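(* Let $H\in(\frac12,1)$, $\alpha>0$, and $N\sim\mathcal N(0,1)$. Let $U$ be the fractional Ornstein-Uhlenbeck process of the second kind with parameter $\alpha$ and $\widehat\alpha_{2,n}=\nu_2^{-1}[Q_{2,n}(U)]$, so that $\nu_2(\widehat\alpha_{2,n})=Q_{2,n}(U)$. Then there exists $C$ depending on $H$ and $\alpha$ such that $$d_W\left(\sqrt{\frac{n}{E[V_{2,n}^2(U^\alpha)]}}\left(\nu_2(\widehat\alpha_{2,n})-\nu_2(\alpha)\right),N\right)\le\frac{C}{\sqrt n}.$$
   Context: The fractional Ornstein-Uhlenbeck process of the second kind $U$ is the solution of $U_0=0$, $dU_t=-\alpha U_tdt+dY^{(1)}_t$, $t\ge0$, where $Y^{(1)}_t=\int_0^te^{-s}dB_{a_s}$, $a_s=He^{s/H}$, and $B$ is a fractional Brownian motion with Hurst parameter $H$; explicitly $U_t=e^{-\alpha t}\int_0^te^{(\alpha-1)s}dB_{a_s}$. Its stationary version is $U^\alpha_t=e^{-\alpha t}\int_{-\infty}^te^{(\alpha-1)s}dB_{a_s}$. For a process $Z$, $Q_{2,n}(Z)=\frac1n\sum_{k=0}^{n-1}(Z_k^2-1)$, and $V_{2,n}(U^\alpha)=\frac1{\sqrt n}\sum_{k=0}^{n-1}\left((U^\alpha_k)^2-E[(U^\alpha_k)^2]\right)$. The function $\nu_2$ is $$\nu_2(\alpha)=\frac{(2H-1)H^{2H}}{\alpha}\beta(1-H+\alpha H,2H-1)-1,\qquad\alpha>0,$$ with $\beta$ the Beta function. $d_W(F,G)=\sup|Ef(F)-Ef(G)|$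 over functions $f$ with Lipschitz constant $\le1$ is the Wasserstein distance. *)

(* Defs.v *)
From HB Require Import structures.
From mathcomp Require Import all_boot all_order all_algebra.
From mathcomp Require Import all_classical all_reals all_analysis.

Set Implicit Arguments.
Unset Strict Implicit.
Unset Printing Implicit Defensive.

Import Order.TTheory GRing.Theory Num.Theory.
Import numFieldNormedType.Exports.

Local Open Scope classical_set_scope.
Local Open Scope ring_scope.

Section gaussian.
Context {d : measure_display} {T : measurableType d} {R : realType}.
Variable P : probability T R.

(* [normal_prob m 0] is, by the library's convention, the uniform law on
   [0, 1]; the degenerate normal law is the Dirac mass at the mean. *)
Definition is_normal (X : T -> R) (m s : R) : Prop :=
  forall A : set R, measurable A ->
    P (X @^-1` A) = if s == 0 then \d_m A else normal_prob m s A.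

Definition gaussian_process (D : set R) (X : R -> {RV P >-> R}) : Prop :=
  forall (n : nat) (t : 'I_n -> R) (c : 'I_n -> R), (forall i, D (t i)) ->
    exists m s : R, is_normal (fun w => \sum_(i < n) c i * X (t i) w) m s.

(* The process is only constrained on the half-line [0, +oo[. *)
Definition fractional_brownian_motion (H : R) (B : R -> {RV P >-> R}) : Prop :=
  [/\ gaussian_process `[0, +oo[ B,
      forall t, 0 <= t -> ('E_P[B t] = 0)%E &
      forall s t, 0 <= s -> 0 <= t ->
        ('E_P[fun w => (B s w * B t w)%R])%E =
        ((s `^ (2 * H) + t `^ (2 * H) - `|t - s| `^ (2 * H)) / 2)%:E].

End gaussian.

Section wiener_integral.
Context {d : measure_display} {T : measurableType d} {R : realType}.
Variable P : probability T R.

Definition riemann_stieltjes_sum (X : R -> T -> R) (f : R -> R)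
    (a b : R) (s : seq R) (c : nat -> R) (w : T) : R :=
  \sum_(0 <= i < size s)
    f (c i) * (X (nth b s i) w - X (nth b (a :: s) i) w).

(* [I] is the integral of the deterministic function [f] with respect to the
   process [X] over [a, b]: the limit in L^2(P) of the Riemann-Stieltjes sums
   over tagged partitions, as the mesh tends to 0. *)
Definition is_integral (X : R -> T -> R) (f : R -> R) (a b : R)
    (I : T -> R) : Prop :=
  forall eps : R, 0 < eps -> exists2 delta : R, 0 < delta &
    forall (s : seq R) (c : nat -> R), itv_partition a b s ->
      (forall i, (i < size s)%N ->
         nth b (a :: s) i <= c i <= nth b s i /\
         nth b s i - nth b (a :: s) i < delta) ->
      ('E_P[fun w => ((riemann_stieltjes_sum X f a b s c w - I w) ^+ 2)%R]
         < eps%:E)%E.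

Definition is_integral_Ny (X : R -> T -> R) (f : R -> R) (b : R)
    (I : T -> R) : Prop :=
  exists2 J : R -> {RV P >-> R},
    forall a, a <= b -> is_integral X f a b (J a) &
    ('E_P[fun w => ((J a w - I w) ^+ 2)%R])%E @[a --> -oo] --> 0%E.

End wiener_integral.

Section fractional_OU_second_kind.
Context {d : measure_display} {T : measurableType d} {R : realType}.
Variable P : probability T R.
Variables H alpha : R.

Definition time_change (s : R) : R := H * expR (s / H).

Definition fOU2 (B U : R -> {RV P >-> R}) : Prop :=
  forall t, 0 <= t -> exists2 I : {RV P >-> R},
    is_integral P (fun s => B (time_change s))
      (fun s => expR ((alpha - 1) * s)) 0 t I &
    forall w, U t w = expR (- alpha * t) * I w.

Definition stationary_fOU2 (B U : R -> {RV P >-> R}) : Prop :=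
  forall t, 0 <= t -> exists2 I : {RV P >-> R},
    is_integral_Ny P (fun s => B (time_change s))
      (fun s => expR ((alpha - 1) * s)) t I &
    forall w, U t w = expR (- alpha * t) * I w.

End fractional_OU_second_kind.

Section estimator.
Context {R : realType}.

Definition Beta (a b : R) : R :=
  \int[lebesgue_measure]_(x in `]0, 1[) (x `^ (a - 1) * (1 - x) `^ (b - 1)).

Definition nu2 (H alpha : R) : R :=
  (2 * H - 1) * H `^ (2 * H) / alpha * Beta (1 - H + alpha * H) (2 * H - 1) - 1.

(* Inverse of [nu2 H] restricted to ]0, +oo[, with value 0 outside the image
   ]-1, +oo[.  The value -1 is attained by [Q2 1 U] since U_0 = 0; as division
   by 0 gives 0, [nu2 H 0 = -1], so that [nu2 H (nu2_inv H (-1)) = -1]. *)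
Definition nu2_inv (H : R) : R -> R := 'pinv_(fun=> 0) `]0, +oo[ (nu2 H).

Context {d : measure_display} {T : measurableType d}.
Variable P : probability T R.

Definition Q2 (n : nat) (Z : R -> T -> R) (w : T) : R :=
  n%:R^-1 * \sum_(0 <= k < n) (Z k%:R w ^+ 2 - 1).

Definition V2 (n : nat) (Z : R -> T -> R) (w : T) : R :=
  (Num.sqrt n%:R)^-1 * \sum_(0 <= k < n)
    (Z k%:R w ^+ 2 - fine ('E_P[fun w' => (Z k%:R w' ^+ 2)%R])%E).

Definition alpha_hat (H : R) (n : nat) (U : R -> T -> R) (w : T) : R :=
  nu2_inv H (Q2 n U w).

End estimator.

Definition wasserstein {R : realType} {d d' : measure_display}
    {T : measurableType d} {T' : measurableType d'}
    (P : probability T R) (P' : probability T' R)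
    (F : T -> R) (G : T' -> R) : \bar R :=
  ereal_sup [set `| 'E_P[f \o F] - 'E_P'[f \o G] |%E
            | f in [set f : R -> R | 1.-lipschitz f]].

(* Main.v *)
(** Since [nu2] maps ]0, +oo[ onto ]-1, +oo[, [nu2 (alpha_hat n)] is [Q2 n U], so
the statement is a quantitative central limit theorem for the sum of the [U_k^2].

Writing Y_s = e^{-s} B_{a_s}, which is stationary with an exponentially decaying
covariance rho, the left Riemann sums of e^{-alpha t} int e^{(alpha-1)s} dB_{a_s} on a
grid of step h are Y_t - q^L Y_{t-Lh} + kappa sum_{j<L} q^j Y_{t-jh}, with
q = e^{-alpha h} and kappa = e^{(1-alpha)h} - 1.  Letting h -> 0 and the left
endpoint go to -oo shows that the variables Ualpha_k belong to one Gaussian space,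
that |E Ualpha_k Ualpha_l| <= C e^{-c|k-l|}, that E Ualpha_k^2 = nu2 alpha + 1 > 0 and
that E (U_k - Ualpha_k)^2 <= C e^{-alpha k}; the last bound replaces U by Ualpha at
cost O(1/sqrt n).

For jointly Gaussian X_i with covariances r_ij, S = sum X_i^2 and
Q = sum r_ij X_i X_j, one has E (S - E S) g(S) = 2 E Q g'(S).  With Stein's equation
f' - x f = h - E h(N) this gives |E h(F) - E h(N)| <= 8 sqrt(Var Q) / Var S for
F = (S - E S) / sqrt(Var S), and exponential decay makes this O(1/sqrt n). *)

Require Import Defs.
From HB Require Import structures.
From mathcomp Require Import all_boot all_order all_algebra.
From mathcomp Require Import all_classical all_reals all_analysis.
From mathcomp Require Import measurable_realfun interval_inference ring lra.

Set Implicit Arguments.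
Unset Strict Implicit.
Unset Printing Implicit Defensive.

Import Order.TTheory GRing.Theory Num.Theory.
Import numFieldNormedType.Exports.
Local Open Scope classical_set_scope.
Local Open Scope ring_scope.

(** * Expectations and square-integrable variables *)

(** Joint Gaussianity is available only through the one-dimensional laws of linear combinations, so
    no density of a vector is at hand and the identity between [S] and [Q] has to come from
    characteristic functions. Differentiating [E cos (th + L)] along directions of the Gaussian
    space gives integration by parts against cosines. It extends to products of cosines, to
    [expR (- s S)], to polynomials in [expR (- a S)], and by uniform approximation to bounded C^1
    functions with bounded derivative, a class that contains the solution of Stein's equation for a
    Lipschitz [h]. The integrals are known only as limits of Riemann-Stieltjes sums, so covariance,
    tail and variance estimates are made for the sums, uniformly in the mesh, and pass to the limit
    through L^2 inner products. The variance appears as [rho 0 + D / alpha], with [D] the integral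
    of [(1 - alpha^2) e^{- alpha w} rho w]; keeping the factor [1 - alpha^2] inside [D] avoids a
    separate case [alpha = 1]. Every estimate on the processes goes through [rho], hence the final
    constant depends on [H] and [alpha] alone. *)

Ltac ge0 := repeat first [ by [] | by apply: ltW | exact: sqr_ge0 | exact: ler0n
  | exact: normr_ge0 | exact: expR_ge0 | exact: sqrtr_ge0 | apply: divr_ge0 | apply: mulr_ge0
  | apply: exprn_ge0 | apply: addr_ge0 | rewrite invr_ge0 ].

Section expectation.
Context {d : measure_display} {T : measurableType d} {R : realType}.
Variable P : probability T R.
Implicit Types X Y Z : T -> R.

Definition intg X := P.-integrable setT (EFin \o X).
(** Real-valued: an infinite integral is read as 0, which is why most rules below carry
    integrability hypotheses. *)
Definition esp X : R := \int[P]_w X w.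

Lemma intg_meas X : intg X -> measurable_fun setT X.
Proof. by move=> /measurable_int /measurable_EFinP. Qed.

Lemma espE X : esp X = fine (\int[P]_w (X w)%:E)%E.
Proof. by []. Qed.

Lemma espEE X : intg X -> (\int[P]_w (X w)%:E)%E = (esp X)%:E.
Proof. by move=> iX; rewrite fineK//; exact: integrable_fin_num. Qed.

Lemma eq_esp X Y : X =1 Y -> esp X = esp Y.
Proof. by move=> /funext ->. Qed.

Lemma eq_intg X Y : X =1 Y -> intg X -> intg Y.
Proof. by move=> /funext ->. Qed.

Lemma intg_cst (k : R) : intg (fun=> k).
Proof. exact: (finite_measure_integrable_cst P k measurableT). Qed.

Lemma intg_dom X Y : measurable_fun setT X -> (forall w, `|X w| <= Y w) ->
  intg Y -> intg X.
Proof.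
move=> mX XY; apply: le_integrable => //; first exact/measurable_EFinP.
by move=> w _ /=; rewrite lee_fin (le_trans (XY w))// ler_norm.
Qed.

Lemma intgD X Y : intg X -> intg Y -> intg (fun w => X w + Y w).
Proof. by move=> iX iY; exact: (integrableD measurableT iX iY). Qed.

Lemma intgZ (k : R) X : intg X -> intg (fun w => k * X w).
Proof. by move=> iX; exact: (integrableZl measurableT k iX). Qed.

Lemma intgN X : intg X -> intg (fun w => - X w).
Proof.
by move=> iX; apply: (@eq_intg (fun w => -1 * X w)); [move=> w; rewrite mulN1r|exact: intgZ].
Qed.

Lemma intgB X Y : intg X -> intg Y -> intg (fun w => X w - Y w).
Proof. by move=> iX iY; apply: intgD => //; exact: intgN. Qed.

Lemma intg_abs X : intg X -> intg (fun w => `|X w|).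
Proof. exact: integrable_norm. Qed.

Lemma intg_sum (I : Type) (s : seq I) (p : pred I) (F : I -> T -> R) :
  (forall i, p i -> intg (F i)) -> intg (fun w => \sum_(i <- s | p i) F i w).
Proof.
move=> iF; elim: s => [|i s ih].
  by apply: eq_intg (intg_cst 0) => w; rewrite big_nil.
case pi : (p i).
  by apply: eq_intg (intgD (iF _ pi) ih) => w; rewrite big_cons pi.
by apply: eq_intg ih => w; rewrite big_cons pi.
Qed.

Lemma intgMb X Y (C : R) : intg X -> measurable_fun setT Y ->
  (forall w, `|Y w| <= C) -> intg (fun w => X w * Y w).
Proof.
move=> iX mY YC; apply: (@intg_dom _ (fun w => C * `|X w|)).
- by apply: measurable_funM => //; exact: intg_meas.
- by move=> w; rewrite normrM mulrC ler_wpM2r.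
- exact/intgZ/intg_abs.
Qed.

Lemma intg_bdd Y (C : R) : measurable_fun setT Y -> (forall w, `|Y w| <= C) -> intg Y.
Proof. by move=> mY YC; apply: (@intg_dom _ (fun=> C)) => //; exact: intg_cst. Qed.

Lemma esp_cst (k : R) : esp (fun=> k) = k.
Proof. by rewrite /esp Rintegral_cst//; have /(congr1 fine) /= -> := probability_setT P; rewrite mulr1. Qed.

Lemma espD X Y : intg X -> intg Y -> esp (fun w => X w + Y w) = esp X + esp Y.
Proof. by move=> iX iY; exact: RintegralD. Qed.

Lemma espB X Y : intg X -> intg Y -> esp (fun w => X w - Y w) = esp X - esp Y.
Proof. by move=> iX iY; exact: RintegralB. Qed.

Lemma espZ (k : R) X : intg X -> esp (fun w => k * X w) = k * esp X.
Proof. by move=> iX; exact: RintegralZl. Qed.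

Lemma espN X : intg X -> esp (fun w => - X w) = - esp X.
Proof.
move=> iX; rewrite (eq_esp (Y := fun w => -1 * X w)); last by move=> w; rewrite mulN1r.
by rewrite espZ// mulN1r.
Qed.

Lemma esp_sum (I : Type) (s : seq I) (p : pred I) (F : I -> T -> R) :
  (forall i, p i -> intg (F i)) ->
  esp (fun w => \sum_(i <- s | p i) F i w) = \sum_(i <- s | p i) esp (F i).
Proof.
move=> iF; elim: s => [|i s ih].
  rewrite big_nil -[RHS](esp_cst 0); apply: eq_esp => w; by rewrite big_nil.
rewrite big_cons; case pi : (p i); last first.
  by rewrite -ih; apply: eq_esp => w; rewrite big_cons pi.
rewrite -ih -espD; [|exact: iF|exact: intg_sum].
by apply: eq_esp => w; rewrite big_cons pi.
Qed.

Lemma esp_ge0 X : (forall w, 0 <= X w) -> 0 <= esp X.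
Proof. by move=> X0; exact: Rintegral_ge0. Qed.

Lemma esp_le X Y : intg X -> intg Y -> (forall w, X w <= Y w) -> esp X <= esp Y.
Proof. by move=> iX iY XY; apply: le_Rintegral. Qed.

Lemma abs_esp X : intg X -> `|esp X| <= esp (fun w => `|X w|).
Proof. by move=> iX; exact: le_normr_Rintegral. Qed.

Lemma abs_esp_le X Y : measurable_fun setT X -> intg Y ->
  (forall w, `|X w| <= Y w) -> `|esp X| <= esp Y.
Proof.
move=> mX iY XY; have iX := intg_dom mX XY iY.
by rewrite (le_trans (abs_esp iX))// esp_le//; exact: intg_abs.
Qed.

Lemma esp_dct (Xn : nat -> T -> R) X Y : (forall n, measurable_fun setT (Xn n)) ->
  (forall w, Xn n w @[n --> \oo] --> X w) ->
  (forall n w, `|Xn n w| <= Y w) -> intg Y ->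
  intg X /\ esp (Xn n) @[n --> \oo] --> esp X.
Proof.
move=> mXn XnX XnY iY.
have mX : measurable_fun setT X.
  by apply: (measurable_fun_cvg mXn) => w _; exact: XnX.
have [iX _ h] : [/\ P.-integrable setT (EFin \o X),
  [sequence \int[P]_w (`|(Xn n w)%:E - (X w)%:E|)]_n @ \oo --> 0 &
  [sequence \int[P]_w (Xn n w)%:E]_n @ \oo --> \int[P]_w (X w)%:E]%E.
  apply: (@dominated_convergence _ T R P setT _ (fun n => EFin \o Xn n) (EFin \o X) (EFin \o Y)) => //.
  - by move=> n; exact/measurable_EFinP.
  - exact/measurable_EFinP.
  - apply: aeW => w _; apply: cvg_EFin; [exact: nearW|exact: XnX].
  - by apply: aeW => w n _; rewrite lee_fin.
split => //; apply: fine_cvg.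
by rewrite -/(esp X) -espEE.
Qed.

(** Serves where a moment is not yet known to be finite, so that no dominating variable exists for
    [esp_dct]: Fatou's lemma bounds the integral of the limit by [C]. *)
Lemma esp_fatou (Xn : nat -> T -> R) X (C : R) : (forall n, intg (Xn n)) ->
  (forall n w, 0 <= Xn n w) ->
  (forall w, Xn n w @[n --> \oo] --> X w) ->
  (forall n, esp (Xn n) <= C) -> intg X.
Proof.
move=> iXn Xn0 XnX XnC.
have mX : measurable_fun setT X.
  by apply: (measurable_fun_cvg (fun n => intg_meas (iXn n))) => w _; exact: XnX.
have X0 w : 0 <= X w.
  rewrite -(cvg_lim _ (XnX w))//; apply: limr_ge; last exact: nearW.
  by apply/cvg_ex; exists (X w); exact: XnX.
apply/integrableP; split; first exact/measurable_EFinP.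
apply: (@le_lt_trans _ _ C%:E); last exact: ltry.
have XE : (\int[P]_w `|(EFin \o X) w| = \int[P]_w (limn_einf (fun n => (EFin \o Xn n) w)))%E.
  apply: eq_integral => w _; rewrite /= ger0_norm//.
  apply/esym; apply: (cvg_limn_einf_sup _).1.
  by apply: cvg_EFin; [exact: nearW|exact: XnX].
rewrite XE; apply: le_trans.
  apply: (@fatou _ T R P setT measurableT (fun n => EFin \o Xn n)) => n.
    by apply/measurable_EFinP; exact: intg_meas.
  by move=> w _; rewrite lee_fin.
have -> : (fun n => \int[P]_w (EFin \o Xn n) w)%E = (fun n => (esp (Xn n))%:E).
  by apply/funext => n; rewrite -espEE.
rewrite limn_einf_lim; apply: lime_le; first exact: is_cvg_einfs.
apply: nearW => n; apply: (@le_trans _ _ (esp (Xn n))%:E); last by rewrite lee_fin.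
by apply: ereal_inf_lbound; exists n => /=.
Qed.

Definition L2 X := measurable_fun setT X /\ intg (fun w => X w ^+ 2).

Lemma L2_meas X : L2 X -> measurable_fun setT X.
Proof. by case. Qed.

Lemma L2_sq X : L2 X -> intg (fun w => X w ^+ 2).
Proof. by case. Qed.

Lemma eq_L2 X Y : X =1 Y -> L2 X -> L2 Y.
Proof. by move=> /funext ->. Qed.

Lemma normM_le_sqr (x y : R) : `|x * y| <= x ^+ 2 + y ^+ 2.
Proof.
rewrite normrM -[x ^+ 2]real_normK ?num_real// -[y ^+ 2]real_normK ?num_real//.
have := normr_ge0 x; have := normr_ge0 y.
by move: `|x| `|y| => a b; nra.
Qed.

Lemma intgM X Y : L2 X -> L2 Y -> intg (fun w => X w * Y w).
Proof.
move=> [mX iX] [mY iY]; apply: (@intg_dom _ (fun w => X w ^+ 2 + Y w ^+ 2)).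
- exact: measurable_funM.
- by move=> w; exact: normM_le_sqr.
- exact: intgD.
Qed.

Lemma L2_bdd X (C : R) : measurable_fun setT X -> (forall w, `|X w| <= C) -> L2 X.
Proof.
move=> mX XC; split => //; apply: (@intg_bdd _ (C ^+ 2)).
  exact: measurable_funX.
by move=> w; rewrite normrX lerXn2r ?nnegrE// (le_trans _ (XC w)).
Qed.

Lemma L2_cst (k : R) : L2 (fun=> k).
Proof. exact: (@L2_bdd _ `|k|). Qed.

Lemma L2_intg X : L2 X -> intg X.
Proof.
move=> hX; apply: eq_intg (intgM hX (L2_cst 1)) => w; by rewrite mulr1.
Qed.

Lemma L2D X Y : L2 X -> L2 Y -> L2 (fun w => X w + Y w).
Proof.
move=> hX hY; split; first by apply: measurable_funD; exact: L2_meas.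
apply: eq_intg (intgD (intgD (L2_sq hX) (intgZ 2 (intgM hX hY))) (L2_sq hY)) => w.
by ring.
Qed.

Lemma L2Z (k : R) X : L2 X -> L2 (fun w => k * X w).
Proof.
move=> hX; split; first by apply: measurable_funM => //; exact: L2_meas.
by apply: eq_intg (intgZ (k ^+ 2) (L2_sq hX)) => w; rewrite exprMn.
Qed.

Lemma L2B X Y : L2 X -> L2 Y -> L2 (fun w => X w - Y w).
Proof.
move=> hX hY; apply: eq_L2 (L2D hX (L2Z (-1) hY)) => w; by rewrite mulN1r.
Qed.

Lemma L2_sum (I : Type) (s : seq I) (p : pred I) (F : I -> T -> R) :
  (forall i, p i -> L2 (F i)) -> L2 (fun w => \sum_(i <- s | p i) F i w).
Proof.
move=> iF; elim: s => [|i s ih].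
  by apply: eq_L2 (L2_cst 0) => w; rewrite big_nil.
case pi : (p i).
  by apply: eq_L2 (L2D (iF _ pi) ih) => w; rewrite big_cons pi.
by apply: eq_L2 ih => w; rewrite big_cons pi.
Qed.

(** The second moment of [s X + t Y] is a nonnegative quadratic form in [(s, t)]; at [(c, - b)] it
    equals [c (a c - b^2)]. When [c = 0] the form is affine in [t], and a suitable [t] would give it
    the value -1 if [b] were nonzero. *)
Lemma esp_cauchy_schwarz X Y : L2 X -> L2 Y ->
  esp (fun w => X w * Y w) ^+ 2 <=
  esp (fun w => X w ^+ 2) * esp (fun w => Y w ^+ 2).
Proof.
move=> hX hY; set a := esp (fun w => X w ^+ 2); set b := esp (fun w => _ * _).
set c := esp (fun w => Y w ^+ 2).
have pos (s t : R) : 0 <= s ^+ 2 * a + 2 * s * t * b + t ^+ 2 * c.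
  suff <- : esp (fun w => (s * X w + t * Y w) ^+ 2) =
      s ^+ 2 * a + 2 * s * t * b + t ^+ 2 * c by apply: esp_ge0 => w; exact: sqr_ge0.
  have i1 := L2_sq hX; have i2 := L2_sq hY; have i3 := intgM hX hY.
  rewrite (eq_esp (Y := fun w => (s ^+ 2 * X w ^+ 2 + 2 * s * t * (X w * Y w))
    + t ^+ 2 * Y w ^+ 2)); last by move=> w; ring.
  by rewrite !espD ?espZ//; repeat (apply: intgD || apply: intgZ).
have a0 : 0 <= a by apply: esp_ge0 => w; exact: sqr_ge0.
have c0 : 0 <= c by apply: esp_ge0 => w; exact: sqr_ge0.
have [c00|c0'] := eqVneq c 0; last first.
  have cp : 0 < c by rewrite lt0r c0' c0.
  have := pos c (- b); rewrite (_ : _ + _ = c * (a * c - b ^+ 2)); last by ring.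
  by rewrite pmulr_rge0// subr_ge0.
have [->|b0] := eqVneq b 0; first by rewrite expr0n mulr_ge0.
have := pos 1 (- (a + 1) / (2 * b)); rewrite c00.
rewrite (_ : _ + _ = -1); first by rewrite ler0N1.
by field.
Qed.

Lemma esp_normM_le X Y : L2 X -> L2 Y ->
  esp (fun w => `|X w * Y w|) <=
  Num.sqrt (esp (fun w => X w ^+ 2)) * Num.sqrt (esp (fun w => Y w ^+ 2)).
Proof.
move=> hX hY; have habs Z : L2 Z -> L2 (fun w => `|Z w|).
  move=> [mZ iZ]; split; first exact: measurableT_comp.
  by apply: eq_intg iZ => w; rewrite real_normK ?num_real.
have E2 Z : esp (fun w => Z w ^+ 2) = esp (fun w => `|Z w| ^+ 2).
  by apply: eq_esp => w; rewrite real_normK ?num_real.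
rewrite -sqrtrM; last by apply: esp_ge0 => w; exact: sqr_ge0.
have h0 : 0 <= esp (fun w => `|X w * Y w|) by apply: esp_ge0.
rewrite -[leLHS]ger0_norm// -sqrtr_sqr; apply: ler_wsqrtr; rewrite E2 [in leRHS]E2.
rewrite (eq_esp (fun w => normrM (X w) (Y w))).
exact: (esp_cauchy_schwarz (habs _ hX) (habs _ hY)).
Qed.

Lemma esp_norm_le X : L2 X ->
  esp (fun w => `|X w|) <= Num.sqrt (esp (fun w => X w ^+ 2)).
Proof.
move=> hX; have := esp_normM_le hX (L2_cst 1).
rewrite expr1n esp_cst sqrtr1 mulr1; congr (_ <= _).
by apply: eq_esp => w; rewrite mulr1.
Qed.

End expectation.

(** * Sequences and derivatives *)

Section real_sequences.
Context {R : realType}.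
Implicit Types u v : nat -> R.

Lemma cvgn_epsP u (l : R) : u n @[n --> \oo] --> l <->
  forall e, 0 < e -> exists N : nat, forall n, (N <= n)%N -> `|u n - l| < e.
Proof.
split=> [/cvgrPdist_lt h e e0|h].
  have [N _ hN] := h e e0; exists N => n Nn; rewrite distrC; exact: hN.
apply/cvgrPdist_lt => e e0; have [N hN] := h e e0.
by exists N => // n /= Nn; rewrite distrC; exact: hN.
Qed.

Lemma cvgn0_squeeze u v : (forall n, `|u n| <= v n) ->
  v n @[n --> \oo] --> (0 : R) -> u n @[n --> \oo] --> (0 : R).
Proof.
move=> uv /cvgn_epsP hv; apply/cvgn_epsP => e /hv[N hN]; exists N => n /hN.
by rewrite !subr0; apply: le_lt_trans; rewrite (le_trans (uv n))// ler_norm.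
Qed.

Lemma cvgn_scale_harmonic (C : R) : C * n.+1%:R^-1 @[n --> \oo] --> (0 : R).
Proof.
rewrite -[X in _ --> X](mulr0 C); apply: cvgM; [exact: cvg_cst|].
exact: (@cvg_harmonic R).
Qed.

Lemma cvgn_bound u (l C : R) : (forall n, `|u n - l| <= C * n.+1%:R^-1) ->
  u n @[n --> \oo] --> l.
Proof.
move=> h; have /cvgn_epsP h0 := cvgn0_squeeze h (cvgn_scale_harmonic C).
apply/cvgn_epsP => e /h0[N hN]; exists N => n /hN; by rewrite subr0.
Qed.

Lemma cvgn_unique u (a b : R) : u n @[n --> \oo] --> a -> u n @[n --> \oo] --> b -> a = b.
Proof. by move=> ha hb; rewrite -(cvg_lim _ ha)// (cvg_lim _ hb). Qed.

Lemma cvgn_le u v (a b : R) : u n @[n --> \oo] --> a -> v n @[n --> \oo] --> b ->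
  (forall n, u n <= v n) -> a <= b.
Proof.
move=> ha hb uv; apply: (ler_cvg_to ha hb); exact: nearW.
Qed.

Lemma cvgn_le_cst u (a b : R) : u n @[n --> \oo] --> a -> (forall n, u n <= b) -> a <= b.
Proof. by move=> ha ub; apply: (cvgn_le ha (cvg_cst b)). Qed.

End real_sequences.

Section derivatives.
Context {R : realType}.
Implicit Types (f g : R -> R) (x a b : R).

Definition isd f x a := is_derive x (1 : R) f a.

(** Derivatives are assembled by composing the rules below; this lemma then replaces the raw result
    by the expected closed form, usually with [ring] or [field]. *)
Lemma isd_eq f x a b : isd f x a -> a = b -> isd f x b.
Proof. by move=> ? <-. Qed.

Lemma eq_isd f g x a : f =1 g -> isd f x a -> isd g x a.
Proof. by move=> /funext ->. Qed.

Lemma isd_cst (k : R) x : isd (fun=> k) x 0.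
Proof. exact: is_derive_cst. Qed.

Lemma isd_id x : isd (fun y => y) x 1.
Proof. exact: is_derive_id. Qed.

Lemma isdD f g x a b : isd f x a -> isd g x b -> isd (fun y => f y + g y) x (a + b).
Proof. by move=> hf hg; exact: is_deriveD. Qed.

Lemma isdN f x a : isd f x a -> isd (fun y => - f y) x (- a).
Proof. by move=> hf; exact: is_deriveN. Qed.

Lemma isdB f g x a b : isd f x a -> isd g x b -> isd (fun y => f y - g y) x (a - b).
Proof. by move=> hf hg; exact: is_deriveB. Qed.

Lemma isdM f g x a b : isd f x a -> isd g x b ->
  isd (fun y => f y * g y) x (a * g x + f x * b).
Proof.
move=> hf hg; apply: (isd_eq (is_deriveM hf hg)).
by rewrite addrC; congr (_ + _); rewrite /GRing.scale /= mulrC.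
Qed.

Lemma isdZ (k : R) f x a : isd f x a -> isd (fun y => k * f y) x (k * a).
Proof.
move=> hf; apply: (isd_eq (isdM (isd_cst k x) hf)); by rewrite mul0r add0r.
Qed.

Lemma isd_comp f g x a b : isd f (g x) a -> isd g x b -> isd (fun y => f (g y)) x (a * b).
Proof. exact: is_derive1_comp. Qed.

Lemma isd_expR f x a : isd f x a -> isd (fun y => expR (f y)) x (expR (f x) * a).
Proof. by move=> hf; apply: isd_comp => //; exact: is_derive_expR. Qed.

Lemma isd_cos f x a : isd f x a -> isd (fun y => cos (f y)) x (- sin (f x) * a).
Proof. by move=> hf; apply: isd_comp => //; exact: is_derive_cos. Qed.

Lemma isd_sin f x a : isd f x a -> isd (fun y => sin (f y)) x (cos (f x) * a).
Proof. by move=> hf; apply: isd_comp => //; exact: is_derive_sin. Qed.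

Lemma isd_powR (p : R) f x a : 0 < f x -> isd f x a ->
  isd (fun y => f y `^ p) x (p * f x `^ (p - 1) * a).
Proof.
by move=> fx hf; apply: (@isd_comp (fun y => y `^ p)) => //; exact: is_derive1_powR.
Qed.

Lemma isd_sqr f x a : isd f x a -> isd (fun y => f y ^+ 2) x (2 * f x * a).
Proof.
move=> hf; apply: (isd_eq (isdM hf hf)); ring.
Qed.

Lemma isd_exprn n f x a : isd f x a ->
  isd (fun y => f y ^+ n.+1) x (n.+1%:R * f x ^+ n * a).
Proof.
move=> hf; elim: n => [|n ih].
  by apply: isd_eq hf _; rewrite expr0 !mul1r.
apply: (@eq_isd (fun y => f y * f y ^+ n.+1)); first by move=> y; rewrite -exprS.
apply: isd_eq (isdM hf ih) _.
by rewrite !exprS -(natr1 n.+1); ring.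
Qed.

Lemma isd_cts f x a : isd f x a -> {for x, continuous f}.
Proof.
by move=> hf; apply: differentiable_continuous; apply/derivable1_diffP; exact: (@ex_derive _ _ _ _ _ _ _ hf).
Qed.

Lemma isd_derivable f x a : isd f x a -> derivable f x 1.
Proof. by move=> hf; exact: (@ex_derive _ _ _ _ _ _ _ hf). Qed.

Lemma isd_derive1 f x a : isd f x a -> f^`()%classic x = a.
Proof. by move=> hf; rewrite derive1E; exact: (@derive_val _ _ _ _ _ _ _ hf). Qed.

Lemma isd_of_derivable f x : derivable f x 1 -> isd f x (f^`()%classic x).
Proof. by move=> hf; apply: DeriveDef => //; rewrite derive1E. Qed.

Lemma cts_meas f : continuous f -> measurable_fun setT f.
Proof. exact: continuous_measurable_fun. Qed.

Lemma isd_lip f df (C : R) : (forall x, isd f x (df x)) -> (forall x, `|df x| <= C) ->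
  forall x y, `|f x - f y| <= C * `|x - y|.
Proof.
move=> hf hC x y; wlog xy : x y / y <= x.
  move=> h; have [|/ltW xy] := leP y x; first exact: h.
  by rewrite distrC (distrC x); exact: h.
have [] := @MVT_segment _ f df y x xy.
- by move=> z _; exact: hf.
- by apply: continuous_subspaceT => z; apply: isd_cts (hf z).
by move=> c _ ->; rewrite normrM ler_wpM2r.
Qed.

End derivatives.

(** * Differentiation of a cosine under the expectation *)

Section derivative_of_expectation.
Context {d : measure_display} {T : measurableType d} {R : realType}.
Variable P : probability T R.
Implicit Types W X Z : T -> R.

Lemma measurable_cos_comp X : measurable_fun setT X -> measurable_fun setT (fun w => cos (X w)).
Proof. by move=> mX; apply: measurableT_comp mX; apply: cts_meas; exact: continuous_cos. Qed.

Lemma measurable_sin_comp X : measurable_fun setT X -> measurable_fun setT (fun w => sin (X w)).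
Proof. by move=> mX; apply: measurableT_comp mX; apply: cts_meas; exact: continuous_sin. Qed.

Lemma norm_cos_le1 (x : R) : `|cos x| <= 1.
Proof. by rewrite ler_norml cos_geN1 cos_le1. Qed.

Lemma norm_sin_le1 (x : R) : `|sin x| <= 1.
Proof. by rewrite ler_norml sin_geN1 sin_le1. Qed.

(** Since [sin] is bounded by 1, [|W X|] dominates the derivative for every [t]. The weight [W] and
    the phase [Z] let the same lemma give first and second derivatives of characteristic
    functions. *)
Lemma isd_esp_cos W X Z (a : R) : intg P W -> measurable_fun setT X ->
  intg P (fun w => W w * X w) -> measurable_fun setT Z ->
  isd (fun t => esp P (fun w => W w * cos (Z w + t * X w))) a
      (- esp P (fun w => W w * X w * sin (Z w + a * X w))).
Proof.
move=> iW mX iWX mZ.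
pose f (t : R) w := W w * cos (Z w + t * X w).
have df t w : isd (f ^~ w) t (- (W w * X w * sin (Z w + t * X w))).
  apply: isd_eq (isdZ _ (isd_cos (isdD (isd_cst _ _) (isdM (isd_id _) (isd_cst _ _))))) _.
  by ring.
have Ia : `]a - 1, a + 1[%classic a by rewrite /= in_itv/= ltrBlDr !ltrDl ltr01.
have h1 t : `]a - 1, a + 1[%classic t -> P.-integrable setT (EFin \o f t).
  move=> _; apply: (intgMb (C := 1)) => //; last by move=> w; exact: norm_cos_le1.
  by apply: measurable_cos_comp; apply: measurable_funD => //; exact: measurable_funM.
have h2 t w : `]a - 1, a + 1[%classic t -> [set: T] w -> derivable (f ^~ w) t 1.
  by move=> _ _; exact: isd_derivable (df t w).
have h3 w : 0 <= `|W w * X w| by [].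
have h4 t w : `]a - 1, a + 1[%classic t -> [set: T] w -> `|partial1of2 f t w| <= `|W w * X w|.
  move=> _ _; rewrite /partial1of2 (isd_derive1 (df t w)) normrN normrM.
  by rewrite ler_piMr// norm_sin_le1.
have -> : - esp P (fun w => W w * X w * sin (Z w + a * X w)) =
    (fun t => esp P (f t))^`()%classic a.
  rewrite (differentiation_under_integral measurableT Ia h1 h2 h3 (intg_abs iWX) h4).
  rewrite -espN; first by apply: eq_esp => w; rewrite /partial1of2 (isd_derive1 (df a w)).
  apply: (intgMb (C := 1)) => //; last by move=> w; exact: norm_sin_le1.
  by apply: measurable_sin_comp; apply: measurable_funD => //; exact: measurable_funM.
apply: isd_of_derivable.
exact: (derivable_under_integral measurableT Ia h1 h2 h3 (intg_abs iWX) h4).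
Qed.

End derivative_of_expectation.

(** * The normal law *)

Section normal_law.
Context {R : realType}.
Notation mu := (@lebesgue_measure R).
Variables (m s : R).
Hypothesis s0 : s != 0.
Local Notation gam := (normal_prob m s).
Local Notation p := (normal_pdf m s).

(** The Radon-Nikodym derivative of the normal law agrees almost everywhere with its density because
    both have the same integral over every measurable set. *)
Lemma normal_Rintegral (f : R -> R) : intg gam f ->
  mu.-integrable setT (EFin \o (fun x => f x * p x)) /\
  esp gam f = \int[mu]_x (f x * p x).
Proof.
move=> intf.
have key (g : R -> R) : intg gam g ->
    (\int[gam]_x (g x)%:E = \int[mu]_x (g x * p x)%:E)%E.
  move=> ig; rewrite -(Radon_Nikodym_change_of_variables (normal_prob_dominates m s))//=.
  apply: ae_eq_integral => //.
  - apply: emeasurable_funM => //; first exact: (measurable_int _ ig).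
    apply: (measurable_int mu); apply: Radon_Nikodym_integrable; exact: normal_prob_dominates.
  - apply/measurable_EFinP/measurable_funM; first exact: intg_meas ig.
    exact: measurable_normal_pdf.
  - under [X in ae_eq _ _ _ X]eq_fun do rewrite EFinM.
    apply: ae_eqe_mul2l => /=.
    rewrite Radon_NikodymE//=; first exact: normal_prob_dominates.
    move=> abmu; case: cid => /= h [h1 h2 h3].
    apply: integral_ae_eq => //=.
      by apply/measurable_EFinP; exact: measurable_normal_pdf.
    by move=> E _ mE; rewrite -h3.
split; last by rewrite espE key.
apply/integrableP; split.
  apply/measurable_EFinP/measurable_funM; first exact: intg_meas intf.
  exact: measurable_normal_pdf.
under eq_integral => x _ do rewrite /= normrM (ger0_norm (normal_pdf_ge0 _ _ _)).
rewrite -key; last exact: intg_abs.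
by rewrite (espEE (intg_abs intf)) ltry.
Qed.

Lemma normal_pdf_expR x : p x = normal_peak s * expR (- ((x - m) ^+ 2 / (2 * s ^+ 2))).
Proof.
rewrite normal_pdfE//; congr (_ * expR _).
by rewrite mulNr; congr (- (_ / _)); rewrite mulr_natl.
Qed.

Lemma isd_normal_pdf x : isd p x (- ((x - m) / s ^+ 2) * p x).
Proof.
apply: (@eq_isd _ (fun x => normal_peak s * expR (- ((x - m) ^+ 2 / (2 * s ^+ 2))))).
  by move=> y; rewrite normal_pdf_expR.
have h : isd (fun y => y - m) x (1 - 0) by apply: isdB; [exact: isd_id|exact: isd_cst].
apply: isd_eq (isdZ _ (isd_expR (isdN (isdM (isd_sqr h) (isd_cst _ x))))) _.
rewrite normal_pdf_expR; move: (expR _) => e; by field.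
Qed.

(** Half of the Gaussian exponent absorbs the factor [|x - m|]; the other half is, up to a constant,
    the density with standard deviation [sqrt 2 * s], which is integrable. *)
Lemma normal_pdf_int_norm : mu.-integrable setT (EFin \o (fun x => `|x - m| * p x)).
Proof.
have s2 : Num.sqrt 2 * s != 0 by rewrite mulf_neq0// gt_eqF// sqrtr_gt0.
have h := integrableZl measurableT ((1 + 4 * s ^+ 2) * normal_peak s / normal_peak (Num.sqrt 2 * s))
   (integrable_normal_pdf m (Num.sqrt 2 * s)).
apply: le_integrable h => //.
  apply/measurable_EFinP/measurable_funM; last exact: measurable_normal_pdf.
  by apply: measurableT_comp => //; apply: measurable_funB.
move=> x _; rewrite /= lee_fin.
rewrite ger0_norm ?mulr_ge0 ?normal_pdf_ge0//.
rewrite (le_trans _ (ler_norm _))// (normal_pdfE m s2) normal_pdf_expR /normal_fun.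
have pk := normal_peak_gt0 s2.
rewrite [leRHS](_ : _ = normal_peak s * ((1 + 4 * s ^+ 2) *
    expR (- (x - m) ^+ 2 / ((Num.sqrt 2 * s) ^+ 2 *+ 2)))); last first.
  by move: (expR _) => e; field; rewrite gt_eqF.
rewrite mulrCA ler_wpM2l ?normal_peak_ge0//.
set u := (x - m) ^+ 2 / (4 * s ^+ 2).
have -> : - (x - m) ^+ 2 / ((Num.sqrt 2 * s) ^+ 2 *+ 2) = - u.
  by rewrite /u exprMn sqr_sqrtr//; field.
have -> : - ((x - m) ^+ 2 / (2 * s ^+ 2)) = - u - u by rewrite /u; field.
rewrite expRD mulrA ler_wpM2r ?expR_ge0// expRN ler_pdivrMr ?expR_gt0//.
have s2p : 0 < s ^+ 2 by rewrite exprn_even_gt0.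
have hu : 0 <= u by rewrite /u divr_ge0 ?sqr_ge0// mulr_ge0// ltW.
have e1 := expR_ge1Dx u.
have -> : `|x - m| <= 1 + 4 * s ^+ 2 * u -> `|x - m| <= (1 + 4 * s ^+ 2) * expR u.
  move=> /le_trans; apply; nra.
by [].
have -> : 4 * s ^+ 2 * u = `|x - m| ^+ 2 by rewrite /u real_normK ?num_real//; field.
by have := normr_ge0 (x - m); move: `|x - m| => a; nra.
Qed.

(** [normal_Rintegral] presupposes integrability under the normal law, so it is applied to the
    bounded truncations of [|x - m|], and Fatou's lemma concludes. *)
Lemma normal_intg_norm : intg gam (fun x => `|x - m|).
Proof.
pose Xn (n : nat) (x : R) := Num.min `|x - m| n%:R.
have mabs : measurable_fun setT (fun x : R => `|x - m|).
  by apply: measurableT_comp => //; apply: measurable_funB.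
have mXn n : measurable_fun setT (Xn n) by apply: measurable_minr.
have X0 n x : 0 <= Xn n x by rewrite le_min normr_ge0/=.
have iXn n : intg gam (Xn n).
  apply: (@intg_bdd _ _ _ gam _ n%:R); first exact: mXn.
  by move=> w; rewrite ger0_norm// ge_min lexx orbT.
apply: (@esp_fatou _ _ _ gam Xn _ (\int[mu]_x (`|x - m| * p x))) => //.
- move=> x; apply: cvg_near_cst.
  exists (Num.bound `|x - m|) => // n /= hn; apply/min_idPl.
  apply: ltW; apply: lt_le_trans (archi_boundP _) _ => //.
  by rewrite ler_nat.
- move=> n; have [i1 ->] := normal_Rintegral (iXn n).
  apply: le_Rintegral => //; first exact: normal_pdf_int_norm.
  move=> x _; rewrite ler_wpM2r ?normal_pdf_ge0//; by rewrite ge_min lexx.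
Qed.

Lemma normal_ibp (g dg : R -> R) (C : R) : (forall x, isd g x (dg x)) ->
  continuous dg -> (forall x, `|g x| <= C) -> (forall x, `|dg x| <= C) ->
  esp gam (fun x => (x - m) * g x) = s ^+ 2 * esp gam dg.
Proof.
move=> hg cdg gC dgC.
have s2p : 0 < s ^+ 2 by rewrite exprn_even_gt0.
have C0 : 0 <= C by rewrite (le_trans _ (gC 0)).
have mg : measurable_fun setT g by apply: cts_meas => x; exact: isd_cts (hg x).
have mdg : measurable_fun setT dg by exact: cts_meas.
have mid : measurable_fun setT (fun x : R => x - m) by apply: measurable_funB.
have i1 : intg gam (fun x => (x - m) * g x).
  apply: (@intg_dom _ _ _ gam _ (fun x => C * `|x - m|)).
  - exact: measurable_funM.
  - by move=> x; rewrite normrM mulrC ler_wpM2r.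
  - by apply: intgZ; exact: normal_intg_norm.
have i2 : intg gam dg by apply: (@intg_bdd _ _ _ gam _ C).
pose H x := (x - m) * g x - s ^+ 2 * dg x.
have iH : intg gam H by apply: intgB => //; exact: intgZ.
suff : esp gam H = 0.
  by rewrite espB ?espZ//; [move/subr0_eq|exact: intgZ].
pose I n := `[m - n.+1%:R, m + n.+1%:R]%classic.
pose Hn n x := H x * \1_(I n) x.
have mHn n : measurable_fun setT (Hn n).
  by apply: measurable_funM; [exact: intg_meas iH|by apply: measurable_indic; exact: measurable_itv].
have HnH x : Hn n x @[n --> \oo] --> H x.
  apply: cvg_near_cst; exists (Num.bound `|x - m|) => // n /= hn.
  have : `|x - m| <= n.+1%:R.
    apply: ltW; apply: lt_le_trans (archi_boundP _) _ => //.
    by rewrite ler_nat (leq_trans hn).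
  rewrite ler_norml => /andP[h1 h2].
  rewrite /Hn indicE mem_set ?mulr1// /I/= in_itv/=; apply/andP; lra.
have Hnb n x : `|Hn n x| <= `|H x|.
  by rewrite /Hn normrM ler_piMr// indicE; case: (_ \in _); rewrite ?normr1 ?normr0.
have [_ cvH] := @esp_dct _ _ _ gam Hn H _ mHn HnH Hnb (intg_abs iH).
(* Since [p' = - ((x - m) / s^2) p], this is a primitive of [H p]. The integral over [I n] is then a
   boundary term, which tends to 0 because [g] is bounded and [p] decays. *)
pose G x := - s ^+ 2 * g x * p x.
have hG x : isd G x (H x * p x).
  apply: isd_eq (isdM (isdZ _ (hg x)) (isd_normal_pdf x)) _.
  by rewrite /H; field.
have cH : continuous H.
  move=> x; apply: cvgB; apply: cvgM => //.
  - by apply: cvgB => //; exact: cvg_cst.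
  - exact: isd_cts (hg x).
  - exact: cvg_cst.
  - exact: cdg.
have En n : esp gam (Hn n) = G (m + n.+1%:R) - G (m - n.+1%:R).
  have iHn : intg gam (Hn n) := @intg_dom _ _ _ gam (Hn n) _ (mHn n) (Hnb n) (intg_abs iH).
  have [_ ->] := normal_Rintegral iHn.
  have ab : m - n.+1%:R < m + n.+1%:R by have := ltr0Sn R n; lra.
  rewrite /Rintegral.
  have -> : (\int[mu]_x (Hn n x * p x)%:E)%E = (\int[mu]_(x in I n) (H x * p x)%:E)%E.
    rewrite [RHS]integral_mkcond; apply: eq_integral => x _.
    rewrite patchE /Hn indicE; case: ifPn => _; first by rewrite mulr1.
    by rewrite mulr0 mul0r.
  rewrite (@continuous_FTC2 _ _ G)//.
  - apply: continuous_subspaceT => x; apply: cvgM; [exact: cH|].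
    exact: isd_cts (isd_normal_pdf x).
  - split.
    + by move=> x _; exact: isd_derivable (hG x).
    + by apply: cvg_at_right_filter; exact: isd_cts (hG _).
    + by apply: cvg_at_left_filter; exact: isd_cts (hG _).
  - by move=> x _; exact: isd_derive1 (hG x).
have small n : `|esp gam (Hn n)| <= 4 * C * normal_peak s * s ^+ 2 ^+ 2 * n.+1%:R^-1.
  (* A crude decay is enough: with [N = n.+1], [exp (- u) <= 1 / (1 + u)] for [u = N^2 / (2 s^2)],
     and [N^2 >= N] gives the rate [1 / N]. *)
  have hp (b : R) : b ^+ 2 = n.+1%:R ^+ 2 -> p (m + b) <= normal_peak s * (2 * s ^+ 2 * n.+1%:R^-1).
    move=> hb; rewrite normal_pdf_expR ler_wpM2l ?normal_peak_ge0//.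
    rewrite addrAC subrr add0r hb expRN.
    have N1 : (1 : R) <= n.+1%:R by rewrite ler1n.
    move: (n.+1%:R) N1 => N N1; have N0 : 0 < N by lra.
    have u0 : 0 < 1 + N ^+ 2 / (2 * s ^+ 2).
      by rewrite ltr_pwDl// divr_ge0 ?sqr_ge0// mulr_ge0 ?sqr_ge0.
    have s4 : 0 < 2 * s ^+ 2 by rewrite mulr_gt0.
    have e1 := expR_ge1Dx (N ^+ 2 / (2 * s ^+ 2)).
    apply: (@le_trans _ _ (1 + N ^+ 2 / (2 * s ^+ 2))^-1).
      by rewrite lef_pV2 ?posrE// expR_gt0.
    rewrite -[leRHS]invrK lef_pV2 ?posrE//; last first.
      by rewrite invr_gt0 divr_gt0.
    rewrite invf_div ler_pdivrMr// mulrDl mul1r divfK ?gt_eqF//; nra.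
  have hG2 (b : R) : b ^+ 2 = n.+1%:R ^+ 2 ->
      `|G (m + b)| <= 2 * C * normal_peak s * s ^+ 2 ^+ 2 * n.+1%:R^-1.
    move=> hb; rewrite /G !normrM normrN (ger0_norm (ltW s2p)) (ger0_norm (normal_pdf_ge0 _ _ _)).
    rewrite [leRHS](_ : _ = s ^+ 2 * C * (normal_peak s * (2 * s ^+ 2 * n.+1%:R^-1))); last by ring.
    by apply: ler_pM => //; [rewrite mulr_ge0// ltW|exact: normal_pdf_ge0|
      rewrite ler_wpM2l// ltW|exact: hp].
  rewrite En (le_trans (ler_normB _ _))//.
  rewrite [leRHS](_ : _ = 2 * C * normal_peak s * s ^+ 2 ^+ 2 * n.+1%:R^-1 +
    2 * C * normal_peak s * s ^+ 2 ^+ 2 * n.+1%:R^-1); last by ring.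
  by apply: lerD; apply: hG2 => //; exact: sqrrN.
have c0 : esp gam (Hn n) @[n --> \oo] --> (0 : R).
  by apply: cvgn0_squeeze small _; exact: cvgn_scale_harmonic.
exact: cvgn_unique cvH c0.
Qed.

(** Integration by parts turns the derivative in [t] into the linear equation [F' = - s^2 t F]. The
    free phase [th] lets one real statement carry both the real and the imaginary part of the
    characteristic function. *)
Lemma normal_charfun (th t : R) :
  esp gam (fun x => cos (th + t * (x - m))) = cos th * expR (- (s ^+ 2 * t ^+ 2 / 2)).
Proof.
have mid : measurable_fun setT (fun x : R => x - m) by apply: measurable_funB.
have ib : intg gam (fun x => x - m).
  by apply: (@intg_dom _ _ _ gam _ (fun x => `|x - m|)) => //; exact: normal_intg_norm.
pose F u := esp gam (fun x => cos (th + u * (x - m))).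
move: t; have dF t : isd F t (- s ^+ 2 * t * F t).
  have h := @isd_esp_cos _ _ _ gam (fun=> 1) (fun x => x - m) (fun=> th) t
    (intg_cst _ 1) mid.
  have h' := h _ (@measurable_cst _ _ _ _ _ _).
  have E : (fun t0 => esp gam (fun w => 1 * cos (th + t0 * (w - m)))) = F.
    by apply/funext => u; apply: eq_esp => w; rewrite mul1r.
  rewrite E in h'; apply: isd_eq (h' _) _.
    by apply: eq_intg ib => x; rewrite mul1r.
  pose g x := sin (th + t * (x - m)).
  have hg x : isd g x (cos (th + t * (x - m)) * t).
    apply: isd_eq (isd_sin (isdD (isd_cst _ _) (isdZ _ (isdB (isd_id _) (isd_cst _ _))))) _.
    by ring.
  have gC x : `|g x| <= 1 + `|t| by rewrite (le_trans (norm_sin_le1 _))// lerDl.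
  have dgC x : `|cos (th + t * (x - m)) * t| <= 1 + `|t|.
    rewrite normrM; have := norm_cos_le1 (th + t * (x - m)).
    have := normr_ge0 t; move: `|t| `|cos _| => a b; nra.
  have cdg : continuous (fun x => cos (th + t * (x - m)) * t).
    move=> x; apply: isd_cts.
    by apply: isdM; [apply: isd_cos; apply: isdD; [exact: isd_cst|apply: isdZ; apply: isdB;
      [exact: isd_id|exact: isd_cst]]|exact: isd_cst].
  have := normal_ibp hg cdg gC dgC.
  rewrite (eq_esp gam (Y := fun w => 1 * (w - m) * sin (th + t * (w - m)))) => [->|w]; last by rewrite mul1r.
  have -> : esp gam (fun x => cos (th + t * (x - m)) * t) = t * F t.
    rewrite -espZ; first by apply: eq_esp => x; rewrite mulrC.
    apply: (@intg_bdd _ _ _ gam _ 1); last by move=> w; exact: norm_cos_le1.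
    by apply: measurable_cos_comp; apply: measurable_funD => //; exact: measurable_funM.
  by rewrite mulrA !mulNr.
have dG t : isd (fun t => F t * expR (s ^+ 2 * t ^+ 2 / 2)) t 0.
  apply: isd_eq (isdM (dF t) (isd_expR (isdM (isdZ _ (isd_sqr (isd_id t))) (isd_cst _ _)))) _.
  by move: (expR _) (F t) => a b; field.
have F0 : F 0 = cos th.
  by rewrite -[RHS](esp_cst gam); apply: eq_esp => x; rewrite mul0r addr0.
move=> t; have := is_derive_0_is_cst t 0 dG.
rewrite F0 expr0n/= mulr0 mul0r expR0 mulr1 => <-.
by rewrite -mulrA -expRD subrr expR0 mulr1.
Qed.

End normal_law.

(** * Expectations depend only on the law *)

Section law_transfer.
Context {d d' : measure_display} {T : measurableType d} {Y : measurableType d'} {R : realType}.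
Variables (P : probability T R) (nu : probability Y R) (X : T -> Y).
Hypothesis mX : measurable_fun setT X.
Hypothesis lawX : forall A : set Y, measurable A -> P (X @^-1` A) = nu A.

Lemma intg_law (g : Y -> R) : measurable_fun setT g ->
  intg P (fun w => g (X w)) <-> intg nu g.
Proof.
move=> mg.
have E : (\int[P]_w `|(g (X w))%:E| = \int[nu]_y `|(g y)%:E|)%E.
  have mE : measurable_fun setT (fun y => `|(g y)%:E|%E).
    by apply: measurableT_comp => //; exact/measurable_EFinP.
  transitivity (\int[pushforward P X]_y `|(g y)%:E|)%E.
    by rewrite ge0_integral_pushforward.
  by apply: eq_measure_integral => A mA _; exact: lawX.
split=> /integrableP[h1 h2]; apply/integrableP; split.
- exact/measurable_EFinP.
- by rewrite -E.
- by apply/measurable_EFinP; exact: measurableT_comp mX.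
- by rewrite E.
Qed.

Lemma esp_law (g : Y -> R) : measurable_fun setT g -> intg P (fun w => g (X w)) ->
  esp P (fun w => g (X w)) = esp nu g.
Proof.
move=> mg ig; rewrite !espE; congr fine.
transitivity (\int[pushforward P X]_y (g y)%:E)%E.
  by rewrite integral_pushforward//; exact/measurable_EFinP.
by apply: eq_measure_integral => A mA _; exact: lawX.
Qed.

End law_transfer.

Section is_normal_expectation.
Context {d : measure_display} {T : measurableType d} {R : realType}.
Variable P : probability T R.

Lemma is_normal_charfun (X : T -> R) (m s th t : R) : measurable_fun setT X ->
  is_normal P X m s ->
  esp P (fun w => cos (th + t * X w)) = cos (th + t * m) * expR (- (s ^+ 2 * t ^+ 2 / 2)).
Proof.
move=> mX hX.
have mc : measurable_fun setT (fun x : R => cos (th + t * x)).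
  by apply: measurable_cos_comp; apply: measurable_funD => //; exact: measurable_funM.
have ic : intg P (fun w => cos (th + t * X w)).
  apply: (@intg_bdd _ _ _ P _ 1); first exact: measurableT_comp mc mX.
  by move=> w; exact: norm_cos_le1.
have [s0|s0] := eqVneq s 0.
  rewrite (@esp_law _ _ _ _ _ P (\d_m : probability R R) X mX _ _ mc ic).
    rewrite s0 expr0n/= mul0r mul0r oppr0 expR0 mulr1 espE integral_dirac//.
      by rewrite diracT mul1e.
    exact/measurable_EFinP.
  by move=> A mA; rewrite (hX A mA) s0 eqxx.
rewrite (@esp_law _ _ _ _ _ P (normal_prob m s) X mX _ _ mc ic).
  rewrite -(normal_charfun m s0); apply: eq_esp => x; congr cos; ring.
by move=> A mA; rewrite (hX A mA) (negbTE s0).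
Qed.

End is_normal_expectation.

(** * Gaussian spaces *)

Section taylor_bounds.
Context {R : realType}.
Implicit Types x y : R.

(** The Taylor bounds that follow form a ladder: the derivative of each is the preceding one, and
    this lemma climbs one step. *)
Lemma ge0_of_isd (f df : R -> R) : (forall x, isd f x (df x)) ->
  (forall x, 0 <= x -> 0 <= df x) -> 0 <= f 0 -> forall x, 0 <= x -> 0 <= f x.
Proof.
move=> hf df0 f0 x x0.
have [] := @MVT_segment _ f df 0 x x0.
- by move=> y _; exact: hf.
- by apply: continuous_subspaceT => y; exact: isd_cts (hf y).
move=> c; rewrite in_itv/= => /andP[c0 _] e.
have : 0 <= f x - f 0 by rewrite e subr0 mulr_ge0// df0.
by rewrite subr_ge0; exact: le_trans.
Qed.

Lemma sin_le x : 0 <= x -> sin x <= x.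
Proof.
move=> x0; rewrite -subr_ge0; move: x x0.
apply: (@ge0_of_isd _ (fun x => 1 - cos x * 1)).
- by move=> x; apply: isdB (isd_id x) (isd_sin (isd_id x)).
- by move=> x _; rewrite mulr1 subr_ge0 cos_le1.
- by rewrite sin0 subr0.
Qed.

Lemma cos_ge_ge0 x : 0 <= x -> 1 - x ^+ 2 / 2 <= cos x.
Proof.
move=> x0; rewrite -subr_ge0; move: x x0.
apply: (@ge0_of_isd _ (fun x => x - sin x)).
- move=> x; apply: isd_eq (isdB (isd_cos (isd_id x)) (isdB (isd_cst 1 x) (isdM (isd_sqr (isd_id x)) (isd_cst _ x)))) _.
  by field.
- by move=> x /sin_le; rewrite subr_ge0.
- by rewrite cos0 expr0n/= mul0r subr0 subrr.
Qed.

Lemma sin_ge x : 0 <= x -> x - x ^+ 3 / 6 <= sin x.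
Proof.
move=> x0; rewrite -subr_ge0; move: x x0.
apply: (@ge0_of_isd _ (fun x => cos x - (1 - x ^+ 2 / 2))).
- move=> x; apply: isd_eq (isdB (isd_sin (isd_id x)) (isdB (isd_id x) (isdM (isd_exprn 2 (isd_id x)) (isd_cst _ x)))) _.
  by field.
- by move=> x /cos_ge_ge0; rewrite subr_ge0.
- by rewrite sin0 expr0n/= mul0r !subr0.
Qed.

Lemma cos_le_ge0 x : 0 <= x -> cos x <= 1 - x ^+ 2 / 2 + x ^+ 4 / 24.
Proof.
move=> x0; rewrite -subr_ge0; move: x x0.
apply: (@ge0_of_isd _ (fun x => sin x - (x - x ^+ 3 / 6))).
- move=> x; apply: isd_eq (isdB (isdD (isdB (isd_cst 1 x) (isdM (isd_sqr (isd_id x)) (isd_cst _ x)))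
    (isdM (isd_exprn 3 (isd_id x)) (isd_cst _ x))) (isd_cos (isd_id x))) _.
  by field.
- by move=> x /sin_ge; rewrite subr_ge0.
- by rewrite cos0 !expr0n/= !mul0r subr0 addr0 subrr.
Qed.

Lemma cos_ge x : 1 - x ^+ 2 / 2 <= cos x.
Proof.
have [/cos_ge_ge0//|/ltW x0] := leP 0 x.
by rewrite -cosN -sqrrN cos_ge_ge0// oppr_ge0.
Qed.

Lemma cos_le x : cos x <= 1 - x ^+ 2 / 2 + x ^+ 4 / 24.
Proof.
have [/cos_le_ge0//|/ltW x0] := leP 0 x.
have e : x ^+ 4 = (- x) ^+ 4 by ring.
by rewrite -cosN -sqrrN e cos_le_ge0// oppr_ge0.
Qed.

Lemma expRN_le2 x : 0 <= x -> expR (- x) <= 1 - x + x ^+ 2 / 2.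
Proof.
move=> x0; rewrite -subr_ge0; move: x x0.
apply: (@ge0_of_isd _ (fun x => expR (- x) - (1 - x))).
- move=> x; apply: isd_eq (isdB (isdD (isdB (isd_cst 1 x) (isd_id x)) (isdM (isd_sqr (isd_id x)) (isd_cst _ x))) (isd_expR (isdN (isd_id x)))) _.
  by field.
- by move=> x _; rewrite subr_ge0; exact: (expR_ge1Dx (- x)).
- by rewrite !(oppr0,expR0,expr0n,mul0r,subr0,addr0,subrr)/=.
Qed.

Lemma expRN_ge3 x : 0 <= x -> 1 - x + x ^+ 2 / 2 - x ^+ 3 / 6 <= expR (- x).
Proof.
move=> x0; rewrite -subr_ge0; move: x x0.
apply: (@ge0_of_isd _ (fun x => 1 - x + x ^+ 2 / 2 - expR (- x))).
- move=> x; apply: isd_eq (isdB (isd_expR (isdN (isd_id x))) (isdB (isdD (isdB (isd_cst 1 x) (isd_id x)) (isdM (isd_sqr (isd_id x)) (isd_cst _ x))) (isdM (isd_exprn 2 (isd_id x)) (isd_cst _ x)))) _.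
  by field.
- by move=> x /expRN_le2; rewrite subr_ge0.
- by rewrite !(oppr0,expR0,expr0n,mul0r,subr0,addr0,subrr)/=.
Qed.

Lemma cos_sub_gauss x : `|cos x - expR (- (x ^+ 2 / 2))| <= x ^+ 4.
Proof.
have h0 : 0 <= x ^+ 2 / 2 by rewrite divr_ge0 ?sqr_ge0.
have h1 := expRN_le2 h0; have h2 := expR_ge1Dx (- (x ^+ 2 / 2)).
have h3 := cos_ge x; have h4 := cos_le x.
have e : x ^+ 4 = (x ^+ 2) ^+ 2 by ring.
rewrite ler_norml; move: (expR _) (cos x) h1 h2 h3 h4; rewrite e.
move: (x ^+ 2) (sqr_ge0 x) => y y0 a b; nra.
Qed.

Lemma norm_subX_le (a b : R) (N : nat) : `|a| <= 1 -> `|b| <= 1 ->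
  `|a ^+ N - b ^+ N| <= N%:R * `|a - b|.
Proof.
move=> a1 b1; elim: N => [|N ih]; first by rewrite !expr0 subrr normr0 mul0r.
have -> : a ^+ N.+1 - b ^+ N.+1 = a * (a ^+ N - b ^+ N) + (a - b) * b ^+ N.
  by rewrite !exprS; ring.
rewrite (le_trans (ler_normD _ _))// -[in leRHS]natr1 [leRHS]mulrDl mul1r lerD//.
  by rewrite normrM (le_trans _ ih)// ler_piMl.
by rewrite normrM ler_piMr// normrX exprn_ile1.
Qed.

End taylor_bounds.

(** * Moments and integration by parts in a Gaussian space *)

Section gaussian_variables.
Context {d : measure_display} {T : measurableType d} {R : realType}.
Variable P : probability T R.
Implicit Types X Y Z L : T -> R.
Local Notation E := (esp P).

(** The centred normal law, variance 0 included, encoded by its characteristic function with a free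
    phase. Only expectations of squares and of cosines occur, so the property survives L^2
    limits. *)
Definition gaussRV Z := L2 P Z /\ forall th t : R,
  E (fun w => cos (th + t * Z w)) = cos th * expR (- (E (fun w => Z w ^+ 2) * t ^+ 2 / 2)).

(* The nonnegative variables [2 (1 - cos (t Z))^2 / t^4] are dominated by their limit
   [Z^4 / 2] and their expectations are read off the characteristic function; Fatou's lemma
   gives integrability and dominated convergence the value. *)
Lemma gauss_fourth Z : gaussRV Z ->
  intg P (fun w => Z w ^+ 4) /\ E (fun w => Z w ^+ 4) = 3 * E (fun w => Z w ^+ 2) ^+ 2.
Proof.
move=> [hZ cZ]; set v := E (fun w => Z w ^+ 2) in cZ *.
have v0 : 0 <= v by apply: esp_ge0 => w; exact: sqr_ge0.
have mZ := L2_meas hZ.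
pose t (n : nat) : R := n.+1%:R^-1.
have t0 n : 0 < t n by rewrite invr_gt0.
have t1 n : t n <= 1 by rewrite invf_le1// ler1n.
pose Xn n w := 2 * ((1 - cos (t n * Z w)) / t n ^+ 2) ^+ 2.
have mc (s : R) : measurable_fun setT (fun w => cos (s * Z w)).
  by apply: measurable_cos_comp; exact: measurable_funM.
have ic (s : R) : intg P (fun w => cos (s * Z w)).
  by apply: (@intg_bdd _ _ _ P _ 1) => // w; exact: norm_cos_le1.
have Ec (s : R) : E (fun w => cos (s * Z w)) = expR (- (v * s ^+ 2 / 2)).
  rewrite -[RHS]mul1r -[X in X * _]cos0 -cZ; apply: eq_esp => w; by rewrite add0r.
have XnE n w : Xn n w = t n ^- 4 * ((3 - 4 * cos (t n * Z w)) + cos (2 * t n * Z w)).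
  have -> : 2 * t n * Z w = t n * Z w + t n * Z w by ring.
  rewrite /Xn cosD -!expr2.
  have := cos2Dsin2 (t n * Z w); move: (cos _) (sin _) => a b ab.
  have -> : b ^+ 2 = 1 - a ^+ 2 by rewrite -ab addrC addKr.
  by have := t0 n; move: (t n) => s s0; field; rewrite gt_eqF.
have iXn n : intg P (Xn n).
  apply: (@eq_intg _ _ _ P (fun w => t n ^- 4 * ((3 - 4 * cos (t n * Z w)) + cos (2 * t n * Z w)))).
    by move=> w; rewrite XnE.
  by apply: intgZ; apply: intgD => //; apply: intgB; [exact: intg_cst|exact: intgZ].
have EXn n : E (Xn n) = t n ^- 4 * (3 - 4 * expR (- (v * t n ^+ 2 / 2)) + expR (- (v * (2 * t n) ^+ 2 / 2))).
  rewrite (eq_esp P (XnE n)) espZ; last first.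
    by apply: intgD => //; apply: intgB; [exact: intg_cst|exact: intgZ].
  rewrite espD ?espB ?espZ ?esp_cst ?Ec//; [exact: intg_cst|exact: intgZ|].
  by apply: intgB; [exact: intg_cst|exact: intgZ].
have EXn_lim n : `|E (Xn n) - 3 * v ^+ 2 / 2| <= 2 * v ^+ 3 * n.+1%:R^-1.
  rewrite EXn -/(t n); have := t1 n; have := t0 n; move: (t n) => s s0 s1.
  have u0 : 0 <= v * s ^+ 2 / 2 by ge0.
  have w0 : 0 <= v * (2 * s) ^+ 2 / 2 by ge0.
  have h1 := expRN_le2 u0; have h2 := expRN_ge3 u0.
  have h3 := expRN_le2 w0; have h4 := expRN_ge3 w0.
  have s4 : 0 < s ^+ 4 by rewrite exprn_gt0.
  rewrite -(ler_pM2l s4) -{1}(ger0_norm (ltW s4)) -normrM mulrBr mulrA divff ?gt_eqF// mul1r.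
  have b1 : s ^+ 6 * v ^+ 3 <= s ^+ 4 * (v ^+ 3 * s).
    rewrite (_ : s ^+ 6 = s ^+ 4 * s * s); last by ring.
    rewrite (_ : _ * v ^+ 3 = s ^+ 4 * (v ^+ 3 * s) * s); last by ring.
    by rewrite ler_piMr//; ge0.
  have b0 : 0 <= s ^+ 6 * v ^+ 3 by rewrite mulr_ge0// exprn_ge0// ltW.
  have e1 : (v * s ^+ 2 / 2) ^+ 3 = s ^+ 6 * v ^+ 3 / 8 by field.
  have e2 : (v * (2 * s) ^+ 2 / 2) ^+ 3 = 8 * (s ^+ 6 * v ^+ 3) by field.
  rewrite e1 in h2; rewrite e2 in h4.
  move: (expR _) (expR _) h1 h2 h3 h4 => x y h1 h2 h3 h4.
  rewrite (_ : s ^+ 4 * (2 * v ^+ 3 * s) = 2 * (s ^+ 4 * (v ^+ 3 * s))); last by ring.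
  move: (s ^+ 6 * v ^+ 3) (s ^+ 4 * (v ^+ 3 * s)) b0 b1 h2 h4 => p q b0 b1 h2 h4.
  rewrite ler_norml; apply/andP; split; nra.
have cosb n w : 0 <= (1 - cos (t n * Z w)) / t n ^+ 2 <= Z w ^+ 2 / 2 /\
    Z w ^+ 2 / 2 - (1 - cos (t n * Z w)) / t n ^+ 2 <= Z w ^+ 4 / 24 * n.+1%:R^-1.
  rewrite -/(t n); have := t1 n; have := t0 n; move: (t n) (Z w) => s z s0 s1.
  have h1 := cos_ge (s * z); have h2 := cos_le (s * z); have h3 := cos_le1 (s * z).
  have s2 : 0 < s ^+ 2 by rewrite exprn_gt0.
  split; first (apply/andP; split).
  - by rewrite divr_ge0 ?subr_ge0 ?sqr_ge0.
  - rewrite ler_pdivrMr//; move: h1; rewrite exprMn; lra.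
  - rewrite lerBlDr -lerBlDl ler_pdivlMr// mulrBl.
    have h4 : z ^+ 4 / 24 * s * s ^+ 2 >= (s * z) ^+ 4 / 24.
      rewrite (_ : (s * z) ^+ 4 / 24 = z ^+ 4 / 24 * s * s ^+ 2 * s); last by ring.
      have z4 : 0 <= z ^+ 4 by rewrite exprn_even_ge0.
      by rewrite ler_piMr//; ge0.
    move: h2 h4; rewrite exprMn; lra.
have XnX w : Xn n w @[n --> \oo] --> Z w ^+ 4 / 2.
  have h : (1 - cos (t n * Z w)) / t n ^+ 2 @[n --> \oo] --> Z w ^+ 2 / 2.
    apply: (@cvgn_bound _ _ _ (Z w ^+ 4 / 24)) => n.
    have [/andP[_ a] b] := cosb n w.
    by rewrite distrC ger0_norm ?subr_ge0.
  rewrite (_ : Z w ^+ 4 / 2 = 2 * (Z w ^+ 2 / 2 * (Z w ^+ 2 / 2))); last by field.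
  by apply: cvgM; [exact: cvg_cst|exact: cvgM].
have Xn4 n w : `|Xn n w| <= Z w ^+ 4 / 2.
  rewrite /Xn ger0_norm; last by rewrite mulr_ge0// sqr_ge0.
  have [/andP[a b] _] := cosb n w.
  rewrite (_ : Z w ^+ 4 / 2 = 2 * ((Z w ^+ 2 / 2) ^+ 2)); last by field.
  by rewrite ler_wpM2l// lerXn2r// nnegrE; ge0.
have i4 : intg P (fun w => Z w ^+ 4 / 2).
  apply: (@esp_fatou _ _ _ P Xn _ (3 * v ^+ 2 / 2 + 2 * v ^+ 3)) => //.
    by move=> n w; rewrite /Xn mulr_ge0// sqr_ge0.
  move=> n; have := EXn_lim n; rewrite ler_norml => /andP[_]; rewrite lerBlDl => /le_trans; apply.
  by rewrite lerD2l ler_piMr// ?mulr_ge0 ?exprn_ge0// invf_le1// ler1n.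
have [_ cv] := esp_dct (fun n => intg_meas (iXn n)) XnX Xn4 i4.
have e := cvgn_unique cv (cvgn_bound EXn_lim).
have i4' : intg P (fun w => Z w ^+ 4).
  by apply: (eq_intg _ (intgZ 2 i4)) => w; field.
split=> //; rewrite (eq_esp P (Y := fun w => 2 * (Z w ^+ 4 / 2))); last by move=> w; field.
by rewrite espZ// e; field.
Qed.

(** Joint Gaussianity in the manner of Cramer and Wold: all linear combinations stay in [G] and each
    of them is Gaussian. *)
Definition gaussian_space (G : set (T -> R)) :=
  (forall (a b : R) X Y, G X -> G Y -> G (fun w => a * X w + b * Y w)) /\
  forall X, G X -> gaussRV X.

Section space.
Variable G : set (T -> R).
Hypothesis hG : gaussian_space G.
Local Notation cov X Y := (E (fun w => X w * Y w)).

Lemma gs_lin (a b : R) X Y : G X -> G Y -> G (fun w => a * X w + b * Y w).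
Proof. by move=> gX gY; exact: hG.1. Qed.

Lemma gs_ext X Y : X =1 Y -> G X -> G Y.
Proof. by move=> /funext ->. Qed.

Lemma gsD X Y : G X -> G Y -> G (fun w => X w + Y w).
Proof. by move=> gX gY; apply: (gs_ext _ (gs_lin 1 1 gX gY)) => w; rewrite !mul1r. Qed.

Lemma gsB X Y : G X -> G Y -> G (fun w => X w - Y w).
Proof. by move=> gX gY; apply: (gs_ext _ (gs_lin 1 (-1) gX gY)) => w; rewrite mul1r mulN1r. Qed.

Lemma gsZ (a : R) X : G X -> G (fun w => a * X w).
Proof. by move=> gX; apply: (gs_ext _ (gs_lin a 0 gX gX)) => w; rewrite mul0r addr0. Qed.

Lemma gs_L2 X : G X -> L2 P X.
Proof. by move=> /hG.2[]. Qed.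

Lemma gs_meas X : G X -> measurable_fun setT X.
Proof. by move=> /gs_L2 /L2_meas. Qed.

Lemma gs_intg4 X : G X -> intg P (fun w => X w ^+ 4).
Proof. by move=> /hG.2 /gauss_fourth[]. Qed.

Lemma gs_L2sq X : G X -> L2 P (fun w => X w ^+ 2).
Proof.
move=> gX; split; first by apply: measurable_funX; exact: gs_meas.
by apply: (eq_intg _ (gs_intg4 gX)) => w; ring.
Qed.

Lemma gs_L2M X Y : G X -> G Y -> L2 P (fun w => X w * Y w).
Proof.
move=> gX gY; split; first by apply: measurable_funM; exact: gs_meas.
apply: (@intg_dom _ _ _ P _ (fun w => X w ^+ 4 + Y w ^+ 4)).
- by apply: measurable_funX; apply: measurable_funM; exact: gs_meas.
- move=> w; rewrite exprMn (le_trans (normM_le_sqr _ _))//.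
  by rewrite le_eqVlt; apply/orP; left; apply/eqP; ring.
- by apply: intgD; exact: gs_intg4.
Qed.

Lemma gs_intg22 X Y : G X -> G Y -> intg P (fun w => X w ^+ 2 * Y w ^+ 2).
Proof. by move=> gX gY; apply: intgM; exact: gs_L2sq. Qed.

Lemma covC X Y : cov X Y = cov Y X.
Proof. by apply: eq_esp => w; rewrite mulrC. Qed.

Lemma covD X Y Z : G X -> G Y -> G Z -> cov X (fun w => Y w + Z w) = cov X Y + cov X Z.
Proof.
move=> gX gY gZ; rewrite -espD; [|exact: intgM (gs_L2 _) (gs_L2 _)..].
by apply: eq_esp => w; rewrite mulrDr.
Qed.

Lemma covZ (a : R) X Y : G X -> G Y -> cov X (fun w => a * Y w) = a * cov X Y.
Proof.
move=> gX gY; rewrite -espZ; last exact: intgM (gs_L2 _) (gs_L2 _).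
by apply: eq_esp => w; rewrite mulrCA.
Qed.

Lemma cov_sqr X : E (fun w => X w ^+ 2) = cov X X.
Proof. by apply: eq_esp => w; rewrite expr2. Qed.

Lemma varD X Y (t : R) : G X -> G Y ->
  E (fun w => (X w + t * Y w) ^+ 2) = cov X X + 2 * t * cov X Y + t ^+ 2 * cov Y Y.
Proof.
move=> gX gY; have h (U V : T -> R) : G U -> G V -> intg P (fun w => U w * V w).
  by move=> gU gV; apply: intgM; exact: gs_L2.
rewrite (eq_esp P (Y := fun w => (X w * X w + (2 * t) * (X w * Y w)) + t ^+ 2 * (Y w * Y w))).
  by rewrite !espD ?espZ//; repeat first [apply: intgD | apply: intgZ | exact: h].
by move=> w; ring.
Qed.

(** Polarization of the fourth moment: [(X + Y)^4 + (X - Y)^4] isolates [X^2 Y^2], and all other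
    fourth moments are given by [gauss_fourth]. *)
Lemma isserlis2 X Y : G X -> G Y ->
  E (fun w => X w ^+ 2 * Y w ^+ 2) = cov X X * cov Y Y + 2 * cov X Y ^+ 2.
Proof.
move=> gX gY.
have h4 Z : G Z -> E (fun w => Z w ^+ 4) = 3 * cov Z Z ^+ 2.
  by move=> gZ; rewrite -(cov_sqr Z); exact: (gauss_fourth (hG.2 Z gZ)).2.
have e1 := h4 _ (gsD gX gY); have e2 := h4 _ (gsB gX gY).
have : E (fun w => (X w + Y w) ^+ 4) + E (fun w => (X w - Y w) ^+ 4) =
    2 * E (fun w => X w ^+ 4) + 12 * E (fun w => X w ^+ 2 * Y w ^+ 2) + 2 * E (fun w => Y w ^+ 4).
  have i1 := gs_intg4 gX; have i2 := gs_intg4 gY; have i3 := gs_intg22 gX gY.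
  rewrite -!espZ// -!espD; repeat first [exact: gs_intg4 (gsD _ _) | exact: gs_intg4 (gsB _ _)
    | apply: intgD | apply: intgZ | by []].
  by apply: eq_esp => w; ring.
rewrite e1 e2 !h4// -!cov_sqr.
rewrite (eq_esp P (X := fun w => (X w + Y w) ^+ 2) (Y := fun w => (X w + 1 * Y w) ^+ 2)); last by move=> w; rewrite mul1r.
rewrite (eq_esp P (X := fun w => (X w - Y w) ^+ 2) (Y := fun w => (X w + -1 * Y w) ^+ 2)); last by move=> w; rewrite mulN1r.
rewrite !varD// !cov_sqr => h.
have h' : 12 * E (fun w => X w ^+ 2 * Y w ^+ 2) = 12 * (cov X X * cov Y Y + 2 * cov X Y ^+ 2).
  rewrite -[LHS](addKr (2 * (3 * cov X X ^+ 2))) -[LHS](addrK (2 * (3 * cov Y Y ^+ 2))).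
  rewrite -(addrA (- _)) -h; ring.
by apply: (mulfI _ h'); rewrite pnatr_eq0.
Qed.

(** A second polarization, writing each product [X1 X2] as a quarter of [(X1 + X2)^2 - (X1 - X2)^2],
    reduces Isserlis' formula to [isserlis2]. *)
Lemma isserlis X1 X2 X3 X4 : G X1 -> G X2 -> G X3 -> G X4 ->
  E (fun w => (X1 w * X2 w) * (X3 w * X4 w)) =
  cov X1 X2 * cov X3 X4 + cov X1 X3 * cov X2 X4 + cov X1 X4 * cov X2 X3.
Proof.
move=> g1 g2 g3 g4.
have p1 := gsD g1 g2; have m1 := gsB g1 g2; have p2 := gsD g3 g4; have m2 := gsB g3 g4.
have h : 16 * E (fun w => (X1 w * X2 w) * (X3 w * X4 w)) =
  E (fun w => (X1 w + X2 w) ^+ 2 * (X3 w + X4 w) ^+ 2) - E (fun w => (X1 w + X2 w) ^+ 2 * (X3 w - X4 w) ^+ 2)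
  - (E (fun w => (X1 w - X2 w) ^+ 2 * (X3 w + X4 w) ^+ 2) - E (fun w => (X1 w - X2 w) ^+ 2 * (X3 w - X4 w) ^+ 2)).
  have i1 := gs_intg22 p1 p2; have i2 := gs_intg22 p1 m2.
  have i3 := gs_intg22 m1 p2; have i4 := gs_intg22 m1 m2.
  rewrite -espZ; last by apply: intgM; exact: gs_L2M.
  by rewrite -!espB//; [apply: eq_esp => w; ring|exact: intgB..].
have bD U V W : G U -> G V -> G W -> cov (fun w => U w + V w) W = cov U W + cov V W.
  by move=> gU gV gW; rewrite covC covD// (covC W) (covC W).
have bB U V W : G U -> G V -> G W -> cov (fun w => U w - V w) W = cov U W - cov V W.
  move=> gU gV gW; rewrite -mulN1r (covC V) -covZ// -(covC _ W) -bD//; last exact: gsZ.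
  by apply: eq_esp => w; rewrite mulN1r.
have cB U V W : G U -> G V -> G W -> cov W (fun w => U w - V w) = cov W U - cov W V.
  by move=> gU gV gW; rewrite covC bB// (covC W) (covC W).
apply: (@mulfI _ 16); first by rewrite pnatr_eq0.
rewrite h !isserlis2// !(bB, cB, bD, covD)//.
rewrite (covC X2 X1) (covC X4 X3).
ring.
Qed.

Lemma gs_cos L (th : R) : G L ->
  E (fun w => cos (th + L w)) = cos th * expR (- (cov L L / 2)).
Proof.
move=> /hG.2[_ h]; have := h th 1; rewrite expr1n mulr1 cov_sqr => <-.
by apply: eq_esp => w; rewrite mul1r.
Qed.

(** [E cos (th + L + t Y)] is differentiated at [t = 0] in two ways: under the expectation, and in
    its closed form, which depends on [t] through the variance of [L + t Y]. *)
Lemma gs_ibp1 Y L (th : R) : G Y -> G L ->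
  E (fun w => Y w * sin (th + L w)) = cov L Y * E (fun w => cos (th + L w)).
Proof.
move=> gY gL.
have h := @isd_esp_cos _ _ _ P (fun=> 1) Y (fun w => th + L w) 0 (intg_cst _ 1) (gs_meas gY).
have /h{}h : intg P (fun w => 1 * Y w).
  by apply: (eq_intg _ (L2_intg (gs_L2 gY))) => w; rewrite mul1r.
have /h{}h : measurable_fun setT (fun w => th + L w).
  by apply: measurable_funD => //; exact: gs_meas.
pose F t := cos th * expR (- ((cov L L + 2 * t * cov L Y + t ^+ 2 * cov Y Y) / 2)).
have E1 : (fun t => E (fun w => 1 * cos (th + L w + t * Y w))) = F.
  apply/funext => t; rewrite /F -varD// cov_sqr -gs_cos//; last by apply: gsD => //; exact: gsZ.
  by apply: eq_esp => w; rewrite mul1r addrA.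
rewrite E1 in h.
have h2 : isd F 0 (- (cov L Y * E (fun w => cos (th + L w)))).
  apply: isd_eq (isdZ _ (isd_expR (isdN (isdM (isdD (isdD (isd_cst _ _)
    (isdM (isdZ _ (isd_id _)) (isd_cst _ _))) (isdM (isd_sqr (isd_id _)) (isd_cst _ _))) (isd_cst _ _))))) _.
  rewrite gs_cos// !(mulr0, mul0r, expr0n, addr0)/=.
  by move: (cov L L) (cov L Y) => a b; field.
have := isd_derive1 h; rewrite (isd_derive1 h2) => /oppr_inj ->.
by apply: eq_esp => w; rewrite mul1r mul0r addr0.
Qed.

Lemma gs_intg_cos X Y (th : R) : intg P X -> G Y -> intg P (fun w => X w * cos (th + Y w)).
Proof.
move=> iX gY; apply: (intgMb iX (C := 1)); last by move=> w; exact: norm_cos_le1.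
by apply: measurable_cos_comp; apply: measurable_funD => //; exact: gs_meas.
Qed.

Lemma gs_intg_sin X Y (th : R) : intg P X -> G Y -> intg P (fun w => X w * sin (th + Y w)).
Proof.
move=> iX gY; apply: (intgMb iX (C := 1)); last by move=> w; exact: norm_sin_le1.
by apply: measurable_sin_comp; apply: measurable_funD => //; exact: gs_meas.
Qed.

(** Derivative at [t = 0] of [gs_ibp1] applied to [X] and [L + t Y]. The phase shift by [pi / 2]
    turns the sine on its left side into the cosine that [isd_esp_cos] differentiates. *)
Lemma gs_ibp2 X Y L (th : R) : G X -> G Y -> G L ->
  E (fun w => X w * Y w * cos (th + L w)) =
  cov X Y * E (fun w => cos (th + L w)) - cov L X * E (fun w => Y w * sin (th + L w)).
Proof.
move=> gX gY gL.
have shift (x : R) : sin x = cos (x - pi / 2) by rewrite cosB cos_pihalf sin_pihalf mulr0 add0r mulr1.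
have shift2 (x : R) : - sin (x - pi / 2) = cos x.
  by rewrite sinB cos_pihalf sin_pihalf mulr0 mulr1 add0r opprK.
have mL : measurable_fun setT (fun w => th - pi / 2 + L w).
  by apply: measurable_funD => //; exact: gs_meas.
have mL' : measurable_fun setT (fun w => th + L w).
  by apply: measurable_funD => //; exact: gs_meas.
have iX := L2_intg (gs_L2 gX); have iY := L2_intg (gs_L2 gY).
have iXY := intgM (gs_L2 gX) (gs_L2 gY).
have h1 := @isd_esp_cos _ _ _ P X Y (fun w => th - pi / 2 + L w) 0 iX (gs_meas gY) iXY mL.
have iY1 : intg P (fun w => 1 * Y w) by apply: (eq_intg _ iY) => w; rewrite mul1r.
have h2 := @isd_esp_cos _ _ _ P (fun=> 1) Y (fun w => th + L w) 0 (intg_cst _ 1) (gs_meas gY) iY1 mL'.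
have E1 : (fun t => E (fun w => X w * cos (th - pi / 2 + L w + t * Y w))) =
    (fun t => (cov L X + t * cov Y X) * E (fun w => 1 * cos (th + L w + t * Y w))).
  apply/funext => t.
  transitivity (E (fun w => X w * sin (th + (L w + t * Y w)))).
    by apply: eq_esp => w; rewrite shift; congr (_ * cos _); ring.
  rewrite gs_ibp1//; last by apply: gsD => //; exact: gsZ.
  congr (_ * _); last by apply: eq_esp => w; rewrite mul1r addrA.
  by rewrite covC covD ?covZ//; [rewrite (covC X L) (covC X Y)|exact: gsZ].
rewrite E1 in h1.
have h3 := isdM (isdD (isd_cst (cov L X) 0) (isdM (isd_id (0:R)) (isd_cst (cov Y X) 0))) h2.
have := isd_derive1 h1; rewrite (isd_derive1 h3) => {h1 h2 h3} /esym h.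
transitivity (- E (fun w => X w * Y w * sin (th - pi / 2 + L w + 0 * Y w))).
  rewrite -espN.
    apply: eq_esp => w; rewrite mul0r addr0 -mulrN; congr (_ * _).
    by rewrite -shift2; congr (- sin _); ring.
  apply: (intgMb iXY (C := 1)); last by move=> w; exact: norm_sin_le1.
  by apply: measurable_sin_comp; apply: measurable_funD => //; apply: measurable_funM => //; exact: gs_meas.
rewrite h !(mul0r, mul1r, addr0, add0r, mulr1) mulrN covC; congr (_ * _ - _ * _).
  by apply: eq_esp => w; rewrite mul1r mul0r addr0.
by apply: eq_esp => w; rewrite mul1r mul0r addr0.
Qed.

End space.
End gaussian_variables.

(** * Laplace transform of a sum of squares *)

Section trig_limits.
Context {R : realType}.
Implicit Types x y s : R.

Lemma cvgn_ext (u v : nat -> R) (l : R) : (forall n, u n = v n) ->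
  v n @[n --> \oo] --> l -> u n @[n --> \oo] --> l.
Proof. by move=> /funext ->. Qed.

Lemma sin_sub_le y : `|sin y - y| <= `|y| ^+ 3 / 6.
Proof.
wlog y0 : y / 0 <= y.
  move=> h; have [/h//|/ltW y0] := leP 0 y.
  by have := h (- y); rewrite oppr_ge0 => /(_ y0); rewrite sinN -opprD !normrN.
rewrite (ger0_norm y0) ler_norml; have := sin_le y0; have := sin_ge y0.
have : 0 <= y ^+ 3 by ge0.
by move=> *; apply/andP; split; lra.
Qed.

Lemma norm_sin_le y : `|sin y| <= `|y|.
Proof.
wlog y0 : y / 0 <= y.
  move=> h; have [/h//|/ltW y0] := leP 0 y.
  by have := h (- y); rewrite oppr_ge0 => /(_ y0); rewrite sinN !normrN.
rewrite (ger0_norm y0); have [y1|/ltW y1] := leP 1 y.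
  by apply: le_trans y1; exact: norm_sin_le1.
rewrite ler_norml (sin_le y0) andbT.
have := sin_ge y0; have : y ^+ 3 <= y.
  by rewrite !exprS expr0 mulr1 ler_piMr// mulr_ile1.
by move=> *; lra.
Qed.

Lemma cosDD (th l y : R) : cos (th + (l + y)) = cos (th + l) * cos y - sin (th + l) * sin y.
Proof. by rewrite addrA (cosD (th + l)). Qed.

Lemma cosDB (th l y : R) : cos (th + (l - y)) = cos (th + l) * cos y + sin (th + l) * sin y.
Proof. by rewrite addrA cosB. Qed.

Lemma sinDD (th l y : R) : sin (th + (l + y)) = sin (th + l) * cos y + cos (th + l) * sin y.
Proof. by rewrite addrA (sinD (th + l)). Qed.

Lemma sinDB (th l y : R) : sin (th + (l - y)) = sin (th + l) * cos y - cos (th + l) * sin y.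
Proof. by rewrite addrA sinB. Qed.

Definition cosfreq s (n : nat) : R := Num.sqrt (2 * s / n.+1%:R).

Lemma cosfreq_sqr s n : 0 <= s -> cosfreq s n ^+ 2 = 2 * s / n.+1%:R.
Proof. by move=> s0; rewrite sqr_sqrtr//; ge0. Qed.

Lemma cvg_cosX s x : 0 <= s ->
  cos (cosfreq s n * x) ^+ n.+1 @[n --> \oo] --> expR (- (s * x ^+ 2)).
Proof.
move=> s0; apply: (@cvgn_bound _ _ _ (4 * s ^+ 2 * x ^+ 4)) => n.
have a2 := cosfreq_sqr n s0; move: (cosfreq s n) a2 => a a2.
have N0 : n.+1%:R != 0 :> R by rewrite pnatr_eq0.
have -> : expR (- (s * x ^+ 2)) = expR (- ((a * x) ^+ 2 / 2)) ^+ n.+1.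
  by rewrite -expRM_natl exprMn a2; congr expR; field.
have e1 : expR (- ((a * x) ^+ 2 / 2)) <= 1.
  by rewrite -[leRHS]expR0 ler_expR oppr_le0; ge0.
apply: (le_trans (norm_subX_le _ (norm_cos_le1 _) _)).
  by rewrite ger0_norm ?expR_ge0.
apply: (@le_trans _ _ (n.+1%:R * (a * x) ^+ 4)).
  by rewrite ler_wpM2l// cos_sub_gauss.
have -> : (a * x) ^+ 4 = (a ^+ 2) ^+ 2 * x ^+ 4 by ring.
rewrite a2.
by rewrite le_eqVlt; apply/orP; left; apply/eqP; field.
Qed.

(** Up to sign the left side is the derivative in [x] of the sequence of [cvg_cosX]; its convergence
    needs its own proof. It uses that [sin (a x)] is [a x] up to third order, and that the powers
    [n] and [n.+1] of the cosine differ by O(1/n). *)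
Lemma cvg_dcosX s x : 0 <= s ->
  n.+1%:R * cosfreq s n * (sin (cosfreq s n * x) * cos (cosfreq s n * x) ^+ n) @[n --> \oo] -->
  2 * s * x * expR (- (s * x ^+ 2)).
Proof.
move=> s0.
have h1 : n.+1%:R * cosfreq s n * sin (cosfreq s n * x) @[n --> \oo] --> 2 * s * x.
  apply: (@cvgn_bound _ _ _ (4 * s ^+ 2 * `|x| ^+ 3 / 6)) => n.
  have a2 := cosfreq_sqr n s0; have a0 : 0 <= cosfreq s n by exact: sqrtr_ge0.
  move: (cosfreq s n) a2 a0 => a a2 a0.
  have N0 : n.+1%:R != 0 :> R by rewrite pnatr_eq0.
  have -> : 2 * s * x = n.+1%:R * a * (a * x).
    have -> : n.+1%:R * a * (a * x) = n.+1%:R * a ^+ 2 * x by ring.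
    by rewrite a2; field.
  rewrite -mulrBr normrM ger0_norm; last by ge0.
  apply: (@le_trans _ _ (n.+1%:R * a * (`|a * x| ^+ 3 / 6))).
    by rewrite ler_wpM2l ?sin_sub_le//; ge0.
  rewrite normrM (ger0_norm a0).
  have -> : n.+1%:R * a * ((a * `|x|) ^+ 3 / 6) = n.+1%:R * (a ^+ 2) ^+ 2 * `|x| ^+ 3 / 6 by ring.
  rewrite a2.
  by rewrite le_eqVlt; apply/orP; left; apply/eqP; field.
have h2 : cos (cosfreq s n * x) ^+ n @[n --> \oo] --> expR (- (s * x ^+ 2)).
  have h3 : cos (cosfreq s n * x) ^+ n - cos (cosfreq s n * x) ^+ n.+1 @[n --> \oo] --> (0 : R).
    apply: (@cvgn_bound _ _ _ (s * x ^+ 2)) => n; rewrite subr0.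
    rewrite exprS -{1}[_ ^+ n]mul1r -mulrBl normrM.
    have a2 := cosfreq_sqr n s0; move: (cosfreq s n) a2 => a a2.
    rewrite (@le_trans _ _ `|1 - cos (a * x)|)//.
      by rewrite ler_piMr// normrX exprn_ile1// norm_cos_le1.
    rewrite ger0_norm ?subr_ge0 ?cos_le1//.
    have := cos_ge (a * x); rewrite exprMn a2.
    have -> : s * x ^+ 2 * n.+1%:R^-1 = 2 * s / n.+1%:R * x ^+ 2 / 2.
      by field.
    by move: (2 * s / _) => b *; lra.
  rewrite -[X in _ --> X]add0r; apply: cvgn_ext (cvgD h3 (@cvg_cosX s x s0)) => n.
  by rewrite /= subrK.
by apply: cvgn_ext (cvgM h1 h2) => n; rewrite /= mulrA.
Qed.

Lemma cvgn_sum (I : Type) (r : seq I) (u : I -> nat -> R) (l : I -> R) :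
  (forall i, u i n @[n --> \oo] --> l i) ->
  \sum_(i <- r) u i n @[n --> \oo] --> \sum_(i <- r) l i.
Proof.
move=> h; elim: r => [|i r ih].
  rewrite big_nil (_ : (fun n => _) = fun=> 0); first exact: cvg_cst.
  by apply/funext => n; rewrite big_nil.
rewrite big_cons (_ : (fun n => _) = fun n => u i n + \sum_(j <- r) u j n); first exact: cvgD.
by apply/funext => n; rewrite big_cons.
Qed.

End trig_limits.

(** * Integration by parts for exponentials of sums of squares *)

Section laplace.
Context {d : measure_display} {T : measurableType d} {R : realType}.
Variable P : probability T R.
Local Notation E := (esp P).
Variable G : set (T -> R).
Hypothesis hG : gaussian_space P G.
Variables (n : nat) (X : 'I_n -> T -> R).
Hypothesis gX : forall i, G (X i).
Local Notation r i j := (E (fun w => X i w * X j w)).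
Local Notation cov U V := (E (fun w => U w * V w)).

(** Gaussian integration by parts for [X k] and a function [g] of the variables with partial
    derivatives [dg]. The test factor [cos (th + L)] with arbitrary [L] makes the property stable
    under multiplication of [g] by [cos (a * X i)], since a product of cosines is a sum of cosines
    with shifted [L]. *)
Definition ibp_for (k : 'I_n) (g : T -> R) (dg : 'I_n -> T -> R) :=
  forall L th, G L -> E (fun w => X k w * g w * cos (th + L w)) =
    \sum_j r k j * E (fun w => dg j w * cos (th + L w)) -
    cov L (X k) * E (fun w => g w * sin (th + L w)).

Definition ibp_adm (g : T -> R) (dg : 'I_n -> T -> R) :=
  [/\ intg P g, forall i, intg P (fun w => X i w * g w) & forall j, intg P (dg j)].

Let mX i : measurable_fun setT (X i).
Proof. exact: (gs_meas hG). Qed.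

(** In the applications [b] is a function of [X i] and [c] is minus its derivative; the linear
    growth of [c] is paid for by the integrability of [X i * g]. *)
Lemma ibp_adm_mul g dg i (b c : T -> R) (C : R) : ibp_adm g dg ->
  measurable_fun setT b -> measurable_fun setT c ->
  (forall w, `|b w| <= C) -> (forall w, `|c w| <= C * (1 + `|X i w|)) ->
  ibp_adm (fun w => g w * b w) (fun j w => dg j w * b w - (j == i)%:R * (g w * c w)).
Proof.
move=> [h1 h2 h3] mb mc bC cC; split.
- exact: intgMb bC.
- move=> j; apply: (eq_intg _ (intgMb (h2 j) mb bC)) => w; by rewrite mulrA.
- move=> j; apply: intgB; first exact: intgMb bC.
  apply: intgZ; apply: (intg_dom (Y := fun w => C * (`|g w| + `|X i w * g w|))).
  + by apply: measurable_funM => //; exact: intg_meas h1.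
  + move=> w; rewrite normrM mulrC normrM -{2}[`|g w|]mul1r -mulrDl mulrA.
    by rewrite ler_wpM2r.
  + by apply: intgZ; apply: intgD; exact: intg_abs.
Qed.

(** The hypothesis on [g] is used with [L + a X_i] and [L - a X_i] and averaged. The covariances
    with [X k] then differ from that of [L] by plus or minus [a r_ki], and this shift is exactly the
    contribution of the derivative of the new factor. *)
Lemma ibp_for_cos k g dg i (a : R) : ibp_adm g dg -> ibp_for k g dg ->
  ibp_for k (fun w => g w * cos (a * X i w))
    (fun j w => dg j w * cos (a * X i w) - (j == i)%:R * (g w * (a * sin (a * X i w)))).
Proof.
move=> [h1 h2 h3] S L th gL.
have gp : G (fun w => L w + a * X i w) by apply: (gsD hG) => //; exact: (gsZ hG).
have gm : G (fun w => L w - a * X i w) by apply: (gsB hG) => //; exact: (gsZ hG).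
have ic (U V : T -> R) : intg P U -> G V -> intg P (fun w => U w * cos (th + V w)).
  by move=> iU gV; exact: (gs_intg_cos hG).
have is_ (U V : T -> R) : intg P U -> G V -> intg P (fun w => U w * sin (th + V w)).
  by move=> iU gV; exact: (gs_intg_sin hG).
have e1 := S _ th gp; have e2 := S _ th gm.
have iL : intg P (fun w => L w * X k w) by apply: intgM; exact: (gs_L2 hG).
have iXX : intg P (fun w => a * X i w * X k w).
  apply: (eq_intg _ (intgZ a (intgM (gs_L2 hG (gX i)) (gs_L2 hG (gX k))))) => w.
  by rewrite mulrA.
have c1 : cov (fun w => L w + a * X i w) (X k) = cov L (X k) + a * r k i.
  rewrite (eq_esp P (Y := fun w => L w * X k w + a * X i w * X k w)); last by move=> w; ring.
  rewrite espD//; congr (_ + _); rewrite -espZ; last by apply: intgM; exact: (gs_L2 hG).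
  by apply: eq_esp => w; ring.
have c2 : cov (fun w => L w - a * X i w) (X k) = cov L (X k) - a * r k i.
  rewrite (eq_esp P (Y := fun w => L w * X k w - a * X i w * X k w)); last by move=> w; ring.
  rewrite espB//; congr (_ - _); rewrite -espZ; last by apply: intgM; exact: (gs_L2 hG).
  by apply: eq_esp => w; ring.
rewrite c1 in e1; rewrite c2 in e2.
have half : 2 * E (fun w => X k w * (g w * cos (a * X i w)) * cos (th + L w)) =
    E (fun w => X k w * g w * cos (th + (L w + a * X i w))) +
    E (fun w => X k w * g w * cos (th + (L w - a * X i w))).
  rewrite -espD; [|exact: ic..]; rewrite -espZ.
    by apply: eq_esp => w; rewrite cosDD cosDB; ring.
  apply: (eq_intg _ (intgMb (ic _ _ (h2 k) gL) (C := 1) (measurable_cos_comp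
    (measurable_funM (@measurable_cst _ _ _ _ _ a) (mX i))) (fun w => norm_cos_le1 _))) => w.
  ring.
have dgj j : 2 * E (fun w => (dg j w * cos (a * X i w) - (j == i)%:R * (g w * (a * sin (a * X i w)))) * cos (th + L w)) =
   E (fun w => dg j w * cos (th + (L w + a * X i w))) + E (fun w => dg j w * cos (th + (L w - a * X i w)))
   - (j == i)%:R * a * (E (fun w => g w * sin (th + (L w + a * X i w))) - E (fun w => g w * sin (th + (L w - a * X i w)))).
  have ms : measurable_fun setT (fun w => sin (a * X i w)).
    by apply: measurable_sin_comp; apply: measurable_funM => //; exact: mX.
  have mc : measurable_fun setT (fun w => cos (a * X i w)).
    by apply: measurable_cos_comp; apply: measurable_funM => //; exact: mX.
  have i1 := ic _ _ (h3 j) gp; have i2 := ic _ _ (h3 j) gm.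
  have i3 := is_ _ _ h1 gp; have i4 := is_ _ _ h1 gm.
  rewrite -(espD i1 i2) -(espB i3 i4) -(espZ _ (intgB i3 i4)).
  rewrite -(espB (intgD i1 i2) (intgZ _ (intgB i3 i4))) -espZ; last first.
    apply: (ic _ _ _ gL); apply: intgB.
      by apply: (intgMb (h3 j) mc (C := 1)) => w; exact: norm_cos_le1.
    apply: intgZ; apply: (eq_intg _ (intgZ a (intgMb h1 ms (C := 1) (fun w => norm_sin_le1 _)))) => w.
    ring.
  by apply: eq_esp => w; rewrite cosDD cosDB sinDD sinDB; ring.
have gs : 2 * E (fun w => g w * cos (a * X i w) * sin (th + L w)) =
   E (fun w => g w * sin (th + (L w + a * X i w))) + E (fun w => g w * sin (th + (L w - a * X i w))).
  rewrite -espD; [|exact: is_..]; rewrite -espZ.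
    by apply: eq_esp => w; rewrite sinDD sinDB; ring.
  apply: (eq_intg _ (intgMb (is_ _ _ h1 gL) (C := 1) (measurable_cos_comp
    (measurable_funM (@measurable_cst _ _ _ _ _ a) (mX i))) (fun w => norm_cos_le1 _))) => w.
  ring.
apply: (@mulfI _ 2); first by rewrite pnatr_eq0.
rewrite half e1 e2 mulrBr mulrCA gs mulr_sumr.
under [in RHS]eq_bigr do rewrite mulrCA dgj mulrBr mulrDr.
rewrite sumrB big_split/=.
have -> : \sum_(j < n) r k j * ((j == i)%:R * a * (E (fun w => g w * sin (th + (L w + a * X i w))) - E (fun w => g w * sin (th + (L w - a * X i w))))) = r k i * (a * (E (fun w => g w * sin (th + (L w + a * X i w))) - E (fun w => g w * sin (th + (L w - a * X i w))))).
  rewrite (bigD1 i)//= eqxx mul1r big1 ?addr0// => j /negbTE ->.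
  by rewrite !mul0r mulr0.
ring.
Qed.


Lemma meas_scale_cos i (a : R) : measurable_fun setT (fun w => cos (a * X i w)).
Proof. by apply: measurable_cos_comp; apply: measurable_funM => //; exact: mX. Qed.

Lemma meas_scale_sin i (a : R) : measurable_fun setT (fun w => sin (a * X i w)).
Proof. by apply: measurable_sin_comp; apply: measurable_funM => //; exact: mX. Qed.

Lemma norm_cosX_le1 (x : R) (N : nat) : `|cos x ^+ N| <= 1.
Proof. by rewrite normrX exprn_ile1// norm_cos_le1. Qed.

Lemma ibp_adm_cosX g dg i (a : R) (N : nat) : 0 <= a -> ibp_adm g dg ->
  ibp_adm (fun w => g w * cos (a * X i w) ^+ N)
    (fun j w => dg j w * cos (a * X i w) ^+ N -
      (j == i)%:R * (g w * (N%:R * a * (sin (a * X i w) * cos (a * X i w) ^+ N.-1)))).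
Proof.
move=> a0 h; apply: (@ibp_adm_mul _ _ _ (fun w => cos (a * X i w) ^+ N)
  (fun w => N%:R * a * (sin (a * X i w) * cos (a * X i w) ^+ N.-1)) (1 + N%:R * a)) => //.
- by apply: measurable_funX; exact: meas_scale_cos.
- apply: measurable_funM => //; apply: measurable_funM; first exact: meas_scale_sin.
  by apply: measurable_funX; exact: meas_scale_cos.
- by move=> w; rewrite (le_trans (norm_cosX_le1 _ _))// lerDl; ge0.
- move=> w; rewrite normrM (ger0_norm (_ : 0 <= N%:R * a)); last by ge0.
  apply: (@le_trans _ _ (N%:R * a * 1)).
    rewrite ler_wpM2l//; first by ge0.
    by rewrite normrM mulr_ile1// ?norm_sin_le1// norm_cosX_le1.
  have h0 : 0 <= N%:R * a by ge0.
  by have := normr_ge0 (X i w); move: `|X i w| (N%:R * a) h0 => u v; nra.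
Qed.

Lemma ibp_for_cosX k g dg i (a : R) (N : nat) : 0 <= a -> ibp_adm g dg -> ibp_for k g dg ->
  ibp_for k (fun w => g w * cos (a * X i w) ^+ N)
    (fun j w => dg j w * cos (a * X i w) ^+ N -
      (j == i)%:R * (g w * (N%:R * a * (sin (a * X i w) * cos (a * X i w) ^+ N.-1)))).
Proof.
move=> a0 adm S; elim: N => [|N ih].
  rewrite (_ : (fun w => _) = g); last by apply/funext => w; rewrite mulr1.
  rewrite [X in ibp_for _ _ X](_ : _ = dg)//.
  by apply/funext => j; apply/funext => w; rewrite mulr1 !mul0r !mulr0 subr0.
have := @ibp_for_cos k _ _ i a (ibp_adm_cosX i N a0 adm) ih.
congr ibp_for; first by apply/funext => w; rewrite exprSr mulrA.
apply/funext => j; apply/funext => w; rewrite -(natr1 N) exprSr /=.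
case: N {ih} => [|N] /=; first by ring.
by rewrite exprSr; ring.
Qed.

Lemma ibp_adm_gauss g dg i (s : R) : 0 <= s -> ibp_adm g dg ->
  ibp_adm (fun w => g w * expR (- (s * X i w ^+ 2)))
    (fun j w => dg j w * expR (- (s * X i w ^+ 2)) -
      (j == i)%:R * (g w * (2 * s * X i w * expR (- (s * X i w ^+ 2))))).
Proof.
move=> s0 h.
have me : measurable_fun setT (fun w => expR (- (s * X i w ^+ 2))).
  apply: measurableT_comp => //; apply: measurableT_comp => //.
  by apply: measurable_funM => //; apply: measurable_funX; exact: mX.
have e1 w : `|expR (- (s * X i w ^+ 2))| <= 1.
  by rewrite ger0_norm ?expR_ge0// -[leRHS]expR0 ler_expR oppr_le0; ge0.
apply: (@ibp_adm_mul _ _ _ (fun w => expR (- (s * X i w ^+ 2)))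
  (fun w => 2 * s * X i w * expR (- (s * X i w ^+ 2))) (1 + 2 * s)) => //.
- by apply: measurable_funM => //; apply: measurable_funM => //; exact: mX.
- by move=> w; rewrite (le_trans (e1 w))// lerDl; ge0.
- move=> w; rewrite normrM normrM (ger0_norm (_ : 0 <= 2 * s)); last by ge0.
  apply: (@le_trans _ _ (2 * s * `|X i w|)).
    by rewrite ler_piMr//; ge0.
  by have := normr_ge0 (X i w); move: `|X i w| => u *; nra.
Qed.

Lemma ibp_for_gauss k g dg i (s : R) : 0 <= s -> ibp_adm g dg -> ibp_for k g dg ->
  ibp_for k (fun w => g w * expR (- (s * X i w ^+ 2)))
    (fun j w => dg j w * expR (- (s * X i w ^+ 2)) -
      (j == i)%:R * (g w * (2 * s * X i w * expR (- (s * X i w ^+ 2))))).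
Proof.
move=> s0 adm S L th gL; have [h1 h2 h3] := adm.
pose a N := cosfreq s N.
have a0 N : 0 <= a N by exact: sqrtr_ge0.
have mtc : measurable_fun setT (fun w => cos (th + L w)).
  by apply: measurable_cos_comp; apply: measurable_funD => //; exact: (gs_meas hG).
have mts : measurable_fun setT (fun w => sin (th + L w)).
  by apply: measurable_sin_comp; apply: measurable_funD => //; exact: (gs_meas hG).
have hN N := ibp_for_cosX i N.+1 (a0 N) adm S th gL.
have aN N := ibp_adm_cosX i N.+1 (a0 N) adm.
have l1 : E (fun w => X k w * (g w * cos (a N * X i w) ^+ N.+1) * cos (th + L w)) @[N --> \oo] -->
    E (fun w => X k w * (g w * expR (- (s * X i w ^+ 2))) * cos (th + L w)).
  apply: (@esp_dct _ _ _ P _ _ (fun w => `|X k w * g w|) _ _ _ (intg_abs (h2 k))).2 => [N|w|N w].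
  - by have [_ m2 _] := aN N; apply: measurable_funM => //; exact: intg_meas (m2 k).
  - apply: cvgM; last exact: cvg_cst.
    by apply: cvgM; [exact: cvg_cst|apply: cvgM; [exact: cvg_cst|exact: cvg_cosX]].
  - rewrite mulrA -mulrA normrM ler_piMr// normrM mulr_ile1//.
      exact: norm_cosX_le1.
    exact: norm_cos_le1.
have l2 : E (fun w => g w * cos (a N * X i w) ^+ N.+1 * sin (th + L w)) @[N --> \oo] -->
    E (fun w => g w * expR (- (s * X i w ^+ 2)) * sin (th + L w)).
  apply: (@esp_dct _ _ _ P _ _ (fun w => `|g w|) _ _ _ (intg_abs h1)).2 => [N|w|N w].
  - by have [m2 _ _] := aN N; apply: measurable_funM => //; exact: intg_meas m2.
  - apply: cvgM; last exact: cvg_cst.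
    by apply: cvgM; [exact: cvg_cst|exact: cvg_cosX].
  - rewrite -mulrA normrM ler_piMr// normrM mulr_ile1//.
      exact: norm_cosX_le1.
    exact: norm_sin_le1.
have l3 j : E (fun w => (dg j w * cos (a N * X i w) ^+ N.+1 -
      (j == i)%:R * (g w * (N.+1%:R * a N * (sin (a N * X i w) * cos (a N * X i w) ^+ N)))) * cos (th + L w)) @[N --> \oo] -->
    E (fun w => (dg j w * expR (- (s * X i w ^+ 2)) -
      (j == i)%:R * (g w * (2 * s * X i w * expR (- (s * X i w ^+ 2))))) * cos (th + L w)).
  apply: (@esp_dct _ _ _ P _ _ (fun w => `|dg j w| + 2 * s * `|X i w * g w|) _ _ _ _).2 => [N|w|N w|].
  - by have [_ _ m2] := aN N; apply: measurable_funM => //; exact: intg_meas (m2 j).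
  - apply: cvgM; last exact: cvg_cst.
    apply: cvgB; first by apply: cvgM; [exact: cvg_cst|exact: cvg_cosX].
    apply: cvgM; [exact: cvg_cst|apply: cvgM; [exact: cvg_cst|exact: cvg_dcosX]].
  - rewrite normrM (@le_trans _ _ `|dg j w * cos (a N * X i w) ^+ N.+1 -
      (j == i)%:R * (g w * (N.+1%:R * a N * (sin (a N * X i w) * cos (a N * X i w) ^+ N)))|)//.
      by rewrite ler_piMr// norm_cos_le1.
    rewrite (le_trans (ler_normB _ _))// lerD//.
      by rewrite normrM ler_piMr// norm_cosX_le1.
    rewrite normrM (@le_trans _ _ `|g w * (N.+1%:R * a N * (sin (a N * X i w) * cos (a N * X i w) ^+ N))|)//.
      by rewrite ler_piMl//; case: (j == i); rewrite ?normr1 ?normr0.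
    rewrite normrM [leRHS](_ : _ = `|g w| * (2 * s * `|X i w|)); last by rewrite normrM; ring.
    rewrite ler_wpM2l// normrM (ger0_norm (_ : 0 <= N.+1%:R * a N)); last by ge0.
    (* The frequency satisfies [N.+1 * a^2 = 2 s], so [|sin y| <= |y|] gives a dominating variable
       independent of [N]. *)
    have -> : 2 * s * `|X i w| = N.+1%:R * a N * `|a N * X i w|.
      rewrite normrM (ger0_norm (a0 N)).
      have -> : N.+1%:R * a N * (a N * `|X i w|) = N.+1%:R * a N ^+ 2 * `|X i w| by ring.
      by rewrite cosfreq_sqr//; field.
    rewrite ler_wpM2l//; first by ge0.
    by rewrite normrM (le_trans _ (norm_sin_le _))// ler_piMr// norm_cosX_le1.
  - by apply: intgD; [exact: intg_abs|apply: intgZ; exact: intg_abs].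
apply: (cvgn_unique l1).
under eq_fun do rewrite hN.
apply: cvgB; last by apply: cvgM; [exact: cvg_cst|exact: l2].
by apply: cvgn_sum => j; apply: cvgM; [exact: cvg_cst|exact: l3].
Qed.

(** Gaussian factors are multiplied in one at a time, along a list of indices. The multiplicity
    [count_mem j u] keeps the induction free of side conditions; for the enumeration of all indices
    it is 1. *)
Lemma ibp_gauss_seq k l (s : R) (u : seq 'I_n) : 0 <= s ->
  let e w := expR (- (s * \sum_(i <- u) X i w ^+ 2)) in
  let g w := X l w * e w in
  let dg (j : 'I_n) w := ((j == l)%:R - 2 * s * (count_mem j u)%:R * (X j w * X l w)) * e w in
  ibp_adm g dg /\ ibp_for k g dg.
Proof.
move=> s0; elim: u => [|i u [adm S]] /=.
  have e1 w : expR (- (s * \sum_(i <- [::]) X i w ^+ 2)) = 1.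
    by rewrite big_nil mulr0 oppr0 expR0.
  split.
    split.
    - by apply: (eq_intg _ (L2_intg (gs_L2 hG (gX l)))) => w; rewrite e1 mulr1.
    - move=> i; apply: (eq_intg _ (intgM (gs_L2 hG (gX i)) (gs_L2 hG (gX l)))) => w.
      by rewrite e1 mulr1.
    - move=> j; apply: (eq_intg _ (intg_cst P (j == l)%:R)) => w.
      by rewrite e1 !(mulr0, mul0r, subr0, mulr1).
  move=> L th gL.
  rewrite (eq_esp P (Y := fun w => X k w * X l w * cos (th + L w))); last by move=> w; rewrite e1 mulr1.
  rewrite (gs_ibp2 hG)//; congr (_ - _ * _); last by apply: eq_esp => w; rewrite e1 mulr1.
  rewrite (bigD1 l)//= eqxx big1 ?addr0.
    congr (_ * _); apply: eq_esp => w; by rewrite e1 !(mulr0, mul0r, subr0, mulr1, mul1r).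
  move=> j /negbTE ->; rewrite [X in _ * X](_ : _ = 0) ?mulr0//.
  rewrite -[RHS](esp_cst P); apply: eq_esp => w.
  by rewrite !(mulr0, mul0r, subr0, mulr0n).
have h1 := ibp_adm_gauss i s0 adm; have h2 := ibp_for_gauss i s0 adm S.
have eE w : expR (- (s * \sum_(j <- i :: u) X j w ^+ 2)) =
    expR (- (s * \sum_(j <- u) X j w ^+ 2)) * expR (- (s * X i w ^+ 2)).
  by rewrite big_cons mulrDr opprD expRD mulrC.
set g1 := (fun w => _ * _) in h1 h2; set dg1 := (fun j w => _) in h1 h2.
have -> : (fun w => X l w * expR (- (s * \sum_(j <- i :: u) X j w ^+ 2))) = g1.
  by apply/funext => w; rewrite /g1 eE mulrA.
have -> : (fun (j : 'I_n) w => ((j == l)%:R - 2 * s * ((i == j) + count_mem j u)%:R * (X j w * X l w)) *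
   expR (- (s * \sum_(j <- i :: u) X j w ^+ 2))) = dg1.
  apply/funext => j; apply/funext => w; rewrite /dg1 eE natrD (eq_sym i j).
  by case: (eqVneq j i) => [->|_] /=; rewrite ?mulr1n ?mulr0n; ring.
by split.
Qed.

Definition sumsq w := \sum_(i < n) X i w ^+ 2.
Definition quadcov w := \sum_(i < n) \sum_(j < n) r i j * (X i w * X j w).

(* Gaussian integration by parts is proved for products of cosines of the [X i], where it
   follows from the characteristic function, and passes to [expR (- s * sumsq)] because
   [cos (x * sqrt (2 s / N)) ^+ N] tends to [expR (- s * x ^+ 2)]. *)
Lemma laplace_ibp (s : R) : 0 <= s ->
  E (fun w => (sumsq w - E sumsq) * expR (- (s * sumsq w))) =
  - (2 * s) * E (fun w => quadcov w * expR (- (s * sumsq w))).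
Proof.
move=> s0.
have me : measurable_fun setT (fun w => expR (- (s * sumsq w))).
  apply: measurableT_comp => //; apply: measurableT_comp => //; apply: measurable_funM => //.
  by apply: measurable_sum => i; apply: measurable_funX; exact: mX.
have S0 w : 0 <= sumsq w by apply: sumr_ge0 => i _; exact: sqr_ge0.
have e1 w : `|expR (- (s * sumsq w))| <= 1.
  by rewrite ger0_norm ?expR_ge0// -[leRHS]expR0 ler_expR oppr_le0; ge0.
have ie : intg P (fun w => expR (- (s * sumsq w))) by exact: intg_bdd me e1.
have i2 i j : intg P (fun w => X i w * X j w) by apply: intgM; exact: (gs_L2 hG).
have i2e i j : intg P (fun w => X i w * X j w * expR (- (s * sumsq w))).
  exact: intgMb (i2 i j) me e1.
have key k : E (fun w => X k w * X k w * expR (- (s * sumsq w))) =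
    r k k * E (fun w => expR (- (s * sumsq w))) -
    2 * s * \sum_j r k j * E (fun w => X k w * X j w * expR (- (s * sumsq w))).
  have [_ S] := ibp_gauss_seq k k (enum 'I_n) s0.
  have sE w : \sum_(i <- enum 'I_n) X i w ^+ 2 = sumsq w by rewrite big_enum.
  have G0 : G (fun w => 0 * X k w) by exact: (gsZ hG).
  have := S _ 0 G0.
  rewrite [X in _ = _ - X * _](_ : _ = 0); last first.
    by rewrite -[RHS](esp_cst P); apply: eq_esp => w; rewrite !mul0r.
  rewrite mul0r subr0.
  rewrite (eq_esp P (Y := fun w => X k w * X k w * expR (- (s * sumsq w)))); last first.
    by move=> w; rewrite sE mul0r addr0 cos0 mulr1 mulrA.
  move=> ->.
  have h j : E (fun w => ((j == k)%:R - 2 * s * (count_mem j (enum 'I_n))%:R * (X j w * X k w)) *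
      expR (- (s * \sum_(i <- enum 'I_n) X i w ^+ 2)) * cos (0 + 0 * X k w)) =
      (j == k)%:R * E (fun w => expR (- (s * sumsq w))) -
      2 * s * E (fun w => X k w * X j w * expR (- (s * sumsq w))).
    rewrite -!espZ// -espB; [|exact: intgZ..].
    apply: eq_esp => w; rewrite sE mul0r addr0 cos0 mulr1 count_uniq_mem ?enum_uniq// mem_enum (_ : (j \in 'I_n) = true)//= mulr1n.
    ring.
  under eq_bigr do rewrite h mulrBr.
  rewrite sumrB (bigD1 k)//= eqxx mul1r big1 ?addr0; last first.
    by move=> j /negbTE ->; rewrite mul0r mulr0.
  congr (_ - _); rewrite mulr_sumr; apply: eq_bigr => j _; ring.
have iS : intg P sumsq.
  by apply: intg_sum => i _; apply: (L2_sq (gs_L2 hG (gX i))).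
rewrite (eq_esp P (Y := fun w => sumsq w * expR (- (s * sumsq w)) - E sumsq * expR (- (s * sumsq w)))); last by move=> w; ring.
rewrite espB; [|exact: intgMb iS me e1|exact: intgZ].
rewrite espZ//.
have -> : E (fun w => sumsq w * expR (- (s * sumsq w))) = \sum_k E (fun w => X k w * X k w * expR (- (s * sumsq w))).
  rewrite -esp_sum//; apply: eq_esp => w; rewrite mulr_suml.
  by apply: eq_bigr => i _; rewrite -expr2.
have -> : E sumsq = \sum_k r k k.
  rewrite -esp_sum//; by apply: eq_esp => w; apply: eq_bigr => i _; rewrite expr2.
have -> : E (fun w => quadcov w * expR (- (s * sumsq w))) =
   \sum_k \sum_j r k j * E (fun w => X k w * X j w * expR (- (s * sumsq w))).
  under [RHS]eq_bigr => k _.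
    under eq_bigr => j _ do rewrite -espZ//.
    rewrite -esp_sum; last by move=> j _; exact: intgZ.
    over.
  rewrite -esp_sum; last by move=> k _; apply: intg_sum => j _; exact: intgZ.
  apply: eq_esp => w; rewrite mulr_suml; apply: eq_bigr => i _.
  by rewrite mulr_suml; apply: eq_bigr => j _; rewrite -[LHS]mulrA.
under eq_bigr do rewrite key.
by rewrite sumrB -mulr_suml -mulr_sumr mulNr; ring.
Qed.

End laplace.

(** * Stein identity for a sum of squares *)

Section weierstrass.
Context {R : realType}.
Implicit Types (f h : R -> R) (u c : R).

Lemma unif_cont_segment f (a b eps : R) : (forall x, {for x, continuous f}) -> 0 < eps ->
  exists2 delta, 0 < delta & forall x y, a <= x <= b -> `|x - y| < delta -> `|f x - f y| < eps.
Proof.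
move=> cf e0.
pose Q (delta x : R) := forall y, `|x - y| < delta -> `|f x - f y| < eps.
have /compact_near_coveringP cpt : compact `[a, b]%classic := @segment_compact _ a b.
have h x : `[a, b]%classic x -> \forall x' \near x & delta \near (0:R)^'+, Q delta x'.
  move=> _; have e2 : 0 < eps / 2 by rewrite divr_gt0.
  have /cvgrPdist_lt/(_ _ e2)[r /= r0 hr] := cf x.
  have r2 : 0 < r / 2 by rewrite divr_gt0.
  exists (ball x (r / 2), [set delta | delta < r / 2]) => /=.
    split; first exact: nbhsx_ballx.
    by apply: nbhs_right_lt.
  move=> [x' delta] /= [xx' dr] y x'y.
  have h1 := hr x'; have h2 := hr y; rewrite /ball /= in xx' h1 h2.
  have {}h1 := h1 (lt_trans xx' (_ : r / 2 < r)).
  have xy : `|x - y| < r.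
    rewrite (splitr r) (le_lt_trans (ler_distD x' _ _))// ltrD//.
    exact: lt_trans x'y dr.
  rewrite (splitr eps) (le_lt_trans (ler_distD (f x) _ _))// ltrD//.
    by rewrite distrC h1// ltr_pdivrMr// ltr_pMr// ltr1n.
  exact: h2.
have hQ : \forall delta \near (0:R)^'+, `[a, b]%classic `<=` Q delta by exact: cpt h.
near (0:R)^'+ => delta; exists delta; first by near: delta; exact: nbhs_right_gt.
have hd : `[a, b]%classic `<=` Q delta by near: delta.
by move=> x y xab; apply: (hd x); rewrite /= in_itv.
Unshelve. all: by end_near. Qed.

(** The Bernstein polynomial, that is, the expectation of [f] at the number of successes in [N]
    trials of probability [u], written by conditioning on one trial. The nodes are the unscaled
    integers. *)
Fixpoint bernstein_poly (N : nat) (f : nat -> R) : {poly R} :=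
  if N is N'.+1 then 'X * bernstein_poly N' (f \o S) + (1 - 'X) * bernstein_poly N' f
  else (f 0%N)%:P.

Lemma horner_bernsteinS N (f : nat -> R) u : (bernstein_poly N.+1 f).[u] =
  u * (bernstein_poly N (f \o S)).[u] + (1 - u) * (bernstein_poly N f).[u].
Proof. by rewrite /= !hornerE. Qed.

Lemma bernstein_le N (f g : nat -> R) u : 0 <= u <= 1 -> (forall i, f i <= g i) ->
  (bernstein_poly N f).[u] <= (bernstein_poly N g).[u].
Proof.
move=> /andP[u0 u1]; elim: N f g => [|N ih] f g fg; first by rewrite /= !hornerC.
by rewrite !horner_bernsteinS lerD// ler_wpM2l ?subr_ge0//; apply: ih => i /=.
Qed.

(** The binomial mean [N u] and variance [N u (1 - u)] in one formula. The centre [c] is free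
    because one success shifts it to [c - 1] in the induction. *)
Lemma bernstein_quad N (a b c u : R) :
  (bernstein_poly N (fun i => a + b * (i%:R - c) ^+ 2)).[u] =
  a + b * ((N%:R * u - c) ^+ 2 + N%:R * u * (1 - u)).
Proof.
elim: N a b c => [|N ih] a b c; first by rewrite /= hornerC; ring.
rewrite horner_bernsteinS ih.
have -> : ((fun i => a + b * (i%:R - c) ^+ 2) \o S) = (fun i => a + b * (i%:R - (c - 1)) ^+ 2).
  by apply/funext => i /=; rewrite -natr1; ring.
by rewrite ih -natr1; ring.
Qed.

Lemma weierstrass01 h (eps : R) : (forall x, {for x, continuous h}) -> 0 < eps ->
  exists p : {poly R}, forall u, 0 <= u <= 1 -> `|h u - p.[u]| <= eps.
Proof.
move=> ch e0; have e2 : 0 < eps / 2 by rewrite divr_gt0.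
have [delta d0 hd] := unif_cont_segment 0 1 ch e2.
have [M hM] : exists M, forall x, 0 <= x <= 1 -> `|h x| <= M.
  have [|c _ hc] := @EVT_max R (fun x => `|h x|) 0 1 ler01.
    by apply: continuous_subspaceT => x; apply: cvg_norm; exact: ch.
  by exists `|h c| => x x01; apply: hc; rewrite in_itv.
have M0 : 0 <= M by apply: le_trans (hM 0 _); rewrite ?lexx ?ler01.
(* Chebyshev's argument: at distance at least [delta] the oscillation [2 M] is at most
   [K (x - y)^2], so [h] lies between two quadratics up to [eps / 2], and [bernstein_quad] evaluates
   those. *)
pose K := 2 * M / delta ^+ 2.
have K0 : 0 <= K by rewrite /K; ge0.
have hK x y : 0 <= x <= 1 -> 0 <= y <= 1 -> `|h x - h y| <= eps / 2 + K * (x - y) ^+ 2.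
  move=> x01 y01; have [xy|xy] := ltP `|x - y| delta.
    by rewrite (le_trans (ltW (hd _ _ x01 xy)))// lerDl; ge0.
  rewrite (@le_trans _ _ (2 * M))//.
    rewrite (le_trans (ler_normB _ _))//.
    by have := hM _ x01; have := hM _ y01; lra.
  have : 2 * M <= K * (x - y) ^+ 2.
    rewrite /K -mulrA ler_peMr//; first by ge0.
    rewrite mulrC ler_pdivlMr ?exprn_gt0// mul1r -[leRHS]real_normK ?num_real//.
    by rewrite lerXn2r ?nnegrE//; exact: ltW.
  by lra.
pose N := (Num.bound (K / eps)).+1.
have NK : K / N%:R <= eps.
  rewrite ler_pdivrMr ?ltr0n// mulrC -ler_pdivrMr//.
  apply: ltW; apply: (lt_trans (archi_boundP _)); first by ge0.
  by rewrite ltr_nat.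
(* [bernstein_le] compares at every natural number, also beyond [N]; the minimum with 1 keeps all
   nodes in [0, 1], where [hK] applies, and only brings them closer to [u]. *)
exists (bernstein_poly N (fun i => h (Num.min (i%:R / N%:R) 1))) => u u01.
have N0 : N%:R != 0 :> R by rewrite pnatr_eq0.
have min01 i : 0 <= Num.min (i%:R / N%:R : R) 1 <= 1.
  by rewrite ge_min lexx orbT andbT le_min ler01 andbT; ge0.
have dist i : (u - Num.min (i%:R / N%:R) 1) ^+ 2 <= (i%:R - N%:R * u) ^+ 2 / N%:R ^+ 2.
  have -> : (i%:R - N%:R * u) ^+ 2 / N%:R ^+ 2 = (u - i%:R / N%:R) ^+ 2 by field.
  rewrite /Num.min; case: ltP => // h1; case/andP: u01 => u0 u1.
  move: (i%:R / N%:R) h1 => y h1; rewrite -subr_ge0.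
  rewrite (_ : _ - _ = (y - 1) * (y + 1 - 2 * u)); last by ring.
  by rewrite mulr_ge0 ?subr_ge0//; lra.
have hi i : `|h u - h (Num.min (i%:R / N%:R) 1)| <= eps / 2 + K / N%:R ^+ 2 * (i%:R - N%:R * u) ^+ 2.
  apply: (le_trans (hK _ _ u01 (min01 i))); rewrite lerD2l -mulrA ler_wpM2l//.
  by rewrite (le_trans (dist i))// mulrC.
have q : K / N%:R ^+ 2 * ((N%:R * u - N%:R * u) ^+ 2 + N%:R * u * (1 - u)) <= eps / 2.
  rewrite subrr expr0n/= add0r.
  rewrite (_ : _ * _ = K / N%:R * (u * (1 - u))); last by field.
  have u4 : u * (1 - u) <= 1 / 4.
    rewrite -subr_ge0 (_ : _ - _ = (u - 1 / 2) ^+ 2) ?sqr_ge0//; by field.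
  have : 0 <= u * (1 - u) by case/andP: u01 => *; rewrite mulr_ge0 ?subr_ge0.
  have : 0 <= K / N%:R by ge0.
  by move: (K / N%:R) (u * (1 - u)) NK u4 => k v *; nra.
rewrite ler_norml; apply/andP; split.
  have : (bernstein_poly N (fun i => h (Num.min (i%:R / N%:R) 1))).[u] <=
      h u + eps / 2 + K / N%:R ^+ 2 * ((N%:R * u - N%:R * u) ^+ 2 + N%:R * u * (1 - u)).
    rewrite -bernstein_quad; apply: bernstein_le => // i.
    by have := hi i; rewrite ler_norml => /andP[+ _]; lra.
  by move: q; lra.
have : h u - eps / 2 + - (K / N%:R ^+ 2) * ((N%:R * u - N%:R * u) ^+ 2 + N%:R * u * (1 - u)) <=
   (bernstein_poly N (fun i => h (Num.min (i%:R / N%:R) 1))).[u].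
  rewrite -bernstein_quad; apply: bernstein_le => // i.
  by have := hi i; rewrite ler_norml => /andP[_]; rewrite mulNr; lra.
by rewrite mulNr; move: q; lra.
Qed.

End weierstrass.

(** * Variances of the quadratic forms and the identity for exponential polynomials *)

Section stein_identity.
Context {d : measure_display} {T : measurableType d} {R : realType}.
Variable P : probability T R.
Local Notation E := (esp P).
Variable G : set (T -> R).
Hypothesis hG : gaussian_space P G.
Variables (n : nat) (X : 'I_n -> T -> R).
Hypothesis gX : forall i, G (X i).
Local Notation r i j := (E (fun w => X i w * X j w)).
Local Notation S := (sumsq X).
Local Notation Q := (quadcov P X).

Lemma sumsq_L2 : L2 P S.
Proof. by apply: L2_sum => i _; exact: (gs_L2sq hG). Qed.

Lemma quadcov_L2 : L2 P Q.
Proof.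
by apply: L2_sum => i _; apply: L2_sum => j _; apply: L2Z; exact: (gs_L2M hG).
Qed.

Lemma sumsq_ge0 w : 0 <= S w.
Proof. by apply: sumr_ge0 => i _; exact: sqr_ge0. Qed.

Lemma esp_sumsq : E S = \sum_i r i i.
Proof.
rewrite esp_sum; first by apply: eq_bigr => i _; apply: eq_esp => w; rewrite expr2.
by move=> i _; exact: L2_sq (gs_L2 hG (gX i)).
Qed.

Lemma esp_quadcov : E Q = \sum_i \sum_j r i j ^+ 2.
Proof.
have i2 i j : intg P (fun w => r i j * (X i w * X j w)).
  by apply: intgZ; apply: intgM; exact: (gs_L2 hG).
rewrite esp_sum; last by move=> i _; apply: intg_sum => j _.
apply: eq_bigr => i _; rewrite esp_sum//; apply: eq_bigr => j _.
by rewrite espZ ?expr2//; apply: intgM; exact: (gs_L2 hG).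
Qed.

Lemma esp_sumsq2 : E (fun w => S w ^+ 2) = (\sum_i r i i) ^+ 2 + 2 * \sum_i \sum_j r i j ^+ 2.
Proof.
have i4 i j : intg P (fun w => X i w * X i w * (X j w * X j w)).
  by apply: intgM; exact: (gs_L2M hG).
rewrite (eq_esp P (Y := fun w => \sum_i \sum_j X i w * X i w * (X j w * X j w))); last first.
  move=> w; rewrite expr2 /sumsq mulr_suml; apply: eq_bigr => i _; rewrite mulr_sumr.
  by apply: eq_bigr => j _; rewrite !expr2.
rewrite esp_sum; last by move=> i _; apply: intg_sum => j _.
rewrite expr2 mulr_suml mulr_sumr -big_split /=; apply: eq_bigr => i _.
rewrite esp_sum// mulr_sumr mulr_sumr -big_split /=; apply: eq_bigr => j _.
by rewrite (isserlis hG)//; ring.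
Qed.

Lemma var_sumsq : E (fun w => (S w - E S) ^+ 2) = 2 * \sum_i \sum_j r i j ^+ 2.
Proof.
have iS := L2_intg sumsq_L2.
rewrite (eq_esp P (Y := fun w => (S w ^+ 2 - (2 * E S) * S w) + E S ^+ 2)); last by move=> w; ring.
rewrite espD ?espB ?espZ ?esp_cst ?esp_sumsq2//; last 5 first.
- exact: intg_cst.
- exact: L2_sq sumsq_L2.
- exact: intgZ.
- by apply: intgB; [exact: L2_sq sumsq_L2|exact: intgZ].
- exact: intg_cst.
by rewrite esp_sumsq; ring.
Qed.

(** Of the three pairings in Isserlis' formula, one reproduces the square of [E Q]; the other two
    agree after exchanging [k] and [l], hence the factor 2. *)
Lemma var_quadcov : E (fun w => (Q w - E Q) ^+ 2) =
  2 * \sum_i \sum_j \sum_k \sum_l r i j * r k l * (r i k * r j l).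
Proof.
have i4 i j k l : intg P (fun w => r i j * r k l * (X i w * X j w * (X k w * X l w))).
  by apply: intgZ; apply: intgM; exact: (gs_L2M hG).
have iQ := L2_intg quadcov_L2.
rewrite (eq_esp P (Y := fun w => (Q w ^+ 2 - (2 * E Q) * Q w) + E Q ^+ 2)); last by move=> w; ring.
rewrite espD ?espB ?espZ ?esp_cst//; last 5 first.
- exact: intg_cst.
- exact: L2_sq quadcov_L2.
- exact: intgZ.
- by apply: intgB; [exact: L2_sq quadcov_L2|exact: intgZ].
- exact: intg_cst.
have -> : E (fun w => Q w ^+ 2) = \sum_i \sum_j \sum_k \sum_l
    (r i j * r k l * (r i j * r k l + r i k * r j l + r i l * r j k)).
  rewrite (eq_esp P (Y := fun w => \sum_i \sum_j \sum_k \sum_l r i j * r k l * (X i w * X j w * (X k w * X l w)))); last first.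
    move=> w; rewrite expr2 {1}/quadcov mulr_suml; apply: eq_bigr => i _.
    rewrite mulr_suml; apply: eq_bigr => j _; rewrite /quadcov mulr_sumr; apply: eq_bigr => k _.
    by rewrite mulr_sumr; apply: eq_bigr => l _; ring.
  rewrite esp_sum; last by move=> i _; do 3 (apply: intg_sum => ? _).
  apply: eq_bigr => i _; rewrite esp_sum; last by move=> j _; do 2 (apply: intg_sum => ? _).
  apply: eq_bigr => j _; rewrite esp_sum; last by move=> k _; apply: intg_sum => ? _.
  apply: eq_bigr => k _; rewrite esp_sum//; apply: eq_bigr => l _.
  by rewrite espZ ?(isserlis hG)//; apply: intgM; exact: (gs_L2M hG).
have e1 : \sum_i \sum_j \sum_k \sum_l (r i j * r k l * (r i j * r k l)) = E Q ^+ 2.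
  rewrite esp_quadcov expr2 mulr_suml; apply: eq_bigr => i _; rewrite mulr_suml.
  apply: eq_bigr => j _; rewrite mulr_sumr; apply: eq_bigr => k _; rewrite mulr_sumr.
  by apply: eq_bigr => l _; ring.
have e2 : \sum_i \sum_j \sum_k \sum_l (r i j * r k l * (r i l * r j k)) =
    \sum_i \sum_j \sum_k \sum_l r i j * r k l * (r i k * r j l).
  apply: eq_bigr => i _; apply: eq_bigr => j _; rewrite exchange_big /=.
  by apply: eq_bigr => l _; apply: eq_bigr => k _; rewrite (covC P (X k)); ring.
have -> : \sum_i \sum_j \sum_k \sum_l (r i j * r k l * (r i j * r k l + r i k * r j l + r i l * r j k)) =
   E Q ^+ 2 + 2 * \sum_i \sum_j \sum_k \sum_l r i j * r k l * (r i k * r j l).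
  rewrite mulr_natl mulr2n -{2}e2 -e1 -!big_split /=; apply: eq_bigr => i _.
  rewrite -!big_split /=; apply: eq_bigr => j _; rewrite -!big_split /=; apply: eq_bigr => k _.
  by rewrite -!big_split /=; apply: eq_bigr => l _; ring.
ring.
Qed.

(** The identity is kept as a property of the pair, so that it can be handed on through linear
    combinations, approximation and limits. *)
Definition stein_pair (g dg : R -> R) :=
  E (fun w => (S w - E S) * g (S w)) = 2 * E (fun w => Q w * dg (S w)).

Let mS := L2_meas sumsq_L2.
Let iS := L2_intg sumsq_L2.
Let LSm : L2 P (fun w => S w - E S) := L2B sumsq_L2 (L2_cst P (E S)).
Let iQ := L2_intg quadcov_L2.

(** For a positive exponent the primitive [(1 - exp (- s x)) / s] reduces the identity to
    [laplace_ibp], its constant part being killed by the centring of [S]. For exponent 0 the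
    identity says that the variance of [S] is twice [E Q]. *)
Lemma stein_pair_monomial (a : R) (j : nat) : 0 < a ->
  exists2 g : R -> R, (forall x, isd g x (expR (- (a * x)) ^+ j)) &
  [/\ L2 P (fun w => g (S w)), g 0 = 0 & stein_pair g (fun x => expR (- (a * x)) ^+ j)].
Proof.
move=> a0; case: j => [|j].
  exists (fun x => x); first by move=> x; rewrite expr0; exact: isd_id.
  split => //; first exact: sumsq_L2.
  rewrite /stein_pair (eq_esp P (Y := fun w => S w ^+ 2 - E S * S w)); last by move=> w; ring.
  rewrite espB ?espZ//; [|exact: L2_sq sumsq_L2|exact: intgZ].
  rewrite (eq_esp P (X := fun w => Q w * _) (Y := Q)); last by move=> w; rewrite mulr1.
  by rewrite esp_sumsq2 esp_sumsq esp_quadcov expr2; ring.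
pose s := a * j.+1%:R; have s0 : 0 < s by rewrite mulr_gt0.
have eE x : expR (- (a * x)) ^+ j.+1 = expR (- (s * x)).
  by rewrite -expRM_natl /s; congr expR; ring.
exists (fun x => (1 - expR (- (s * x))) / s).
  move=> x; rewrite eE.
  apply: isd_eq (isdM (isdB (isd_cst 1 x) (isd_expR (isdN (isdZ s (isd_id x))))) (isd_cst s^-1 x)) _.
  by move: (expR _) => e; field; rewrite gt_eqF.
have me : measurable_fun setT (fun w => expR (- (s * S w))).
  by apply: measurableT_comp => //; apply: measurableT_comp => //; exact: measurable_funM.
have e1 w : `|expR (- (s * S w))| <= 1.
  rewrite ger0_norm ?expR_ge0// -[leRHS]expR0 ler_expR oppr_le0 mulr_ge0 ?sumsq_ge0//; exact: ltW.
split.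
- apply: (@eq_L2 _ _ _ P (fun w => s^-1 * (1 - expR (- (s * S w))))); first by move=> w; rewrite mulrC.
  by apply: L2Z; apply: L2B; [exact: L2_cst|exact: L2_bdd me e1].
- by rewrite mulr0 oppr0 expR0 subrr mul0r.
- have h := laplace_ibp hG gX (ltW s0).
  rewrite /stein_pair (eq_esp P (Y := fun w => s^-1 * (S w - E S) - s^-1 * ((S w - E S) * expR (- (s * S w))))); last first.
    by move=> w; ring.
  rewrite espB; last 2 first.
  + by apply: intgZ; exact: L2_intg LSm.
  + by apply: intgZ; exact: intgMb (L2_intg LSm) me e1.
  rewrite !espZ ?h; last 2 first.
  + exact: intgMb (L2_intg LSm) me e1.
  + exact: L2_intg LSm.
  rewrite espB ?esp_cst//; last exact: intg_cst.
  rewrite (eq_esp P (X := fun w => Q w * expR (- (a * S w)) ^+ j.+1) (Y := fun w => Q w * expR (- (s * S w)))); last by move=> w; rewrite eE.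
  by field; rewrite gt_eqF.
Qed.

Lemma stein_pair_poly (a : R) (p : {poly R}) : 0 < a ->
  exists2 g : R -> R, (forall x, isd g x p.[expR (- (a * x))]) &
  [/\ L2 P (fun w => g (S w)), g 0 = 0 & stein_pair g (fun x => p.[expR (- (a * x))])].
Proof.
move=> a0.
have me : measurable_fun setT (fun w => expR (- (a * S w))).
  by apply: measurableT_comp => //; apply: measurableT_comp => //; exact: measurable_funM.
have e1 w : `|expR (- (a * S w))| <= 1.
  rewrite ger0_norm ?expR_ge0// -[leRHS]expR0 ler_expR oppr_le0 mulr_ge0 ?sumsq_ge0//; exact: ltW.
have iQe (j : nat) : intg P (fun w => Q w * expR (- (a * S w)) ^+ j).
  apply: (intgMb iQ (C := 1)); first exact: measurable_funX.
  by move=> w; rewrite normrX exprn_ile1.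
suff key (m : nat) : exists2 g : R -> R, (forall x, isd g x (\sum_(j < m) p`_j * expR (- (a * x)) ^+ j)) &
  [/\ L2 P (fun w => g (S w)), g 0 = 0 & stein_pair g (fun x => \sum_(j < m) p`_j * expR (- (a * x)) ^+ j)].
  have [g g1 [g2 g3 g4]] := key (size p); exists g; first by move=> x; rewrite horner_coef.
  split => //; rewrite /stein_pair g4; congr (_ * _); apply: eq_esp => w.
  by rewrite horner_coef.
elim: m => [|m [g g1 [g2 g3 g4]]].
  exists (fun=> 0); first by move=> x; rewrite big_ord0; exact: isd_cst.
  split=> //; first exact: L2_cst.
  rewrite /stein_pair (eq_esp P (Y := fun=> 0)); last by move=> w; rewrite mulr0.
  rewrite (eq_esp P (X := fun w => Q w * _) (Y := fun=> 0)); last by move=> w; rewrite big_ord0 mulr0.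
  by rewrite !esp_cst mulr0.
have [h h1 [h2 h3 h4]] := stein_pair_monomial m a0.
exists (fun x => g x + p`_m * h x).
  by move=> x; rewrite big_ord_recr /=; apply: isdD => //; exact: isdZ.
split.
- by apply: L2D => //; exact: L2Z.
- by rewrite g3 h3 mulr0 addr0.
- rewrite /stein_pair (eq_esp P (Y := fun w => (S w - E S) * g (S w) + p`_m * ((S w - E S) * h (S w)))); last by move=> w; ring.
  rewrite espD ?espZ; [|exact: intgM|exact: intgM|by apply: intgZ; exact: intgM].
  rewrite g4 h4.
  rewrite (eq_esp P (X := fun w => Q w * (\sum_(j < m.+1) _)) (Y := fun w => Q w * (\sum_(j < m) p`_j * expR (- (a * S w)) ^+ j) + p`_m * (Q w * expR (- (a * S w)) ^+ m))); last first.
    by move=> w; rewrite big_ord_recr /= mulrDr; ring.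
  rewrite espD ?espZ//; [ring| |exact: intgZ].
  apply: (@eq_intg _ _ _ P (fun w => \sum_(j < m) p`_j * (Q w * expR (- (a * S w)) ^+ j))).
    by move=> w; rewrite [RHS]mulr_sumr; apply: eq_bigr => j _; ring.
  by apply: intg_sum => j _; exact: intgZ.
Qed.

End stein_identity.

(** * The identity for bounded C^1 functions *)

Section stein_identity.
Context {d : measure_display} {T : measurableType d} {R : realType}.
Variable P : probability T R.
Local Notation E := (esp P).
Variable G : set (T -> R).
Hypothesis hG : gaussian_space P G.
Variables (n : nat) (X : 'I_n -> T -> R).
Hypothesis gX : forall i, G (X i).
Local Notation r i j := (E (fun w => X i w * X j w)).
Local Notation S := (sumsq X).
Local Notation Q := (quadcov P X).

Let L2S := sumsq_L2 hG gX.
Let L2Q := quadcov_L2 hG gX.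
Let mS := L2_meas L2S.
Let iS := L2_intg L2S.
Let LSm : L2 P (fun w => S w - E S) := L2B L2S (L2_cst P (E S)).
Let iQ := L2_intg L2Q.

(* In the variable [u = expR (- a x)] on [0, 1], the derivative of the damped function is
   approximated uniformly by polynomials in [u]. *)
Lemma stein_pair_damped (g dg : R -> R) (C a : R) : 0 < a ->
  (forall x, isd g x (dg x)) -> continuous dg ->
  (forall x, `|g x| <= C) -> (forall x, `|dg x| <= C) ->
  stein_pair P X (fun x => g x * expR (- (a * x))) (fun x => (dg x - a * g x) * expR (- (a * x))).
Proof.
move=> a0 hg cdg gC dgC.
have C0 : 0 <= C by rewrite (le_trans _ (gC 0)).
pose phi x := dg x - a * g x.
have cphi : continuous phi.
  move=> x; apply: cvgB; first exact: cdg.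
  by apply: cvgM; [exact: cvg_cst|exact: isd_cts (hg x)].
pose K := C + a * C.
have K0 : 0 <= K by rewrite /K; ge0.
have phiK x : `|phi x| <= K.
  rewrite (le_trans (ler_normB _ _))// lerD// normrM (ger0_norm (ltW a0)).
  by rewrite ler_wpM2l// ltW.
(* The damped derivative read in the variable [u]. Since [phi] is bounded, the factor [u] makes the
   extension by 0 continuous at 0, which corresponds to [x] at infinity; this is the purpose of the
   damping. *)
pose h u := if u <= 0 then 0 else u * phi (- (ln u / a)).
have hb u : `|h u| <= K * `|u|.
  rewrite /h; case: ifP => _; first by rewrite normr0; ge0.
  by rewrite normrM mulrC ler_wpM2r.
have ch u : {for u, continuous h}.
  have [u0|u0|->] := ltgtP u 0.
  - have : h x @[x --> u] --> (0 : R).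
      apply: cvg_near_cst; near=> x; rewrite /h ifT//; apply: ltW.
      by near: x; exact: lt_nbhsl.
    by rewrite /continuous_at /prop_for /h (ltW u0).
  - have : u * phi (- (ln u / a)) = h u by rewrite /h leNgt u0.
    rewrite /prop_for /continuous_at => <-.
    have : x * phi (- (ln x / a)) @[x --> u] --> u * phi (- (ln u / a)).
      apply: cvgM; first exact: cvg_id.
      apply: (@cvg_comp _ _ _ (fun x => - (ln x / a)) phi); last exact: cphi.
      by apply: cvgN; apply: cvgM; [exact: continuous_ln|exact: cvg_cst].
    apply: cvg_trans; apply: near_eq_cvg; near=> x; rewrite /h leNgt ifN//.
    by rewrite negbK; near: x; exact: lt_nbhsr.
  - rewrite /prop_for /continuous_at (_ : h 0 = 0); last by rewrite /h lexx.
    apply/cvgrPdist_lt => e e0; near=> x; rewrite sub0r normrN.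
    apply: (le_lt_trans (hb x)).
    apply: (@le_lt_trans _ _ ((K + 1) * `|x|)); first by rewrite ler_wpM2r// lerDl.
    rewrite mulrC -ltr_pdivlMr; last by rewrite ltr_wpDl.
    rewrite -[x in `|x|]subr0 -normrN opprB; near: x.
    by apply: cvgr_dist_lt; [exact: cvg_id|rewrite divr_gt0// ltr_wpDl].
pose ga x := g x * expR (- (a * x)).
pose psi x := phi x * expR (- (a * x)).
have hga x : isd ga x (psi x).
  apply: isd_eq (isdM (hg x) (isd_expR (isdN (isdZ a (isd_id x))))) _.
  by rewrite /psi /phi; ring.
have psiE x : psi x = h (expR (- (a * x))).
  rewrite /h leNgt expR_gt0 /= expRK /psi mulrC; congr (_ * phi _).
  by field; rewrite gt_eqF.
rewrite /stein_pair -/ga -/psi.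
pose m1 := E (fun w => `|(S w - E S) * S w|); pose m2 := E (fun w => `|Q w|).
have m10 : 0 <= m1 by exact: esp_ge0.
have m20 : 0 <= m2 by exact: esp_ge0.
have me : measurable_fun setT (fun w => expR (- (a * S w))).
  by apply: measurableT_comp => //; apply: measurableT_comp => //; exact: measurable_funM.
have e01 w : 0 <= expR (- (a * S w)) <= 1.
  by rewrite expR_ge0/= -[leRHS]expR0 ler_expR oppr_le0 mulr_ge0 ?sumsq_ge0//; exact: ltW.
have mg : measurable_fun setT g by apply: cts_meas => x; exact: isd_cts (hg x).
have mphi : measurable_fun setT phi by exact: cts_meas.
have iga : L2 P (fun w => ga (S w)).
  apply: (@L2_bdd _ _ _ P _ C).
    by apply: measurable_funM => //; exact: measurableT_comp mg mS.
  move=> w; rewrite normrM (le_trans _ (gC (S w)))// ler_piMr//.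
  by have /andP[? ?] := e01 w; rewrite ger0_norm.
have ipsi : intg P (fun w => Q w * psi (S w)).
  apply: (intgMb iQ (C := K)).
    by apply: measurable_funM => //; exact: measurableT_comp mphi mS.
  move=> w; rewrite normrM (le_trans _ (phiK (S w)))// ler_piMr//.
  by have /andP[? ?] := e01 w; rewrite ger0_norm.
(* An error [dl] in the derivative becomes at most [dl * S] in the function by the mean value
   theorem from 0, which explains the moment [m1]. The constant [ga 0] is free because [S - E S] has
   mean 0. *)
have key (dl : R) : 0 < dl ->
    `|E (fun w => (S w - E S) * ga (S w)) - 2 * E (fun w => Q w * psi (S w))| <= dl * (m1 + 2 * m2).
  move=> dl0; have [p hp] := weierstrass01 ch dl0.
  have [pf pf1 [pf2 pf3 pf4]] := stein_pair_poly hG gX p a0.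
  have ipe : intg P (fun w => Q w * p.[expR (- (a * S w))]).
    have [B hB] : exists B, forall u, 0 <= u <= 1 -> `|p.[u]| <= B.
      have [|c _ hc] := @EVT_max R (fun x => `|p.[x]|) 0 1 ler01.
        apply: continuous_subspaceT => x; apply: cvg_norm.
        have : continuous (fun x => p.[x]) by exact: continuous_horner.
        exact.
      by exists `|p.[c]| => x x01; apply: hc; rewrite in_itv.
    apply: (intgMb iQ (C := B)); last by move=> w; apply: hB.
    have mp : measurable_fun setT (fun x : R => p.[x]).
      by apply: cts_meas; exact: continuous_horner.
    exact: measurableT_comp mp me.
  have EQ : E (fun w => (S w - E S) * ga (S w)) - 2 * E (fun w => Q w * psi (S w)) =
     E (fun w => (S w - E S) * (ga (S w) - pf (S w) - ga 0)) -
     2 * E (fun w => Q w * (psi (S w) - p.[expR (- (a * S w))])).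
    rewrite (eq_esp P (X := fun w => (S w - E S) * (ga (S w) - pf (S w) - ga 0))
      (Y := fun w => ((S w - E S) * ga (S w) - (S w - E S) * pf (S w)) - ga 0 * (S w - E S))); last by move=> w; ring.
    rewrite (eq_esp P (X := fun w => Q w * (psi (S w) - p.[expR (- (a * S w))]))
      (Y := fun w => Q w * psi (S w) - Q w * p.[expR (- (a * S w))])); last by move=> w; ring.
    rewrite !espB ?espZ//; last 5 first.
    - exact: L2_intg LSm.
    - exact: intgM.
    - exact: intgM.
    - by apply: intgB; exact: intgM.
    - by apply: intgZ; exact: L2_intg LSm.
    rewrite pf4 espB ?esp_cst ?subrr//; last exact: intg_cst.
    ring.
  rewrite EQ (le_trans (ler_normB _ _))// mulrDr lerD//.
    rewrite -[dl * m1]espZ; last first.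
      by apply: intg_abs; apply: intgM.
    apply: abs_esp_le.
    - apply: measurable_funM; first exact: L2_meas LSm.
      by apply: measurable_funB => //; apply: measurable_funB; [exact: L2_meas iga|exact: L2_meas pf2].
    - by apply: intgZ; apply: intg_abs; apply: intgM.
    - move=> w; rewrite !normrM mulrCA ler_wpM2l// (ger0_norm (sumsq_ge0 _ _)).
      have S0 := sumsq_ge0 X w.
      have [] := @MVT_segment R (fun x => ga x - pf x) (fun x => psi x - p.[expR (- (a * x))]) 0 (S w) S0.
      + by move=> x _; exact: isdB.
      + by apply: continuous_subspaceT => x; exact: isd_cts (isdB (hga x) (pf1 x)).
      move=> c; rewrite in_itv/= pf3 !subr0 => /andP[c0 _] ->.
      rewrite normrM (ger0_norm S0) ler_wpM2r// psiE; apply: hp.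
      by rewrite expR_ge0/= -[leRHS]expR0 ler_expR oppr_le0; ge0.
  rewrite normrM ger0_norm// mulrCA ler_wpM2l// -[dl * m2]espZ; last exact: intg_abs.
  apply: abs_esp_le; last 1 first.
  - move=> w; rewrite normrM mulrC ler_wpM2r// psiE; exact: hp.
  - apply: measurable_funM; first exact: L2_meas L2Q.
    apply: measurable_funB; first by apply: measurable_funM => //; exact: measurableT_comp mphi mS.
    have mp : measurable_fun setT (fun x : R => p.[x]).
      by apply: cts_meas; exact: continuous_horner.
    exact: measurableT_comp mp me.
  - by apply: intgZ; exact: intg_abs.
apply/eqP; rewrite -subr_eq0 -normr_eq0 eq_le normr_ge0 andbT.
apply/ler_addgt0Pl => e e0; rewrite addr0.
pose M := m1 + 2 * m2 + 1; have M0 : 0 < M by rewrite /M ltr_wpDl//; ge0.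
apply: (le_trans (key (e / M) _)); first by rewrite divr_gt0.
by rewrite mulrAC ler_pdivrMr// ler_wpM2l ?(ltW e0)// /M lerDl.
Unshelve. all: by end_near. Qed.

(** The damping is removed by letting its rate [1 / (k + 1)] tend to 0: the damped function stays
    bounded by [C] and its derivative by [2 C], so dominated convergence applies. *)
Lemma stein_identity (g dg : R -> R) (C : R) :
  (forall x, isd g x (dg x)) -> continuous dg ->
  (forall x, `|g x| <= C) -> (forall x, `|dg x| <= C) -> stein_pair P X g dg.
Proof.
move=> hg cdg gC dgC.
have C0 : 0 <= C by rewrite (le_trans _ (gC 0)).
pose a (k : nat) : R := k.+1%:R^-1.
have a0 k : 0 < a k by rewrite invr_gt0.
have a1 k : a k <= 1 by rewrite invf_le1// ler1n.
have ca : a k @[k --> \oo] --> (0:R) by apply: cvgn_ext (cvgn_scale_harmonic 1) => k; rewrite mul1r.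
have mg : measurable_fun setT g by apply: cts_meas => x; exact: isd_cts (hg x).
have mdg : measurable_fun setT dg by exact: cts_meas.
have mgS : measurable_fun setT (fun w => g (S w)) by exact: measurableT_comp mg mS.
have mdgS : measurable_fun setT (fun w => dg (S w)) by exact: measurableT_comp mdg mS.
have me k : measurable_fun setT (fun w => expR (- (a k * S w))).
  by apply: measurableT_comp => //; apply: measurableT_comp => //; exact: measurable_funM.
have e01 k w : `|expR (- (a k * S w))| <= 1.
  rewrite ger0_norm ?expR_ge0// -[leRHS]expR0 ler_expR oppr_le0 mulr_ge0 ?sumsq_ge0//; exact: ltW.
have ce w : expR (- (a k * S w)) @[k --> \oo] --> (1:R).
  rewrite -[X in _ --> X]expR0 -[X in expR X]oppr0 -[X in - X](mul0r (S w)).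
  apply: (@cvg_comp _ _ _ (fun k => - (a k * S w)) expR); last exact: continuous_expR.
  by apply: cvgN; apply: cvgM => //; exact: cvg_cst.
have l1 : E (fun w => (S w - E S) * (g (S w) * expR (- (a k * S w)))) @[k --> \oo] -->
    E (fun w => (S w - E S) * g (S w)).
  apply: (@esp_dct _ _ _ P _ _ (fun w => C * `|S w - E S|) _ _ _ _).2 => [k|w|k w|].
  - apply: measurable_funM; first exact: L2_meas LSm.
    exact: measurable_funM.
  - apply: cvgM; first exact: cvg_cst.
    by rewrite -[X in _ --> X]mulr1; apply: cvgM => //; exact: cvg_cst.
  - rewrite normrM mulrC ler_wpM2r// normrM (le_trans _ (gC (S w)))// ler_piMr//.
  - by apply: intgZ; apply: intg_abs; exact: L2_intg LSm.
have l2 : E (fun w => Q w * ((dg (S w) - a k * g (S w)) * expR (- (a k * S w)))) @[k --> \oo] -->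
    E (fun w => Q w * dg (S w)).
  apply: (@esp_dct _ _ _ P _ _ (fun w => (C + C) * `|Q w|) _ _ _ _).2 => [k|w|k w|].
  - apply: measurable_funM; first exact: L2_meas L2Q.
    apply: measurable_funM => //; apply: measurable_funB => //.
    exact: measurable_funM.
  - apply: cvgM; first exact: cvg_cst.
    rewrite -[X in _ --> X]mulr1; apply: cvgM => //.
    rewrite -[X in _ --> X]subr0 -[X in _ --> _ - X](mul0r (g (S w))).
    by apply: cvgB; [exact: cvg_cst|apply: cvgM => //; exact: cvg_cst].
  - rewrite normrM mulrC ler_wpM2r// normrM.
    rewrite (@le_trans _ _ `|dg (S w) - a k * g (S w)|)//; first by rewrite ler_piMr.
    rewrite (le_trans (ler_normB _ _))// lerD// normrM (le_trans _ (gC (S w)))//.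
    by rewrite ler_piMl// ger0_norm ?a1// ltW.
  - by apply: intgZ; exact: intg_abs.
rewrite /stein_pair; apply: (cvgn_unique l1).
apply: (@cvgn_ext _ _ (fun k => 2 * E (fun w => Q w * ((dg (S w) - a k * g (S w)) * expR (- (a k * S w)))))); last first.
  by apply: cvgM l2; exact: cvg_cst.
move=> k; exact: (stein_pair_damped (a0 k) hg cdg gC dgC).
Qed.

End stein_identity.

(** * Stein's equation and the quadratic central limit theorem *)

Section comparison.
Context {R : realType}.
Implicit Types (Z dZ : R -> R).

(** The Gaussian tail estimates below are comparisons of this kind: the sign of a derivative and the
    value at infinity replace the estimation of an integral. *)
Lemma ge0_of_decr_lim Z dZ a : (forall x, a <= x -> isd Z x (dZ x)) ->
  (forall x, a <= x -> dZ x <= 0) -> Z n%:R @[n --> \oo] --> (0 : R) -> 0 <= Z a.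
Proof.
move=> hZ dZ0 lim; have h n : (Num.bound `|a| <= n)%N -> Z n%:R <= Z a.
  move=> hn; have an : a <= n%:R.
    rewrite (le_trans (ler_norm _))// ltW// (lt_le_trans (archi_boundP _))//.
    by rewrite ler_nat.
  have [] := @MVT_segment R Z dZ a n%:R an.
  - by move=> x; rewrite in_itv/= => /andP[/ltW ax _]; exact: hZ.
  - apply: continuous_in_subspaceT => x; rewrite inE/= in_itv/= => /andP[ax _].
    exact: isd_cts (hZ x ax).
  move=> c; rewrite in_itv/= => /andP[ac _] e.
  by rewrite -subr_le0 e mulr_le0_ge0 ?subr_ge0// dZ0.
have l2 : Z (n + Num.bound `|a|)%:R @[n --> \oo] --> (0 : R).
  by have := lim; rewrite -(cvg_shiftn (Num.bound `|a|)).
by apply: (cvgn_le_cst l2) => n; apply: h; rewrite leq_addl.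
Qed.

Lemma ge0_of_incr_lim Z dZ a : (forall x, isd Z x (dZ x)) ->
  (forall x, x <= a -> 0 <= dZ x) -> Z (- n%:R) @[n --> \oo] --> (0 : R) -> 0 <= Z a.
Proof.
move=> hZ dZ0 lim; rewrite -[a]opprK.
apply: (@ge0_of_decr_lim (fun x => Z (- x)) (fun x => dZ (- x) * (- 1)) (- a)) => //.
- by move=> x _; apply: (isd_comp (f := Z)); [exact: hZ|exact: isdN (isd_id x)].
- by move=> x xa; rewrite mulrN1 oppr_le0 dZ0// lerNl.
Qed.

End comparison.

(** * Stein's equation for a Lipschitz function *)

Section stein_equation.
Context {R : realType}.
Notation mu := (@lebesgue_measure R).
Local Notation gam := (normal_prob (0:R) 1).
Local Notation p := (normal_pdf (0:R) 1).

Let one_neq0 : (1 : R) != 0. Proof. exact: oner_neq0. Qed.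

Lemma isd_stdpdf x : isd p x (- x * p x).
Proof. by apply: isd_eq (isd_normal_pdf 0 one_neq0 x) _; rewrite subr0 expr1n divr1. Qed.

Lemma stdpdf_gt0 x : 0 < p x.
Proof. by rewrite normal_pdf_expR// mulr_gt0 ?expR_gt0 ?normal_peak_gt0. Qed.

Lemma stdpdf_even x : p (- x) = p x.
Proof. by rewrite !normal_pdf_expR// !subr0 sqrrN. Qed.

Lemma stdpdf_lim : p n%:R @[n --> \oo] --> (0 : R).
Proof.
have pk0 := normal_peak_ge0 (1:R).
apply: (cvgn0_squeeze (v := fun n => (2 * normal_peak (1:R)) * n.+1%:R^-1)); last exact: cvgn_scale_harmonic.
move=> n; rewrite ger0_norm ?(ltW (stdpdf_gt0 _))// normal_pdf_expR// subr0 expr1n mulr1.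
rewrite -mulrA mulrCA ler_wpM2l// expRN.
have e1 := expR_ge1Dx (n%:R ^+ 2 / 2 : R).
apply: (@le_trans _ _ (1 + n%:R ^+ 2 / 2)^-1).
  by rewrite lef_pV2 ?posrE ?expR_gt0// ltr_pwDl//; ge0.
rewrite -[leRHS]invrK lef_pV2 ?posrE; last 2 first.
- by rewrite ltr_pwDl//; ge0.
- by rewrite invr_gt0 mulr_gt0.
rewrite invf_div -natr1; have := ler0n R n; move: (n%:R) => N N0; have := sqr_ge0 (N - 1 / 2); nra.
Qed.

(** A Mills ratio estimate: [v] is bounded by [B] times the Gaussian tail beyond [x], and that tail
    is compared with [2 p x / (1 + x)]. *)
Lemma small_over_pdf (v dv : R -> R) (B : R) : (forall x, isd v x (dv x)) ->
  (forall x, `|dv x| <= B * p x) -> v n%:R @[n --> \oo] --> (0 : R) ->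
  forall x, 0 <= x -> `|v x| <= 2 * B * p x.
Proof.
move=> hv dvB lim x x0.
have B0 : 0 <= B.
  by have := le_trans (normr_ge0 _) (dvB 0); rewrite pmulr_lge0 ?stdpdf_gt0.
have hq y : 0 <= y -> isd (fun y => p y * (1 + y)^-1) y (- (p y * ((1 + y + y ^+ 2) / (1 + y) ^+ 2))).
  move=> y0; have y1 : 1 + y != 0 by rewrite gt_eqF// ltr_pwDl.
  have hi : isd (fun y => (1 + y)^-1) y (- (1 + y) ^- 2 * (0 + 1)).
    apply: (@isd_comp _ (fun z => z^-1) (fun y => 1 + y)).
      by apply: isd_eq (is_deriveV _ (isd_id (1 + y))) _ => //; rewrite /GRing.scale /= mulr1.
    by apply: isdD; [exact: isd_cst|exact: isd_id].
  by apply: isd_eq (isdM (isd_stdpdf y) hi) _; field.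
have limq : p n%:R * (1 + n%:R)^-1 @[n --> \oo] --> (0 : R).
  apply: (cvgn0_squeeze (v := fun n => p n%:R)) stdpdf_lim => n.
  rewrite ger0_norm; last by rewrite mulr_ge0 ?invr_ge0 ?(ltW (stdpdf_gt0 _))//; ge0.
  rewrite ler_piMr ?(ltW (stdpdf_gt0 _))// invf_le1 ?lerDl//.
have key (s : R) : `|s| = 1 -> 0 <= 2 * B * (p x * (1 + x)^-1) - s * v x.
  move=> s1; apply: (@ge0_of_decr_lim _ (fun x => 2 * B * (p x * (1 + x)^-1) - s * v x)
    (fun y => 2 * B * (- (p y * ((1 + y + y ^+ 2) / (1 + y) ^+ 2))) - s * dv y)).
  - move=> y xy; apply: isdB; apply: isdZ; first by apply: hq; exact: le_trans x0 xy.
    exact: hv.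
  - move=> y xy; have y0 := le_trans x0 xy.
    have h1 : - (s * dv y) <= B * p y.
      by rewrite (le_trans (ler_norm _))// normrN normrM s1 mul1r.
    (* The quotient is smallest at [y = 1]; its value 3/4 there is why the factor 2 in the
       comparison function is large enough. *)
    have h2 : 3 / 4 <= (1 + y + y ^+ 2) / (1 + y) ^+ 2.
      by rewrite ler_pdivlMr ?exprn_gt0 ?ltr_pwDl//; have := sqr_ge0 (y - 1); nra.
    have h3 : 0 <= B * p y by rewrite mulr_ge0// ltW// stdpdf_gt0.
    have h4 : B * p y * (3 / 4) <= B * p y * ((1 + y + y ^+ 2) / (1 + y) ^+ 2) by rewrite ler_wpM2l.
    rewrite (_ : 2 * B * _ = - (2 * (B * p y * ((1 + y + y ^+ 2) / (1 + y) ^+ 2)))); last by ring.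
    by move: h1 h3 h4; lra.
  - rewrite -[X in _ --> X](subr0 (0:R)) -[X in _ --> X - _](mulr0 (2 * B)) -[X in _ --> _ - X](mulr0 s).
    by apply: cvgB; (apply: cvgM; [exact: cvg_cst|]).
have h1 := key 1 (normr1 _); have h2 := key (-1) (normrN1 _).
apply: (@le_trans _ _ (2 * B * (p x * (1 + x)^-1))).
  by rewrite ler_norml; apply/andP; split; lra.
rewrite ler_wpM2l//; first by ge0.
rewrite ler_piMr ?(ltW (stdpdf_gt0 _))// invf_le1 ?lerDl//.
by rewrite ltr_pwDl.
Qed.

Lemma small_over_pdf_all (v dv : R -> R) (B : R) : (forall x, isd v x (dv x)) ->
  (forall x, `|dv x| <= B * p x) -> v n%:R @[n --> \oo] --> (0 : R) ->
  v (- n%:R) @[n --> \oo] --> (0 : R) -> forall x, `|v x| <= 2 * B * p x.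
Proof.
move=> hv dvB l1 l2 x; have [x0|/ltW x0] := leP 0 x; first exact: small_over_pdf hv dvB l1 x x0.
rewrite -[x]opprK stdpdf_even.
apply: (@small_over_pdf (fun x => v (- x)) (fun x => dv (- x) * (- 1))) => //.
- by move=> y; apply: (isd_comp (f := v)); [exact: hv|exact: isdN (isd_id y)].
- by move=> y; rewrite mulrN1 normrN -[p y]stdpdf_even.
- by rewrite oppr_ge0.
Qed.

Variable h : R -> R.
Hypothesis lip_h : forall x y, `|h x - h y| <= `|x - y|.

Lemma lip_continuous : continuous h.
Proof.
move=> x; apply/cvgrPdist_lt => e e0; near=> y; apply: (le_lt_trans (lip_h x y)).
by near: y; apply: cvgr_dist_lt; [exact: cvg_id|].
Unshelve. all: by end_near. Qed.

Lemma lip_intg_normal : intg gam h.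
Proof.
have hn := @normal_intg_norm R 0 1 one_neq0.
apply: (@intg_dom _ _ _ gam _ (fun x => `|h 0| + `|x - 0|)).
- exact: cts_meas lip_continuous.
- move=> x; rewrite -[h x](subrK (h 0)) addrC (le_trans (ler_normD _ _))// lerD2l.
  exact: lip_h.
- by apply: intgD => //; exact: intg_cst.
Qed.

Let ht x := h x - esp gam h.

Let iht : intg gam ht.
Proof. by apply: intgB; [exact: lip_intg_normal|exact: intg_cst]. Qed.

Let cht : continuous ht.
Proof. by move=> x; apply: cvgB; [exact: lip_continuous|exact: cvg_cst]. Qed.

(** [I x / p x] is the classical solution of Stein's equation. As [ht] is centred, [I] vanishes at
    both ends of the line. *)
Let I x := \int[mu]_(t in `]-oo, x]) (ht t * p t).

Let I_esp x : I x = esp gam (fun t => ht t * \1_(`]-oo, x]%classic) t) /\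
   intg gam (fun t => ht t * \1_(`]-oo, x]%classic) t).
Proof.
have i1 : intg gam (fun t => ht t * \1_(`]-oo, x]%classic) t).
  apply: (@intgMb _ _ _ gam ht _ 1 iht); first by apply: measurable_indic; exact: measurable_itv.
  by move=> w; rewrite indicE; case: (_ \in _); rewrite ?normr1 ?normr0.
split => //; have [_ ->] := normal_Rintegral i1.
rewrite /I Rintegral_mkcond; apply: eq_Rintegral => t _.
by rewrite patchE indicE; case: ifPn => _; rewrite ?mulr1 ?mulr0 ?mul0r.
Qed.

Let isd_I x : isd I x (ht x * p x).
Proof.
have [i1 _] := normal_Rintegral iht.
have [] := @continuous_FTC1 R (fun t => ht t * p t) -oo%O x (x + 1).
- by rewrite ltrDl.
- by apply: integrableS i1 => //; exact: measurable_itv.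
- by rewrite ltNyr.
- apply: cvgM; [exact: cht|exact: isd_cts (isd_stdpdf x)].
by move=> h1 h2; have := isd_of_derivable h1; rewrite h2.
Qed.

Let I_lim_pos : I n%:R @[n --> \oo] --> (0 : R).
Proof.
have -> : (0:R) = esp gam ht.
  by rewrite espB ?esp_cst ?subrr//; [exact: lip_intg_normal|exact: intg_cst].
apply: (@cvgn_ext _ _ (fun n => esp gam (fun t => ht t * \1_(`]-oo, n%:R]%classic) t))).
  by move=> n; have [] := I_esp n%:R.
apply: (@esp_dct _ _ _ gam _ _ (fun t => `|ht t|) _ _ _ (intg_abs iht)).2 => [n|w|n w].
- by have [_ /intg_meas] := I_esp n%:R.
- apply: cvg_near_cst; exists (Num.bound `|w|) => // n /= hn.
  rewrite indicE mem_set ?mulr1//= in_itv/= (le_trans (ler_norm _))// ltW//.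
  by rewrite (lt_le_trans (archi_boundP _))// ler_nat.
- by rewrite normrM ler_piMr// indicE; case: (_ \in _); rewrite ?normr1 ?normr0.
Qed.

Let I_lim_neg : I (- n%:R) @[n --> \oo] --> (0 : R).
Proof.
have -> : (0:R) = esp gam (fun=> 0) by rewrite esp_cst.
apply: (@cvgn_ext _ _ (fun n => esp gam (fun t => ht t * \1_(`]-oo, (- n%:R)]%classic) t))).
  by move=> n; have [] := I_esp (- n%:R).
apply: (@esp_dct _ _ _ gam _ _ (fun t => `|ht t|) _ _ _ (intg_abs iht)).2 => [n|w|n w].
- by have [_ /intg_meas] := I_esp (- n%:R).
- apply: cvg_near_cst; exists (Num.bound `|w|) => // n /= hn.
  rewrite indicE memNset ?mulr0//= in_itv/=; apply/negP; rewrite -ltNge ltrNl.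
  rewrite (le_lt_trans (ler_norm _))// normrN.
  by rewrite (lt_le_trans (archi_boundP _))// ler_nat.
- by rewrite normrM ler_piMr// indicE; case: (_ \in _); rewrite ?normr1 ?normr0.
Qed.

(** Since [h] is merely Lipschitz, [df] need not be differentiable. The bound on [df] therefore
    comes from bounding the difference quotients of [f] and passing to the limit. *)
Lemma stein_equation : exists f df : R -> R,
  [/\ forall x, isd f x (df x), continuous df, forall x, `|f x| <= 1, forall x, `|df x| <= 4
    & forall x, df x - x * f x = h x - esp gam h].
Proof.
have p0 x : p x != 0 by rewrite gt_eqF ?stdpdf_gt0.
pose f x := I x * (p x)^-1.
have hf x : isd f x (ht x + x * f x).
  have hi : isd (fun y => (p y)^-1) x (- (p x) ^- 2 * (- x * p x)).
    apply: (@isd_comp _ (fun z => z^-1) p); last exact: isd_stdpdf.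
    by apply: isd_eq (is_deriveV _ (isd_id (p x))) _ => //; rewrite /GRing.scale /= mulr1.
  by apply: isd_eq (isdM (isd_I x) hi) _; rewrite /f; field.
have plimN : p (- n%:R) @[n --> \oo] --> (0 : R).
  by apply: cvgn_ext stdpdf_lim => n; rewrite stdpdf_even.
have f1 x : `|f x| <= 1.
  (* The derivative of [p - s I] is [p] times [- y - s ht y], which is nonincreasing because [h] is
     1-Lipschitz. So [p - s I], which vanishes at both infinities, decreases to the right of [x] or
     increases to its left. *)
  have key (s : R) : `|s| = 1 -> 0 <= p x - s * I x.
    move=> s1.
    have hJ y : isd (fun y => p y - s * I y) y ((- y - s * ht y) * p y).
      by apply: isd_eq (isdB (isd_stdpdf y) (isdZ s (isd_I y))) _; ring.
    have mono y z : y <= z -> - z - s * ht z <= - y - s * ht y.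
      move=> yz; rewrite -subr_ge0.
      have : s * (ht y - ht z) <= z - y.
        rewrite (le_trans (ler_norm _))// normrM s1 mul1r /ht.
        rewrite (_ : _ - _ = h y - h z); last by ring.
        by rewrite (le_trans (lip_h _ _))// distrC ger0_norm ?subr_ge0.
      by lra.
    have [k0|/ltW k0] := leP (- x - s * ht x) 0.
      apply: (@ge0_of_decr_lim _ (fun y => p y - s * I y)); first by move=> y _; exact: hJ.
        move=> y xy; rewrite pmulr_lle0 ?stdpdf_gt0//; exact: le_trans (mono _ _ xy) k0.
      rewrite -[X in _ --> X](subr0 (0:R)) -[X in _ --> _ - X](mulr0 s).
      by apply: cvgB; [exact: stdpdf_lim|apply: cvgM; [exact: cvg_cst|exact: I_lim_pos]].
    apply: (@ge0_of_incr_lim _ (fun y => p y - s * I y) (fun y => (- y - s * ht y) * p y)) => //.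
      move=> y xy; rewrite pmulr_lge0 ?stdpdf_gt0//; exact: le_trans k0 (mono _ _ xy).
    rewrite -[X in _ --> X](subr0 (0:R)) -[X in _ --> _ - X](mulr0 s).
    by apply: cvgB => //; apply: cvgM; [exact: cvg_cst|exact: I_lim_neg].
  rewrite /f normrM normfV [`|p x|]ger0_norm ?(ltW (stdpdf_gt0 _))// ler_pdivrMr ?stdpdf_gt0// mul1r.
  have h1 := key 1 (normr1 _); have h2 := key (-1) (normrN1 _).
  by rewrite ler_norml; apply/andP; split; lra.
have cf : continuous f by move=> x; exact: isd_cts (hf x).
exists f, (fun x => ht x + x * f x); split => //.
- move=> x; apply: cvgD; first exact: cht.
  by apply: cvgM; [exact: cvg_id|exact: cf].
- (* The translate [f (x + e) - f x] solves the same equation with a right-hand side of size [2 e]. *)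
  have lipf (e : R) : 0 < e -> forall x, `|f (x + e) - f x| <= 4 * e.
    move=> e0 x.
    pose v y := (f (y + e) - f y) * p y.
    have hv y : isd v y ((e * f (y + e) + (h (y + e) - h y)) * p y).
      have hs : isd (fun y => f (y + e)) y ((ht (y + e) + (y + e) * f (y + e)) * (1 + 0)).
        apply: (isd_comp (f := f)); first exact: hf.
        by apply: isdD; [exact: isd_id|exact: isd_cst].
      by apply: isd_eq (isdM (isdB hs (hf y)) (isd_stdpdf y)) _; rewrite /ht; ring.
    have v2 y : `|v y| <= 2 * p y.
      rewrite normrM [`|p y|]ger0_norm ?(ltW (stdpdf_gt0 _))// ler_wpM2r ?(ltW (stdpdf_gt0 _))//.
      by rewrite (le_trans (ler_normB _ _))//; have := f1 (y + e); have := f1 y; lra.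
    have := @small_over_pdf_all v _ (2 * e) hv _ _ _ x.
    rewrite /v normrM [`|p x|]ger0_norm ?(ltW (stdpdf_gt0 _))// ler_pM2r ?stdpdf_gt0//.
    rewrite mulrA -natrM; apply.
    + move=> y; rewrite normrM [`|p y|]ger0_norm ?(ltW (stdpdf_gt0 _))// ler_wpM2r ?(ltW (stdpdf_gt0 _))//.
      rewrite (le_trans (ler_normD _ _))// mulr_natl mulr2n lerD//.
        by rewrite normrM gtr0_norm// ler_piMr// ltW.
      by rewrite (le_trans (lip_h _ _))// addrAC subrr add0r gtr0_norm.
    + apply: (cvgn0_squeeze (v := fun n => 2 * p n%:R)); first by move=> n; exact: v2.
      by rewrite -[X in _ --> X](mulr0 2); apply: cvgM; [exact: cvg_cst|exact: stdpdf_lim].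
    + apply: (cvgn0_squeeze (v := fun n => 2 * p (- n%:R))); first by move=> n; exact: v2.
      by rewrite -[X in _ --> X](mulr0 2); apply: cvgM; [exact: cvg_cst|].
  move=> x; have hd := hf x.
  have hder : derivable f x 1 := isd_derivable hd.
  rewrite -(isd_derive1 hd) derive1E /derive.
  have hc : forall (e : R), e != 0 -> `|e^-1 *: (f (e *: (1:R) + x) - f x)| <= 4.
    move=> e e0; rewrite /GRing.scale /= mulr1 normrM normfV mulrC ler_pdivrMr ?normr_gt0//.
    have [e1|e1|e1] := ltgtP e 0; last by rewrite e1 eqxx in e0.
      have := lipf (- e) _ (e + x); rewrite oppr_gt0 => /(_ e1).
      by rewrite addrAC subrr add0r distrC (ltr0_norm e1).
    by rewrite (addrC e x) (gtr0_norm e1); exact: lipf.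
  rewrite ler_norml; apply/andP; split.
  + apply: limr_ge; first exact: hder.
    near=> e; have : e != 0 by near: e; exact: nbhs_dnbhs_neq.
    by move=> /hc; rewrite ler_norml => /andP[].
  + apply: limr_le; first exact: hder.
    near=> e; have : e != 0 by near: e; exact: nbhs_dnbhs_neq.
    by move=> /hc; rewrite ler_norml => /andP[].
- by move=> x; rewrite addrK.
Unshelve. all: by end_near. Qed.

End stein_equation.

(** * Normal approximation of a sum of squares *)

Section quadratic_clt.
Context {d : measure_display} {T : measurableType d} {R : realType}.
Variable P : probability T R.
Local Notation E := (esp P).
Variable G : set (T -> R).
Hypothesis hG : gaussian_space P G.
Variables (n : nat) (X : 'I_n -> T -> R).
Hypothesis gX : forall i, G (X i).
Local Notation r i j := (E (fun w => X i w * X j w)).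
Local Notation S := (sumsq X).
Local Notation Q := (quadcov P X).
Local Notation gam := (normal_prob (0:R) 1).

Lemma quadratic_stein (h : R -> R) : (forall x y, `|h x - h y| <= `|x - y|) ->
  let s2 := E (fun w => (S w - E S) ^+ 2) in 0 < s2 ->
  `|E (fun w => h ((Num.sqrt s2)^-1 * (S w - E S))) - esp gam h| <=
  8 * s2^-1 * Num.sqrt (E (fun w => (Q w - E Q) ^+ 2)).
Proof.
move=> lip s2 s20; have [f [df [hf cdf f1 df4 eqf]]] := stein_equation lip.
set k := (Num.sqrt s2)^-1.
have k0 : 0 < k by rewrite invr_gt0 sqrtr_gt0.
have k2 : k ^+ 2 = s2^-1 by rewrite exprVn sqr_sqrtr// ltW.
have L2S := sumsq_L2 hG gX; have L2Q := quadcov_L2 hG gX.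
have LSm : L2 P (fun w => S w - E S) := L2B L2S (L2_cst P (E S)).
pose F w := k * (S w - E S).
have LF : L2 P F by exact: L2Z.
have mF := L2_meas LF.
have cf : continuous f by move=> x; exact: isd_cts (hf x).
have mf : measurable_fun setT (fun w => f (F w)) by apply: measurableT_comp mF; exact: cts_meas.
have mdf : measurable_fun setT (fun w => df (F w)) by apply: measurableT_comp mF; exact: cts_meas.
pose g x := f (k * (x - E S)); pose dg x := df (k * (x - E S)) * k.
have hg x : isd g x (dg x).
  apply: isd_eq (isd_comp (f := f) (hf _) (isdZ k (isdB (isd_id x) (isd_cst (E S) x)))) _.
  by rewrite /dg; ring.
have cdg : continuous dg.
  move=> x; apply: cvgM; last exact: cvg_cst.
  apply: (@cvg_comp _ _ _ (fun x => k * (x - E S)) df); last exact: cdf.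
  by apply: cvgM; [exact: cvg_cst|apply: cvgB; [exact: cvg_id|exact: cvg_cst]].
have gC x : `|g x| <= 1 + 4 * k by rewrite (le_trans (f1 _))// lerDl; ge0.
have dgC x : `|dg x| <= 1 + 4 * k.
  rewrite normrM (gtr0_norm k0) (@le_trans _ _ (4 * k))//; last by rewrite lerDr.
  by rewrite ler_wpM2r// ltW.
have st := stein_identity hG gX hg cdg gC dgC.
have iFf : intg P (fun w => F w * f (F w)) by exact: intgMb (L2_intg LF) mf (fun w => f1 _).
have idf : intg P (fun w => df (F w)) by exact: intg_bdd mdf (fun w => df4 _).
have iQdf : intg P (fun w => Q w * df (F w)) by exact: intgMb (L2_intg L2Q) mdf (fun w => df4 _).
have EFf : E (fun w => F w * f (F w)) = 2 * k ^+ 2 * E (fun w => Q w * df (F w)).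
  rewrite (eq_esp P (Y := fun w => k * ((S w - E S) * g (S w)))); last first.
    by move=> w; rewrite /F /g; ring.
  rewrite espZ; last first.
    apply: (intgMb (L2_intg LSm) (C := 1)); last by move=> w; exact: f1.
    exact: mf.
  rewrite st (eq_esp P (Y := fun w => k * (Q w * df (F w)))).
    by rewrite espZ//; ring.
  by move=> w; rewrite /dg /F; ring.
(* This normalizes the Stein factor [2 k^2 Q] to mean 1, so that only its fluctuation remains. The
   final 8 is this factor 2 times the bound 4 on [df]. *)
have s2E : s2 = 2 * E Q by rewrite /s2 (var_sumsq hG gX) (esp_quadcov hG gX).
have EQ1 : 2 * k ^+ 2 * E Q = 1.
  by rewrite k2 mulrAC -s2E mulfV// gt_eqF.
have LW : L2 P (fun w => 2 * k ^+ 2 * (Q w - E Q)).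
  by apply: L2Z; apply: L2B => //; exact: L2_cst.
have -> : E (fun w => h (k * (S w - E S))) - esp gam h =
    E (fun w => - (2 * k ^+ 2 * (Q w - E Q)) * df (F w)).
  rewrite -[esp gam h](esp_cst P) -espB; last 2 first.
  - apply: (@eq_intg _ _ _ P (fun w => df (F w) - F w * f (F w) + esp gam h)).
      by move=> w; rewrite -/(F w) eqf subrK.
    by apply: intgD; [exact: intgB|exact: intg_cst].
  - exact: intg_cst.
  rewrite (eq_esp P (Y := fun w => df (F w) - F w * f (F w))); last by move=> w; rewrite -eqf.
  rewrite espB// EFf.
  rewrite (eq_esp P (X := fun w => - _ * _) (Y := fun w => (2 * k ^+ 2 * E Q) * df (F w) - (2 * k ^+ 2) * (Q w * df (F w)))); last by move=> w; ring.
  by rewrite espB ?espZ//; [rewrite EQ1 mul1r|exact: intgZ|exact: intgZ].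
apply: (@le_trans _ _ (E (fun w => 4 * `|2 * k ^+ 2 * (Q w - E Q)|))).
  apply: abs_esp_le.
  - apply: measurable_funM => //; apply: measurableT_comp => //; exact: L2_meas LW.
  - by apply: intgZ; apply: intg_abs; exact: L2_intg LW.
  - by move=> w; rewrite normrM normrN mulrC ler_wpM2r.
rewrite espZ; last by apply: intg_abs; exact: L2_intg LW.
have := esp_norm_le LW.
rewrite (eq_esp P (X := fun w => (_ * _) ^+ 2) (Y := fun w => (2 * k ^+ 2) ^+ 2 * (Q w - E Q) ^+ 2)); last by move=> w; rewrite exprMn.
rewrite espZ; last by apply: L2_sq; apply: L2B => //; exact: L2_cst.
rewrite sqrtrM ?sqr_ge0// sqrtr_sqr ger0_norm; last by ge0.
by rewrite k2; lra.
Qed.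

(** One of the four covariances is bounded by [rho]; the other three form the path j - i - k - l.
    Summing along the path costs one row sum per new index, so only the first index contributes a
    factor [n]. *)
Lemma var_quadcov_le (rho : R) : (forall i, \sum_j `|r i j| <= rho) ->
  E (fun w => (Q w - E Q) ^+ 2) <= 2 * (n%:R * rho ^+ 4).
Proof.
move=> hrho; rewrite (var_quadcov hG gX) ler_wpM2l//.
have [n0|n0] := posnP n.
  have r4 : 0 <= rho ^+ 4 by rewrite exprn_even_ge0.
  rewrite (@le_trans _ _ 0)//; last by ge0.
  by rewrite big1// => i; have := ltn_ord i; rewrite {2}n0.
have rho0 : 0 <= rho by apply: le_trans (hrho (Ordinal n0)); exact: sumr_ge0.
have rle i j : `|r i j| <= rho.
  by apply: le_trans (hrho i); rewrite (bigD1 j)//= lerDl; exact: sumr_ge0.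
have -> : n%:R * rho ^+ 4 = \sum_(i < n) (rho * (rho * (rho * rho))).
  by rewrite sumr_const card_ord mulr_natl; congr (_ *+ _); ring.
apply: ler_sum => i _.
apply: (@le_trans _ _ (\sum_j `|r i j| * (\sum_k `|r i k| * (\sum_l `|r k l| * rho)))).
  apply: ler_sum => j _; rewrite mulr_sumr; apply: ler_sum => k _.
  rewrite !mulr_sumr; apply: ler_sum => l _.
  rewrite (le_trans (ler_norm _))// !normrM -!mulrA ler_wpM2l// mulrCA ler_wpM2l//.
  by rewrite ler_wpM2l.
have h k : \sum_l `|r k l| * rho <= rho * rho by rewrite -mulr_suml ler_wpM2r.
have h2 : \sum_k `|r i k| * (\sum_l `|r k l| * rho) <= rho * (rho * rho).
  apply: (@le_trans _ _ (\sum_k `|r i k| * (rho * rho))).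
    by apply: ler_sum => k _; rewrite ler_wpM2l.
  by rewrite -mulr_suml ler_wpM2r//; ge0.
apply: (@le_trans _ _ (\sum_j `|r i j| * (rho * (rho * rho)))).
  by apply: ler_sum => j _; rewrite ler_wpM2l.
by rewrite -mulr_suml ler_wpM2r//; ge0.
Qed.

Lemma var_sumsq_ge (v : R) : (forall i, r i i = v) ->
  2 * (n%:R * v ^+ 2) <= E (fun w => (S w - E S) ^+ 2).
Proof.
move=> hv; rewrite (var_sumsq hG gX) ler_wpM2l//.
rewrite mulr_natl -[X in _ *+ X](card_ord n) -sumr_const; apply: ler_sum => i _.
by rewrite (bigD1 i)//= hv lerDl; apply: sumr_ge0 => j _; exact: sqr_ge0.
Qed.

Lemma quadratic_clt (h : R -> R) (rho v : R) : (0 < n)%N -> 0 < v ->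
  (forall x y, `|h x - h y| <= `|x - y|) ->
  (forall i, r i i = v) -> (forall i, \sum_j `|r i j| <= rho) ->
  `|E (fun w => h ((Num.sqrt (E (fun w => (S w - E S) ^+ 2)))^-1 * (S w - E S))) - esp gam h|
  <= 8 * (rho ^+ 2 / v ^+ 2) / Num.sqrt n%:R.
Proof.
move=> n0 v0 lip hv hrho; set s2 := E (fun w => (S w - E S) ^+ 2).
have nR : 0 < n%:R :> R by rewrite ltr0n.
have h1 : 2 * (n%:R * v ^+ 2) <= s2 by exact: var_sumsq_ge.
have nv0 : 0 < 2 * (n%:R * v ^+ 2) by rewrite !mulr_gt0// exprn_gt0.
have s20 : 0 < s2 by exact: lt_le_trans h1.
apply: (le_trans (quadratic_stein lip s20)).
have rho0 : 0 <= rho by apply: le_trans (hrho (Ordinal n0)); exact: sumr_ge0.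
(* The bound [2 n rho^4] is loosened to [4 n rho^4], a perfect square. *)
have h2 : Num.sqrt (E (fun w => (Q w - E Q) ^+ 2)) <= 2 * (Num.sqrt n%:R * rho ^+ 2).
  rewrite (@le_trans _ _ (Num.sqrt ((2 * (Num.sqrt n%:R * rho ^+ 2)) ^+ 2)))//.
    apply: ler_wsqrtr; apply: (le_trans (var_quadcov_le hrho)).
    have -> : (2 * (Num.sqrt n%:R * rho ^+ 2)) ^+ 2 = 4 * (Num.sqrt n%:R ^+ 2 * rho ^+ 4) by ring.
    rewrite sqr_sqrtr ?(ltW nR)//.
    have : 0 <= n%:R * rho ^+ 4 by rewrite mulr_ge0 ?(ltW nR)// exprn_even_ge0.
    by lra.
  by rewrite sqrtr_sqr ger0_norm//; ge0.
have h3 : s2^-1 <= (2 * (n%:R * v ^+ 2))^-1 by rewrite lef_pV2.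
apply: (@le_trans _ _ (8 * (2 * (n%:R * v ^+ 2))^-1 * (2 * (Num.sqrt n%:R * rho ^+ 2)))).
  by apply: ler_pM => //; [rewrite mulr_ge0// invr_ge0 ltW|rewrite ler_wpM2l].
have sn0 : Num.sqrt n%:R != 0 :> R by rewrite gt_eqF// sqrtr_gt0.
have nE : n%:R = Num.sqrt n%:R ^+ 2 :> R by rewrite sqr_sqrtr// ltW.
rewrite {1}nE le_eqVlt; apply/orP; left; apply/eqP; field.
by rewrite sn0 gt_eqF.
Qed.

End quadratic_clt.

(** * The Beta function and the range of nu2 *)

Section primitive01.
Context {R : realType}.
Local Notation mu := (@lebesgue_measure R).
Implicit Types (f F : R -> R) (x : R).

Lemma bigcup_itv01 : \bigcup_n `[(n.+3%:R^-1 : R), 1 - n.+3%:R^-1]%classic = `]0, 1[%classic.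
Proof.
apply/seteqP; split => [x [n _]|x] /=; rewrite !in_itv/= => /andP[h1 h2].
  have h0 : 0 < n.+3%:R^-1 :> R by rewrite invr_gt0.
  move: (_^-1) h1 h2 h0 => a h1 h2 h0.
  by apply/andP; split; lra.
have m0 : 0 < Num.min x (1 - x) by rewrite lt_min h1 subr_gt0.
exists (Num.bound (Num.min x (1 - x))^-1) => //=; rewrite in_itv/=.
set n := Num.bound _.
have : (n.+3%:R : R)^-1 <= Num.min x (1 - x).
  rewrite -[leRHS]invrK lef_pV2 ?posrE ?invr_gt0//.
  apply: ltW; apply: (lt_le_trans (archi_boundP _)); first by rewrite invr_ge0 ltW.
  by rewrite ler_nat -addn3 leq_addr.
rewrite le_min; move: (_^-1) => a /andP[? ?]; by apply/andP; split; lra.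
Qed.

(** The bounded primitive bounds the integral over every compact subinterval by [2 C], and monotone
    convergence exhausts the open interval. Starting at [n.+3] makes [a < 1 - a] from the first
    subinterval on. *)
Lemma integrable01 f F (C : R) : measurable_fun setT f ->
  (forall x, 0 <= f x) ->
  (forall x, 0 < x < 1 -> isd F x (f x)) ->
  (forall x, 0 < x < 1 -> {for x, continuous f}) ->
  (forall x, 0 < x < 1 -> `|F x| <= C) ->
  mu.-integrable `]0, 1[ (EFin \o f).
Proof.
move=> mf f0 hF cf FC; apply/integrableP; split.
  by apply/measurable_EFinP; apply: measurable_funS mf.
have mE (D : set R) : measurable_fun D (EFin \o f).
  by apply/measurable_EFinP; apply: measurable_funS mf.
under eq_integral do rewrite /= ger0_norm//.
pose Fn n : set R := `[(n.+3%:R^-1 : R), 1 - n.+3%:R^-1]%classic.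
have n3 n : (n.+3%:R : R)^-1 <= 3^-1 by rewrite lef_pV2 ?posrE// ler_nat.
have hFn n : (\int[mu]_(x in Fn n) (f x)%:E <= (2 * C)%:E)%E.
  have n0 : 0 < n.+3%:R^-1 :> R by rewrite invr_gt0.
  have := n3 n; rewrite /Fn; move: (n.+3%:R^-1) n0 => a n0 a3.
  have in01 x : a <= x <= 1 - a -> 0 < x < 1 by move=> /andP[? ?]; apply/andP; split; lra.
  have ctsF x : 0 < x < 1 -> {for x, continuous F} by move=> h; exact: isd_cts (hF x h).
  rewrite (@continuous_FTC2 _ f F).
  - rewrite -EFinB lee_fin (le_trans (ler_norm _))// (le_trans (ler_normB _ _))//.
    have := @FC a; have := @FC (1 - a).
    by move=> /(_ ltac:(apply/andP; split; lra)) ? /(_ ltac:(apply/andP; split; lra)) ?; lra.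
  - by lra.
  - apply: continuous_in_subspaceT => x; rewrite inE/= in_itv/= => h; exact: cf (in01 _ h).
  - split.
    + move=> x; rewrite in_itv/= => /andP[? ?]; apply: isd_derivable (hF x _).
      by apply/andP; split; lra.
    + apply: cvg_at_right_filter; apply: ctsF; apply: in01; apply/andP; split; lra.
    + apply: cvg_at_left_filter; apply: ctsF; apply: in01; apply/andP; split; lra.
  - move=> x; rewrite in_itv/= => /andP[? ?]; apply: isd_derive1 (hF x _).
    by apply/andP; split; lra.
have nnd : nondecreasing_seq Fn.
  apply/nondecreasing_seqP => n; apply/subsetPset => x; rewrite /Fn/= !in_itv/=.
  move=> /andP[h1 h2].
  have : (n.+4%:R : R)^-1 <= n.+3%:R^-1 by rewrite lef_pV2 ?posrE// ler_nat.
  move: (n.+4%:R^-1) (n.+3%:R^-1) h1 h2 => a b h1 h2.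
  by move=> ?; apply/andP; split; lra.
have mFn n : measurable (Fn n) by exact: measurable_itv.
have h0 (i : nat) x : Fn i x -> (0 <= (EFin \o f) x)%E by move=> _; rewrite lee_fin.
have := ge0_nondecreasing_set_cvg_integral (mu := mu) nnd mFn (fun i => mE (Fn i)) h0.
rewrite bigcup_itv01 => hc.
apply: (@le_lt_trans _ _ ((2 * C)%:E)); last exact: ltry.
rewrite -(cvg_lim _ hc)//; apply: lime_le; first by apply/cvg_ex; eexists; exact: hc.
by apply: nearW => n; exact: hFn.
Qed.

Lemma primitive01 f : measurable_fun setT f -> mu.-integrable `]0, 1[ (EFin \o f) ->
  (forall x, 0 < x < 1 -> {for x, continuous f}) ->
  exists G : R -> R, [/\ G 0 = 0, G 1 = \int[mu]_(x in `]0, 1[) f x,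
    {within `[0, 1], continuous G} & forall x, 0 < x < 1 -> isd G x (f x)].
Proof.
move=> mf fi cf.
have fi1 : mu.-integrable `[0, 1] (EFin \o f).
  apply/integrableP; split; first by apply/measurable_EFinP; apply: measurable_funS mf.
  have /integrableP[_] := fi; congr (_ < _)%E; apply/esym.
  apply: (@integral_itv_bndoo R 0 1 _ true false).
  by apply: measurableT_comp => //; apply/measurable_EFinP; apply: measurable_funS mf.
exists (fun x => parameterized_integral mu 0 x f); split.
- by rewrite /parameterized_integral set_itv1 Rintegral_set1.
- rewrite /parameterized_integral /Rintegral; congr fine.
  by apply: integral_itv_bndoo; apply/measurable_EFinP; apply: measurable_funS mf.
- exact: parameterized_integral_continuous.
move=> x /[dup] hx /andP[x0 x1].
have [] := @continuous_FTC1_closed R f 0 x 1 x1 fi1 x0 (cf x hx).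
by move=> h <-; exact: isd_of_derivable.
Qed.

End primitive01.

(** * Positivity, monotonicity and continuity of Beta *)

Section Beta_function.
Context {R : realType}.
Local Notation mu := (@lebesgue_measure R).
Implicit Types (a b x : R).

Let bg a b x := x `^ (a - 1) * (1 - x) `^ (b - 1).
(** The two endpoint singularities are separated: on either half of the interval the power that is
    regular there is at most 2. Unlike the Beta integrand, the sum has an elementary primitive. *)
Let dom a b x := 2 * (x `^ (a - 1) + (1 - x) `^ (b - 1)).

Let bg_ge0 a b x : 0 <= bg a b x.
Proof. by rewrite mulr_ge0// powR_ge0. Qed.

Let meas1B p : measurable_fun setT (fun x : R => (1 - x) `^ p).
Proof.
apply: (measurableT_comp (f := fun y : R => y `^ p)); first exact: measurable_powR.
by apply: measurable_funB.
Qed.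

Let bg_meas a b : measurable_fun setT (bg a b).
Proof. by apply: measurable_funM; [exact: measurable_powR|exact: meas1B]. Qed.

Let isd_1B x : isd (fun y : R => 1 - y) x (-1).
Proof. by apply: isd_eq (isdB (isd_cst 1 x) (isd_id x)) _; rewrite sub0r. Qed.

Let bg_cts a b x : 0 < x < 1 -> {for x, continuous (bg a b)}.
Proof.
move=> /andP[x0 x1]; apply: isd_cts.
apply: isdM; first exact: isd_powR (isd_id x).
by apply: isd_powR (isd_1B x); rewrite subr_gt0.
Qed.

Lemma powR_le1 x (p : R) : 0 <= x <= 1 -> 0 <= p -> x `^ p <= 1.
Proof.
by move=> /andP[x0 x1] p0; have -> : 1 = 1 `^ p :> R; [rewrite powR1|rewrite ge0_ler_powR// nnegrE].
Qed.

Let dom_intg a b : 0 < a -> 0 < b -> mu.-integrable `]0, 1[ (EFin \o dom a b).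
Proof.
move=> a0 b0.
apply: (@integrable01 _ _ (fun x => 2 * (x `^ a / a - (1 - x) `^ b / b)) (2 * (a^-1 + b^-1))).
- apply: measurable_funM => //; apply: measurable_funD; [exact: measurable_powR|exact: meas1B].
- by move=> x; rewrite mulr_ge0// addr_ge0// powR_ge0.
- move=> x /andP[x0 x1].
  have h1x : 0 < 1 - x by rewrite subr_gt0.
  apply: isd_eq (isdZ 2 (isdB (isdM (isd_powR (f := fun y => y) a x0 (isd_id x)) (isd_cst a^-1 x)) (isdM (isd_powR (f := fun y => 1 - y) b h1x (isd_1B x)) (isd_cst b^-1 x)))) _.
  by rewrite /dom; field; rewrite !gt_eqF.
- move=> x /andP[x0 x1]; have h1x : 0 < 1 - x by rewrite subr_gt0.
  by apply: isd_cts; apply: isdZ; apply: isdD; [exact: isd_powR (isd_id x)|exact: isd_powR (isd_1B x)].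
move=> x /andP[x0 x1]; rewrite normrM ger0_norm// ler_wpM2l// (le_trans (ler_normB _ _))//.
rewrite !normrM !(ger0_norm (powR_ge0 _ _)) !gtr0_norm ?invr_gt0//.
have h (y p : R) : 0 < y < 1 -> 0 < p -> y `^ p / p <= p^-1.
  move=> /andP[y0 y1] p0; rewrite ler_piMl ?invr_ge0 ?(ltW p0)//.
  by rewrite powR_le1 ?(ltW p0)// (ltW y0) (ltW y1).
by apply: lerD; apply: h => //; apply/andP; split; lra.
Qed.

Let powR_le2 x (p : R) : 1 / 2 <= x <= 1 -> -1 <= p <= 0 -> x `^ p <= 2.
Proof.
move=> /andP[x0 x1] /andP[p1 p0].
have xp : 0 < x by lra.
rewrite (@le_trans _ _ (x `^ (-1)))//.
  by apply: ger_powR => //; rewrite xp.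
rewrite powR_inv1 ?(ltW xp)// -[2]invrK lef_pV2 ?posrE//; lra.
Qed.

Let bg_le_dom a b a' x : 0 < x < 1 -> a' <= a -> 0 <= a' <= 1 -> 0 <= b <= 1 ->
  bg a b x <= dom a' b x.
Proof.
move=> /andP[x0 x1] aa /andP[a0 a1] /andP[b0 b1].
have xa : x `^ (a - 1) <= x `^ (a' - 1) by apply: ger_powR; rewrite ?x0 ?(ltW x1)//; lra.
apply: (@le_trans _ _ (x `^ (a' - 1) * (1 - x) `^ (b - 1))); first by rewrite ler_wpM2r// powR_ge0.
rewrite /dom mulrDr; have [x2|x2] := leP x (1 / 2).
  apply: (@le_trans _ _ (2 * x `^ (a' - 1))); last by rewrite lerDl mulr_ge0// powR_ge0.
  rewrite mulrC ler_wpM2r ?powR_ge0// powR_le2//; apply/andP; split; lra.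
apply: (@le_trans _ _ (2 * (1 - x) `^ (b - 1))); last by rewrite lerDr mulr_ge0// powR_ge0.
rewrite ler_wpM2r ?powR_ge0// powR_le2//; apply/andP; split; lra.
Qed.

Lemma Beta_integrable a b : 0 < a -> 0 < b <= 1 -> mu.-integrable `]0, 1[
  (EFin \o (fun x => x `^ (a - 1) * (1 - x) `^ (b - 1))).
Proof.
move=> a0 /andP[b0 b1].
have m0 : 0 < Num.min a 1 by rewrite lt_min a0 ltr01.
apply: le_integrable (dom_intg m0 b0) => //.
  by apply/measurable_EFinP; apply: measurable_funS (bg_meas a b).
move=> x /=; rewrite in_itv/= => hx; rewrite lee_fin ger0_norm ?bg_ge0//.
apply: le_trans (ler_norm _); apply: bg_le_dom => //; first by rewrite ge_min lexx.
  by rewrite (ltW m0)/= ge_min lexx orbT.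
by rewrite (ltW b0).
Qed.

Lemma Beta_primitive a b : 0 < a -> 0 < b <= 1 ->
  exists G : R -> R, [/\ G 0 = 0, G 1 = Beta a b, {within `[0, 1], continuous G} &
    forall x, 0 < x < 1 -> isd G x (x `^ (a - 1) * (1 - x) `^ (b - 1))].
Proof.
move=> a0 hb; apply: primitive01; first exact: bg_meas.
  exact: Beta_integrable.
by move=> x; exact: bg_cts.
Qed.

(** A mean value replaces the estimation of the integral: lower bounds of the integrand at an
    unknown interior point are enough for [Beta_gt0] and [Beta_ge1]. *)
Lemma Beta_mean a b : 0 < a -> 0 < b <= 1 ->
  exists2 x, 0 < x < 1 & Beta a b = x `^ (a - 1) * (1 - x) `^ (b - 1).
Proof.
move=> a0 hb; have [G [G0 G1 cG dG]] := Beta_primitive a0 hb.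
have [] := @MVT _ G (bg a b) 0 1 ltr01 _ cG.
  by move=> x; rewrite in_itv/= => /dG.
move=> x; rewrite in_itv/= => hx; rewrite G0 G1 !subr0 mulr1 => ->.
by exists x.
Qed.

Lemma Beta_gt0 a b : 0 < a -> 0 < b <= 1 -> 0 < Beta a b.
Proof.
move=> a0 hb; have [x /andP[x0 x1] ->] := Beta_mean a0 hb.
by rewrite mulr_gt0// powR_gt0// subr_gt0.
Qed.

Lemma Beta_ge1 a b : 0 < a <= 1 -> 0 < b <= 1 -> 1 <= Beta a b.
Proof.
move=> /andP[a0 a1] hb; have [x /andP[x0 x1] ->] := Beta_mean a0 hb.
have h (y c : R) : 0 < y < 1 -> c <= 1 -> 1 <= y `^ (c - 1).
  move=> /andP[y0 y1] c1; rewrite -[leLHS](powRr0 y); apply: ger_powR; rewrite ?y0 ?(ltW y1)//; lra.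
rewrite -[leLHS]mulr1 ler_pM// h ?x0//; first by apply/andP; split; lra.
by have /andP[] := hb.
Qed.

Lemma Beta_le a a' b : 0 < a -> a <= a' -> 0 < b <= 1 -> Beta a' b <= Beta a b.
Proof.
move=> a0 aa hb; apply: le_Rintegral => //.
- exact: Beta_integrable (lt_le_trans a0 aa) hb.
- exact: Beta_integrable.
move=> x; rewrite /= in_itv/= => /andP[x0 x1]; rewrite ler_wpM2r ?powR_ge0//.
apply: ger_powR; rewrite ?x0 ?(ltW x1)//; lra.
Qed.

Lemma Beta_continuous a b : 0 < a -> 0 < b <= 1 -> {for a, continuous (Beta ^~ b)}.
Proof.
move=> a0 /andP[b0 b1].
(* This exponent lies below every parameter in []a / 2, a * 2[] and is at most 1, so one dominating
   function serves the whole neighbourhood of [a]. *)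
have m0 : 0 < Num.min (a / 2) 1 by rewrite lt_min divr_gt0// ltr01.
have Ia : a \in (`]a / 2, a * 2[%classic : set R).
  by rewrite inE/= in_itv/=; apply/andP; split; lra.
apply: (@continuity_under_integral R _ _ mu (fun a => bg a b) `]0, 1[ (measurable_itv _) (a / 2) (a * 2) _ _ (dom (Num.min (a / 2) 1) b)) => //.
- by move=> x /=; rewrite in_itv/= => /andP[hx _]; apply: Beta_integrable; [lra|rewrite b0].
- apply: nearW => y; rewrite /= in_itv/= => /andP[y0 y1] x _.
  apply: isd_cts; apply: isdM (isd_cst _ x).
  apply: (@eq_isd _ (fun x => expR ((x - 1) * ln y))); first by move=> z; rewrite /powR gt_eqF.
  by apply: isd_expR; apply: isdM (isd_cst _ x); apply: isdB; [exact: isd_id|exact: isd_cst].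
- exact: dom_intg.
move=> x; rewrite /= in_itv/= => /andP[hx _].
apply: nearW => y; rewrite /= in_itv/= => hy; rewrite ger0_norm ?bg_ge0//.
apply: bg_le_dom => //.
- by rewrite ge_min (ltW hx).
- by rewrite (ltW m0)/= ge_min lexx orbT.
by rewrite (ltW b0).
Qed.

End Beta_function.

(** * Range of nu2 and its right inverse *)

Section nu2_inverse.
Context {R : realType}.
Variable H : R.
Hypothesis hH : 1 / 2 < H < 1.

Let H12 : 1 / 2 < H. Proof. by case/andP: hH. Qed.
Let H1 : H < 1. Proof. by case/andP: hH. Qed.
Let H0 : 0 < H. Proof. by move: H12; lra. Qed.
Let c := (2 * H - 1) * H `^ (2 * H).
Let c0 : 0 < c. Proof. by rewrite /c; apply: mulr_gt0; [move: H12; lra|apply: powR_gt0; move: H12; lra]. Qed.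
Let b01 : 0 < 2 * H - 1 <= 1. Proof. by move: H12 H1 => *; apply/andP; split; lra. Qed.
Let a_gt0 a : 0 < a -> 0 < 1 - H + a * H.
Proof. by move=> a0; rewrite addr_gt0// ?subr_gt0// mulr_gt0//; move: H12; lra. Qed.

Lemma nu2_gtN1 a : 0 < a -> -1 < nu2 H a.
Proof.
move=> a0; rewrite /nu2 ltrBrDr addNr -/c mulr_gt0// ?divr_gt0//.
by rewrite Beta_gt0// a_gt0.
Qed.

(* [Beta] is at least 1 for [a <= 1], so [nu2] explodes at 0, and it tends to [-1] at infinity. *)
Lemma nu2_surj v : -1 < v -> exists2 a, 0 < a & nu2 H a = v.
Proof.
move=> v1; have v0 : 0 < v + 1 by lra.
pose M := Beta 1 (2 * H - 1).
have M1 : 1 <= M by apply: Beta_ge1; rewrite ?ltr01 ?lexx.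
pose a1 := Num.min 1 (c / (v + 1)); pose a2 := Num.max 1 (c * M / (v + 1)).
have a10 : 0 < a1 by rewrite lt_min ltr01 divr_gt0.
have a11 : a1 <= 1 by rewrite ge_min lexx.
have a21 : 1 <= a2 by rewrite le_max lexx.
have a12 : a1 <= a2 by exact: le_trans a11 a21.
have lo : v <= nu2 H a1.
  rewrite /nu2 -/c lerBrDr.
  apply: (@le_trans _ _ (c / a1)).
    by rewrite ler_pdivlMr// mulrC -ler_pdivlMr// ge_min lexx orbT.
  apply: ler_peMr; first by apply: divr_ge0; exact: ltW.
  apply: Beta_ge1 => //.
  rewrite a_gt0//= -subr_ge0 (_ : _ - _ = (1 - a1) * H); last by ring.
  by rewrite mulr_ge0 ?subr_ge0 ?(ltW H0).
have a20 : 0 < a2 by exact: lt_le_trans a21.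
have hi : nu2 H a2 <= v.
  rewrite /nu2 -/c lerBlDr.
  apply: (@le_trans _ _ (c / a2 * M)).
    rewrite ler_wpM2l ?divr_ge0 ?(ltW c0) ?(ltW a20)//.
    apply: Beta_le => //; rewrite -subr_ge0 (_ : _ - _ = (a2 - 1) * H); last by ring.
    by rewrite mulr_ge0 ?subr_ge0 ?(ltW H0).
  rewrite mulrAC ler_pdivrMr// (mulrC (v + 1)) -ler_pdivrMr// le_max lexx orbT//.
have [] := @IVT R (nu2 H) a1 a2 v a12.
- apply: continuous_in_subspaceT => x; rewrite inE/= in_itv/= => /andP[ax _].
  have x0 : 0 < x by exact: lt_le_trans a10 ax.
  apply: cvgB; last exact: cvg_cst.
  apply: cvgM.
    by apply: cvgM; [exact: cvg_cst|apply: cvgV; [rewrite gt_eqF|exact: cvg_id]].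
  apply: (@cvg_comp _ _ _ (fun a => 1 - H + a * H) (Beta ^~ (2 * H - 1)) _ (nbhs (1 - H + x * H))).
    by apply: cvgD; [exact: cvg_cst|apply: cvgM; [exact: cvg_id|exact: cvg_cst]].
  by apply: Beta_continuous => //; exact: a_gt0.
- by apply/andP; split; [rewrite ge_min; apply/orP; right|rewrite le_max; apply/orP; left].
move=> a; rewrite in_itv/= => /andP[ha _] <-; exists a => //.
exact: lt_le_trans a10 ha.
Qed.

Lemma nu2_nu2_inv v : -1 <= v -> nu2 H (nu2_inv H v) = v.
Proof.
have inj v' : [set nu2 H x | x in `]0, +oo[] v' -> nu2 H (nu2_inv H v') = v'.
  by move=> hv; apply: (@pinvK _ _ _ _ _); rewrite inE.
rewrite le_eqVlt => /predU1P[<-|v1]; last first.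
  have [a a0 <-] := nu2_surj v1; apply: inj; exists a => //=.
  by rewrite in_itv/= andbT.
have [|h] := pselect ([set nu2 H x | x in `]0, +oo[] (-1)); first exact: inj.
have -> : nu2_inv H (-1) = 0.
  rewrite /nu2_inv /pinv_ splitV /=.
  rewrite oinv_surj; case: pselect => //.
by rewrite /nu2 invr0 mulr0 mul0r sub0r.
Qed.

End nu2_inverse.

(** * The stationary covariance *)

Section limits_along_sequences.
Context {R : realType}.
Implicit Types (f : R -> R) (u : nat -> R).

Lemma cvg_right_seq f (a l : R) u : f x @[x --> a^'+] --> l ->
  (forall n, a < u n) -> u n @[n --> \oo] --> a -> f (u n) @[n --> \oo] --> l.
Proof.
move=> /cvgrPdist_lt hf ua hu; apply/cvgn_epsP => e e0.
have [dl /= dl0 hd] := hf e e0.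
have /cvgn_epsP/(_ _ dl0)[N hN] := hu; exists N => n Nn.
by rewrite distrC; apply: hd => //=; rewrite distrC hN.
Qed.

Lemma cvg_left_seq f (a l : R) u : f x @[x --> a^'-] --> l ->
  (forall n, u n < a) -> u n @[n --> \oo] --> a -> f (u n) @[n --> \oo] --> l.
Proof.
move=> /cvgrPdist_lt hf ua hu; apply/cvgn_epsP => e e0.
have [dl /= dl0 hd] := hf e e0.
have /cvgn_epsP/(_ _ dl0)[N hN] := hu; exists N => n Nn.
by rewrite distrC; apply: hd => //=; rewrite distrC hN.
Qed.

End limits_along_sequences.

(** * Decay and weighted primitive of the covariance *)

Section covariance_function.
Context {R : realType}.
Variable H : R.
Hypothesis hH : 1 / 2 < H < 1.
Implicit Types (s t w y : R).

Let H12 : 1 / 2 < H. Proof. by case/andP: hH. Qed.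
Let H1 : H < 1. Proof. by case/andP: hH. Qed.
Let H0 : 0 < H. Proof. by move: H12; lra. Qed.
Local Notation K := (H `^ (2 * H)).

Definition fou2_cov w : R := K / 2 *
  (expR w + expR (- w) - `|expR (w / (2 * H)) - expR (- (w / (2 * H)))| `^ (2 * H)).
Local Notation rho := fou2_cov.

Lemma powR_expR w p : (expR w) `^ p = expR (w * p).
Proof. by rewrite /powR gt_eqF ?expR_gt0// expRK mulrC. Qed.

Lemma powR_addr1 y p : 0 < y -> y `^ (p + 1) = y `^ p * y.
Proof. by move=> y0; rewrite powRD ?powRr1 ?(ltW y0)// (gt_eqF y0) implybT. Qed.

Lemma fou2_covN w : rho (- w) = rho w.
Proof. by rewrite /fou2_cov mulNr !opprK (addrC (expR (- w))) distrC. Qed.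

Lemma fou2_cov0 : rho 0 = K.
Proof.
rewrite /fou2_cov mul0r !oppr0 expR0 subrr normr0 powR0; first by field.
by rewrite mulf_neq0// gt_eqF.
Qed.

Lemma fou2_cov_continuous : continuous rho.
Proof.
have cp : continuous (fun x : R => `|x| `^ (2 * H)).
  move=> x; have [->|x0] := eqVneq x 0.
    rewrite /continuous_at normr0 powR0; last by rewrite mulf_neq0// gt_eqF.
    apply/cvgrPdist_lt => e e0.
    have p0 : 0 < 2 * H by rewrite mulr_gt0.
    have := powR_cvg0 p0 => /cvgrPdist_lt /(_ e e0).
    rewrite near_simpl /at_right !near_withinE => hN.
    move: hN; rewrite !nearE => -[dl /= dl0 hd]; exists dl => // y /= hy.
    have [->|y0] := eqVneq y 0; first by rewrite normr0 powR0 ?subrr ?normr0// gt_eqF.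
    apply: hd; last by rewrite normr_gt0.
    by move: hy; rewrite /= !sub0r !normrN normr_id.
  apply: (@cvg_comp _ _ _ (fun x : R => `|x|) (fun x => x `^ (2 * H)) _ (nbhs `|x|)).
    exact: norm_continuous.
  have n0 : 0 < `|x| by rewrite normr_gt0.
  exact: isd_cts (isd_powR (f := fun y => y) (2 * H) n0 (isd_id _)).
move=> w; apply: cvgM; first exact: cvg_cst.
apply: cvgB.
  apply: cvgD; first exact: continuous_expR.
  exact: isd_cts (isd_expR (isdN (isd_id w))).
apply: (@cvg_comp _ _ _ (fun w : R => expR (w / (2 * H)) - expR (- (w / (2 * H))))
  (fun x : R => `|x| `^ (2 * H)) _ (nbhs (expR (w / (2 * H)) - expR (- (w / (2 * H)))))).
  have dw := isdM (isd_id w) (isd_cst (2 * H)^-1 w).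
  exact: isd_cts (isdB (isd_expR dw) (isd_expR (isdN dw))).
exact: cp.
Qed.

(** With [exp w] factored out, everything is expressed in [y = exp (- w / H)], the variable in which
    the decay and the Beta integral become visible. *)
Lemma fou2_covE w : 0 <= w -> let y := expR (- (w / H)) in
  rho w = K / 2 * expR w * (1 + y `^ (2 * H) - (1 - y) `^ (2 * H)).
Proof.
move=> w0 y.
have y1 : y <= 1 by rewrite -expR0 ler_expR oppr_le0 divr_ge0// ltW.
have -> : y `^ (2 * H) = expR (- w) * expR (- w).
  by rewrite powR_expR -expRD; congr expR; field; rewrite gt_eqF.
have -> : (1 - y) `^ (2 * H) = expR (- w) * `|expR (w / (2 * H)) - expR (- (w / (2 * H)))| `^ (2 * H).
  have -> : expR (- w) = expR (- (w / (2 * H))) `^ (2 * H).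
    by rewrite powR_expR; congr expR; field; rewrite gt_eqF.
  rewrite -powRM ?expR_ge0//; congr (_ `^ _).
  rewrite ger0_norm; last first.
    by rewrite subr_ge0 ler_expR -subr_ge0 opprK addr_ge0// divr_ge0// mulr_ge0// ltW.
  rewrite mulrBr -!expRD addNr expR0; congr (_ - expR _); field; by rewrite gt_eqF.
rewrite /fou2_cov; have e0 := expR_gt0 w; rewrite expRN; field; by rewrite gt_eqF.
Qed.

Lemma fou2_cov_bump_bounds y : 0 < y <= 1 ->
  0 <= 1 + y `^ (2 * H) - (1 - y) `^ (2 * H) <= 3 * y.
Proof.
move=> /andP[y0 y1].
have a1 : (1 - y) `^ (2 * H) <= 1 by apply: powR_le1; [apply/andP; split; lra|rewrite mulr_ge0// ltW].
have a2 : 1 - 2 * y <= (1 - y) `^ (2 * H).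
  have [->|y1'] := eqVneq y 1; first by have := powR_ge0 (1 - (1:R)) (2 * H); lra.
  have y1'' : 0 < 1 - y by rewrite subr_gt0 lt_neqAle y1'.
  apply: (@le_trans _ _ ((1 - y) `^ 2)).
    by rewrite powR_mulrn ?(ltW y1'')// -subr_ge0 (_ : _ - _ = y ^+ 2) ?sqr_ge0//; ring.
  by apply: ger_powR; [rewrite y1''/=; lra|move: H1; lra].
have a3 : 0 <= y `^ (2 * H) by exact: powR_ge0.
have a4 : y `^ (2 * H) <= y.
  by apply: ge1r_powR; [rewrite y0|move: H12; lra].
by apply/andP; split; lra.
Qed.

(** The bracket is of order [y = exp (- w / H)], which beats the factor [exp w] because [H < 1]; the
    net rate is [1 / H - 1]. *)
Lemma fou2_cov_bounds w : 0 <= w ->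
  0 <= rho w <= 3 / 2 * K * expR (- ((1 - H) / H * w)).
Proof.
move=> w0; rewrite fou2_covE//; set y := expR (- (w / H)).
have y0 : 0 < y by exact: expR_gt0.
have y1 : y <= 1 by rewrite -expR0 ler_expR oppr_le0 divr_ge0// ltW.
have /andP[b1 b2] : 0 <= 1 + y `^ (2 * H) - (1 - y) `^ (2 * H) <= 3 * y.
  by apply: fou2_cov_bump_bounds; rewrite y0.
have K0 : 0 <= K / 2 * expR w by rewrite !mulr_ge0// ?powR_ge0// expR_ge0.
rewrite mulr_ge0//=; apply: le_trans (ler_wpM2l K0 b2) _.
rewrite le_eqVlt; apply/orP; left; apply/eqP.
have -> : expR (- ((1 - H) / H * w)) = expR w * y.
  by rewrite /y -expRD; congr expR; field; rewrite gt_eqF.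
by field.
Qed.

Lemma fou2_cov_abs_le w : `|rho w| <= 3 / 2 * K * expR (- ((1 - H) / H * `|w|)).
Proof.
have [w0|w0] := leP 0 w.
  by have /andP[r0 r1] := fou2_cov_bounds w0; rewrite (ger0_norm w0) ger0_norm.
have w1 : 0 <= - w by rewrite oppr_ge0 ltW.
have /andP[] := fou2_cov_bounds w1; rewrite fou2_covN => r0 r1.
by rewrite (ltr0_norm w0) ger0_norm.
Qed.

Lemma fou2_cov_ge0 w : 0 <= rho w.
Proof.
have [w0|w0] := leP 0 w; first by have /andP[] := fou2_cov_bounds w0.
have w1 : 0 <= - w by rewrite oppr_ge0 ltW.
by rewrite -fou2_covN; have /andP[] := fou2_cov_bounds w1.
Qed.

Lemma time_change_cov s t : expR (- s) * expR (- t) *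
  ((time_change H s `^ (2 * H) + time_change H t `^ (2 * H)
    - `|time_change H t - time_change H s| `^ (2 * H)) / 2) = rho (s - t).
Proof.
rewrite /time_change !powRM ?expR_ge0 ?(ltW H0)// !powR_expR.
have -> : `|H * expR (t / H) - H * expR (s / H)| =
    H * expR ((s + t) / (2 * H)) * `|expR ((s - t) / (2 * H)) - expR (- ((s - t) / (2 * H)))|.
  have -> : H * expR ((s + t) / (2 * H)) = `|H * expR ((s + t) / (2 * H))|.
    by rewrite ger0_norm// mulr_ge0 ?expR_ge0// ltW.
  rewrite -normrM distrC mulrBr -!mulrA -!expRD; congr `|_|.
  by congr (_ * expR _ - _ * expR _); field; rewrite gt_eqF.
rewrite powRM ?mulr_ge0 ?expR_ge0 ?(ltW H0)// powRM ?expR_ge0 ?(ltW H0)// powR_expR.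
have e1 (x : R) : x / H * (2 * H) = x + x by field; rewrite gt_eqF.
have e2 (x : R) : x / (2 * H) * (2 * H) = x by field; rewrite gt_eqF.
rewrite !e1 e2 !expRD /fou2_cov opprB !expRD !expRN.
have es := expR_gt0 s; have et := expR_gt0 t.
by field; rewrite !gt_eqF.
Qed.


Variable alpha : R.
Hypothesis alpha0 : 0 < alpha.
Local Notation c := ((2 * H - 1) * K).

Let num y := 1 + y `^ (2 * H) - (1 - y) `^ (2 * H).
Let brk y := 1 - y `^ (2 * H) - (1 + y) * (1 - y) `^ (2 * H - 1) + alpha * num y.
(** In the variable [w] this is [exp (- alpha w) (rho' w + alpha rho w) - alpha K], with derivative
    [exp (- alpha w) (rho'' - alpha^2 rho)]. The difference [rho - rho''] is the kernel that yields
    the Beta integrand, and the constant makes [low] vanish at [y = 1]. *)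
Let low y := K / 2 * (y `^ (alpha * H - H) * brk y) - alpha * K.

Let isd_low y : 0 < y < 1 -> isd low y
  (c * (y `^ (alpha * H - H) * (1 - y) `^ (2 * H - 2))
   - (1 - alpha ^+ 2) * H * (K / 2) * y `^ (alpha * H - H - 1) * num y).
Proof.
move=> /andP[y0 y1]; have y1' : 0 < 1 - y by rewrite subr_gt0.
have iy := isd_id y.
have i1 : isd (fun y : R => 1 - y) y (-1) by apply: isd_eq (isdB (isd_cst 1 y) iy) _; rewrite sub0r.
have i2 : isd (fun y : R => 1 + y) y 1 by apply: isd_eq (isdD (isd_cst 1 y) iy) _; rewrite add0r.
have p1 := isd_powR (f := fun y => y) (2 * H) y0 iy.
have p2 := isd_powR (f := fun y => 1 - y) (2 * H) y1' i1.
have p3 := isd_powR (f := fun y => 1 - y) (2 * H - 1) y1' i1.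
have p4 := isd_powR (f := fun y => y) (alpha * H - H) y0 iy.
have dn := isdB (isdD (isd_cst 1 y) p1) p2.
have db := isdD (isdB (isdB (isd_cst 1 y) p1) (isdM i2 p3)) (isdZ alpha dn).
apply: isd_eq (isdB (isdZ (K / 2) (isdM p4 db)) (isd_cst (alpha * K) y)) _.
rewrite /num.
have -> : 2 * H - 1 - 1 = 2 * H - 2 by ring.
(* All powers are reduced to lowest ones, which [field] can then treat as independent atoms. *)
have e1 : y `^ (2 * H) = y * y `^ (2 * H - 1) by rewrite mulr_powRB1 ?(ltW y0)// mulr_gt0.
have e2 : (1 - y) `^ (2 * H) = (1 - y) * (1 - y) `^ (2 * H - 1).
  by rewrite mulr_powRB1 ?(ltW y1')// mulr_gt0.
have e3 : (1 - y) `^ (2 * H - 1) = (1 - y) * (1 - y) `^ (2 * H - 2).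
  rewrite (_ : 2 * H - 2 = 2 * H - 1 - 1); last by ring.
  by rewrite mulr_powRB1 ?(ltW y1')//; move: H12; lra.
have e4 : y `^ (alpha * H - H) = y * y `^ (alpha * H - H - 1).
  by rewrite [RHS]mulrC -powR_addr1// subrK.
by rewrite e1 e2 e3 e4; field.
Qed.

Let num_bounds y : 0 < y <= 1 -> `|num y| <= 3 * y.
Proof. by move=> hy; have /andP[n0 n3] := fou2_cov_bump_bounds hy; rewrite ger0_norm. Qed.

Let brk_bounds y : 0 < y <= 1 -> `|brk y| <= (2 + 3 * alpha) * y.
Proof.
move=> hy; have /andP[y0 y1] := hy.
rewrite /brk [leRHS]mulrDl; apply: (le_trans (ler_normD _ _)); apply: lerD; last first.
  by rewrite normrM gtr0_norm// (mulrC 3) -mulrA ler_wpM2l ?(ltW alpha0)// num_bounds.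
have a0 := powR_ge0 y (2 * H).
have a1 : y `^ (2 * H) <= y by apply: ge1r_powR; [rewrite y0|move: H12; lra].
have b0 := powR_ge0 (1 - y) (2 * H - 1).
have b1 : (1 - y) `^ (2 * H - 1) <= 1.
  by apply: powR_le1; [apply/andP; split; lra|move: H12; lra].
have b2 : 1 - y <= (1 - y) `^ (2 * H - 1).
  have [->|y1'] := eqVneq y 1; first by rewrite subrr powR_ge0.
  have y1'' : 0 < 1 - y by rewrite subr_gt0 lt_neqAle y1'.
  by apply: ger1_powR; [rewrite y1''/=; lra|move: H1; lra].
have l1 : (1 + y) * (1 - y) `^ (2 * H - 1) <= 1 + y by rewrite ler_piMr// ltW// addr_gt0.
have l2 : (1 + y) * (1 - y) <= (1 + y) * (1 - y) `^ (2 * H - 1).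
  by rewrite ler_wpM2l// ltW// addr_gt0.
have l3 : y * y <= y by rewrite ler_piMr// ltW.
by rewrite ler_norml; apply/andP; split; lra.
Qed.

Let low0 (u : nat -> R) : (forall n, 0 < u n <= 1) -> u n @[n --> \oo] --> (0 : R) ->
  low (u n) @[n --> \oo] --> - (alpha * K).
Proof.
move=> hu u0; rewrite -[X in _ --> X]add0r; apply: cvgB; last exact: cvg_cst.
rewrite -[X in _ --> X](mulr0 (K / 2)); apply: cvgM; first exact: cvg_cst.
have p0 : 0 < alpha * H - H + 1.
  by have := mulr_gt0 alpha0 H0; move: H1; lra.
apply: (@cvgn0_squeeze _ _ (fun n => (2 + 3 * alpha) * u n `^ (alpha * H - H + 1))).
  move=> n; have /andP[un0 un1] := hu n.
  rewrite powR_addr1//.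
  rewrite normrM ger0_norm ?powR_ge0// mulrCA ler_wpM2l ?powR_ge0//.
  by rewrite brk_bounds.
rewrite -[X in _ --> X](mulr0 (2 + 3 * alpha)); apply: cvgM; first exact: cvg_cst.
by apply: (cvg_right_seq (powR_cvg0 p0)) => // n; have /andP[] := hu n.
Qed.

Let low1 (u : nat -> R) : (forall n, 0 < u n < 1) -> u n @[n --> \oo] --> (1 : R) ->
  low (u n) @[n --> \oo] --> (0 : R).
Proof.
move=> hu u1.
have cp (p : R) : u n `^ p @[n --> \oo] --> (1 : R).
  have -> : 1 = 1 `^ p :> R by rewrite powR1.
  apply: (@cvg_comp _ _ _ u (fun y => y `^ p) _ (nbhs (1 : R))) => //.
  exact: isd_cts (isd_powR (f := fun y => y) p ltr01 (isd_id _)).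
have cq (p : R) : 0 < p -> (1 - u n) `^ p @[n --> \oo] --> (0 : R).
  move=> p0; apply: (cvg_right_seq (powR_cvg0 p0)).
    by move=> n; rewrite subr_gt0; have /andP[] := hu n.
  by rewrite -[X in _ --> X](subrr 1); apply: cvgB => //; exact: cvg_cst.
have : low (u n) @[n --> \oo] --> K / 2 * (1 * (1 - 1 - (1 + 1) * 0 + alpha * (1 + 1 - 0))) - alpha * K.
  have p1 : 0 < 2 * H by rewrite mulr_gt0.
  have p2 : 0 < 2 * H - 1 by move: H12; lra.
  apply: cvgB; last exact: cvg_cst.
  apply: cvgM; first exact: cvg_cst.
  apply: cvgM => //; apply: cvgD.
    apply: cvgB; first by apply: cvgB => //; exact: cvg_cst.
    by apply: cvgM; [apply: cvgD => //; exact: cvg_cst|exact: cq].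
  apply: cvgM; first exact: cvg_cst.
  by apply: cvgB; [apply: cvgD => //; exact: cvg_cst|exact: cq].
rewrite (_ : K / 2 * _ - _ = 0)//; by field.
Qed.

(* [D] is the primitive that two integrations by parts and the substitution
   [y = expR (- w / H)] produce for [(1 - alpha^2) expR (- alpha w) fou2_cov w]; at [w = 0] it
   vanishes, and the Beta function appears as [w] tends to infinity. *)
Lemma fou2_cov_primitive : exists D : R -> R, [/\
  forall w, 0 < w -> isd D w ((1 - alpha ^+ 2) * (expR (- (alpha * w)) * rho w)),
  D n.+1%:R^-1 @[n --> \oo] --> (0 : R) &
  D n%:R @[n --> \oo] --> c * Beta (1 - H + alpha * H) (2 * H - 1) - alpha * K].
Proof.
have a0 : 0 < 1 - H + alpha * H.
  by have := mulr_gt0 alpha0 H0; move: H1; lra.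
have hb : 0 < 2 * H - 1 <= 1 by move: H1 H12 => ? ?; apply/andP; split; lra.
have [G [G0 G1 cG dG]] := Beta_primitive a0 hb.
set be := Beta _ _ in G1 *.
pose D w := c * (be - G (expR (- (w / H)))) + low (expR (- (w / H))).
have [cG' cG0 cG1] : [/\ {in `]0, 1[, continuous G}, G x @[x --> 0^'+] --> G 0 & G x @[x --> 1^'-] --> G 1].
  by have /(continuous_within_itvP _ ltr01)[] := cG.
have y01 w : 0 < w -> 0 < expR (- (w / H)) < 1.
  by move=> w0; rewrite expR_gt0/= -expR0 ltr_expR oppr_lt0 divr_gt0.
exists D; split.
- move=> w w0; have hy := y01 w w0; set y := expR (- (w / H)) in hy *.
  have dy : isd (fun w => expR (- (w / H))) w (y * - H^-1).
    apply: isd_eq (isd_expR (isdN (isdM (isd_id w) (isd_cst H^-1 w)))) _.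
    by rewrite /y; ring.
  have d1 := isd_comp (f := G) (g := fun w => expR (- (w / H))) (dG y hy) dy.
  have d2 := isd_comp (f := low) (g := fun w => expR (- (w / H))) (isd_low hy) dy.
  apply: isd_eq (isdD (isdZ c (isdB (isd_cst be w) d1)) d2) _.
  rewrite fou2_covE ?(ltW w0)// -/y -/(num y).
  have -> : 1 - H + alpha * H - 1 = alpha * H - H by ring.
  have -> : 2 * H - 1 - 1 = 2 * H - 2 by ring.
  have e1 : expR (- (alpha * w)) * expR w = y `^ (alpha * H - H - 1) * y.
    rewrite /y powR_expR -!expRD; congr expR; field; by rewrite gt_eqF.
  rewrite [RHS](_ : _ = (1 - alpha ^+ 2) * (K / 2) * (expR (- (alpha * w)) * expR w) * num y); last by ring.
  rewrite e1; field; by rewrite gt_eqF.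
- have hu n : 0 < expR (- (n.+1%:R^-1 / H)) < 1 by exact: y01.
  have u1 : expR (- (n.+1%:R^-1 / H)) @[n --> \oo] --> (1 : R).
    rewrite -[X in _ --> X]expR0; apply: (@cvg_comp _ _ _ (fun n : nat => - (n.+1%:R^-1 / H)) expR _ (nbhs (0 : R))).
      rewrite -oppr0 -(mul0r H^-1); apply: cvgN; apply: cvgM; last exact: cvg_cst.
      exact: (@cvg_harmonic R).
    exact: continuous_expR.
  rewrite -[X in _ --> X](addr0 0) -{1}(mulr0 c) -[in X in c * X](subrr be).
  apply: cvgD; last exact: low1.
  apply: cvgM; first exact: cvg_cst.
  apply: cvgB; first exact: cvg_cst.
  by rewrite -G1; apply: (cvg_left_seq cG1) => // n; have /andP[] := hu n.
pose u n := expR (- (n%:R / H)).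
have hu n : 0 < u n <= 1 by rewrite expR_gt0 -expR0 ler_expR oppr_le0 divr_ge0// ltW.
have u0 : u n @[n --> \oo] --> (0 : R).
  apply/cvgn_epsP => e e0.
  exists (Num.bound (H / e)) => n Nn.
  have n0 : H / e < n%:R.
    apply: (lt_le_trans (archi_boundP _)); first by rewrite divr_ge0// ltW.
    by rewrite ler_nat.
  rewrite subr0 gtr0_norm ?expR_gt0// /u expRN invf_plt ?posrE ?expR_gt0//.
  have nH : e^-1 < n%:R / H by rewrite ltr_pdivlMr// mulrC.
  by apply: (lt_trans nH); apply: lt_le_trans (expR_ge1Dx _); rewrite ltrDr.
rewrite -(subr0 be) -G0.
apply: cvgD; last exact: low0.
apply: cvgM; first exact: cvg_cst.
apply: cvgB; first exact: cvg_cst.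
by apply: (cvg_right_seq cG0) => // n; have /andP[] := hu n.
Qed.

End covariance_function.

(** * Discretized variance *)

Section riemann_sums.
Context {R : realType}.
Implicit Types (phi D : R -> R).

Lemma isd_harmonic phi (a : R) : isd phi 0 a ->
  (phi n.+1%:R^-1 - phi 0) * n.+1%:R @[n --> \oo] --> a.
Proof.
move=> h; have hd := isd_derivable h; have := isd_derive1 h; rewrite derive1E => <-.
move/cvgrPdist_lt : hd => hd.
apply/cvgn_epsP => e e0; have [dl /= dl0 hdl] := hd e e0.
have /cvgn_epsP/(_ _ dl0)[N hN] := @cvg_harmonic R; exists N => n Nn.
rewrite distrC; have := hdl n.+1%:R^-1; rewrite /= sub0r normrN.
have := hN n Nn; rewrite /harmonic /= subr0 => h1 /(_ h1).
rewrite invr_neq0 ?pnatr_eq0// => /(_ isT).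
by rewrite invrK /GRing.scale /= mulr1 addr0 [in X in _ -> X]mulrC.
Qed.

(** [D] is a primitive only on the open half-line, so the first node is split off, and the
    telescoping sum starts at [D h], which tends to 0. *)
Lemma cvg_riemann_sum phi D (m : nat) : continuous phi ->
  (forall w, 0 < w -> isd D w (phi w)) -> D n.+1%:R^-1 @[n --> \oo] --> (0 : R) ->
  n.+1%:R^-1 * (\sum_(j < m.+1 * n.+1) phi (j%:R * n.+1%:R^-1)) @[n --> \oo] --> D m.+1%:R.
Proof.
move=> cphi dD /cvgn_epsP D0; apply/cvgn_epsP => e e0.
(* Of the [m + 3] shares, [m + 1] go to the oscillation over an interval of that length, one to the
   first node and one to [D h]. *)
have e1 : 0 < e / (m.+3)%:R by rewrite divr_gt0.
set e' := e / _ in e1.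
have [dl dl0 hdl] := @unif_cont_segment R phi 0 m.+1%:R e' (fun x => cphi x) e1.
have [N1 hN1] := D0 e' e1.
have /cvgn_epsP/(_ _ dl0)[N2 hN2] := @cvg_harmonic R.
have /cvgn_epsP/(_ _ e1)[N3 hN3] := cvgn_scale_harmonic (phi 0).
exists (N1 + N2 + N3)%N => n Nn.
have n1 := hN1 n (leq_trans (leq_trans (leq_addr _ _) (leq_addr _ _)) Nn).
have := hN2 n (leq_trans (leq_trans (leq_addl _ _) (leq_addr _ _)) Nn).
have := hN3 n (leq_trans (leq_addl _ _) Nn).
rewrite /harmonic /= subr0 in n1 *; rewrite subr0.
set h := n.+1%:R^-1 in n1 *; move=> n3.
have h0 : 0 < h by rewrite invr_gt0.
rewrite subr0 ger0_norm ?(ltW h0)// => n2.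
pose L := (m.+1 * n.+1).-1.
have LE : (m.+1 * n.+1)%N = L.+1 by rewrite prednK// muln_gt0.
have Lh : L.+1%:R * h = m.+1%:R by rewrite -LE natrM mulfK// pnatr_eq0.
rewrite LE big_ord_recl mul0r mulrDr.
have step (j : nat) : (j < L)%N ->
    `|h * phi (j.+1%:R * h) - (D (j.+2%:R * h) - D (j.+1%:R * h))| <= h * e'.
  move=> jL.
  have j0 : 0 < j.+1%:R * h by rewrite mulr_gt0.
  have jj : j.+2%:R * h = j.+1%:R * h + h by rewrite -natr1; ring.
  have [] := @MVT R D phi (j.+1%:R * h) (j.+2%:R * h).
  - by rewrite jj ltrDl.
  - by move=> x; rewrite in_itv/= => /andP[x0 _]; apply: dD; exact: lt_trans x0.
  - apply: continuous_in_subspaceT => x; rewrite inE/= in_itv/= => /andP[x0 _].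
    by apply: isd_cts (dD x _); exact: lt_le_trans x0.
  move=> x; rewrite in_itv/= => /andP[x0 x1] ->.
  rewrite (_ : h * _ - _ = h * (phi (j.+1%:R * h) - phi x)); last by rewrite jj; ring.
  rewrite normrM (gtr0_norm h0) ler_wpM2l ?(ltW h0)// ltW//; apply: hdl.
    rewrite (ltW j0)/= -Lh ler_wpM2r ?(ltW h0)// ler_nat; exact: leqW.
  rewrite distrC gtr0_norm ?subr_gt0//; apply: le_lt_trans n2.
  by rewrite lerBlDl -jj ltW.
have tel : \sum_(j < L) (D (j.+2%:R * h) - D (j.+1%:R * h)) = D m.+1%:R - D h.
  rewrite -(big_mkord predT (fun j => D (j.+2%:R * h) - D (j.+1%:R * h))).
  rewrite (telescope_sumr (fun j => D (j.+1%:R * h)))// Lh mul1r//.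
have key : `|h * (\sum_(j < L) phi (j.+1%:R * h)) - (D m.+1%:R - D h)| <= m.+1%:R * e'.
  rewrite -tel mulr_sumr -sumrB (le_trans (ler_norm_sum _ _ _))//.
  apply: (@le_trans _ _ (\sum_(j < L) h * e')).
    by apply: ler_sum => j _; exact: step.
  have -> : \sum_(j < L) h * e' = L%:R * h * e'.
    by rewrite sumr_const card_ord -mulr_natr; ring.
  by rewrite ler_wpM2r ?(ltW e1)// -Lh ler_wpM2r ?(ltW h0)// ler_nat.
have -> : e = m.+1%:R * e' + e' + e'.
  by rewrite -[X in _ + X + _]mul1r -[X in _ + _ + X]mul1r -!mulrDl natr1 natr1 /e' mulrC divfK// pnatr_eq0.
have -> : h * phi 0 + h * (\sum_(i < L) phi ((lift ord0 i)%:R * h)) - D m.+1%:R =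
    (h * (\sum_(j < L) phi (j.+1%:R * h)) - (D m.+1%:R - D h)) + phi 0 * h - D h.
  by ring.
apply: le_lt_trans (ler_normB _ _) _; apply: ltrD => //.
by apply: le_lt_trans (ler_normD _ _) _; apply: ler_ltD.
Qed.

End riemann_sums.

Section exponential_bounds.
Context {R : realType}.
Implicit Types x h b : R.

Lemma inv_one_sub_expRN_le b h : 0 < b -> 0 < h <= 1 ->
  0 < 1 - expR (- b * h) /\ (1 - expR (- b * h))^-1 <= (1 + b) / b / h.
Proof.
move=> b0 /andP[h0 h1]; have bh : 0 < b * h by rewrite mulr_gt0.
have e1 : expR (- b * h) <= (1 + b * h)^-1.
  rewrite mulNr expRN lef_pV2 ?posrE ?expR_gt0// ?addr_gt0// expR_ge1Dx//.
have e2 : b * h / (1 + b) <= 1 - expR (- b * h).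
  apply: (@le_trans _ _ (1 - (1 + b * h)^-1)); last by rewrite lerD2l lerN2.
  have -> : 1 - (1 + b * h)^-1 = b * h / (1 + b * h) by field; rewrite gt_eqF// addr_gt0.
  rewrite ler_wpM2l ?(ltW bh)// lef_pV2 ?posrE ?addr_gt0// lerD2l ler_piMr// ltW//.
have p0 : 0 < b * h / (1 + b) by rewrite divr_gt0// addr_gt0.
split; first exact: lt_le_trans p0 e2.
rewrite (_ : (1 + b) / b / h = (b * h / (1 + b))^-1); last first.
  by field; rewrite !gt_eqF// addr_gt0.
by rewrite lef_pV2 ?posrE//; exact: lt_le_trans p0 e2.
Qed.

Lemma geometric_sum_le x n : 0 <= x -> 0 < 1 - x -> \sum_(j < n) x ^+ j <= (1 - x)^-1.
Proof.
move=> x0 x1; rewrite -[leRHS]mul1r ler_pdivlMr//.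
rewrite (_ : _ * _ = 1 - x ^+ n) ?lerBlDr ?lerDl ?exprn_ge0//.
elim: n => [|n ih]; first by rewrite big_ord0 expr0 mul0r subrr.
by rewrite big_ord_recr/= mulrDl ih exprSr; ring.
Qed.

Lemma abs_expR_sub1_le x : `|expR x - 1| <= `|x| * expR `|x|.
Proof.
have h (y : R) : 0 <= y -> expR y - 1 <= y * expR y.
  move=> y0; rewrite lerBlDr -lerBlDl.
  have := expR_ge1Dx (- y); rewrite expRN => h1.
  have ey := expR_gt0 y.
  have : expR y * (1 + - y) <= expR y * (expR y)^-1 by rewrite ler_wpM2l// ltW.
  rewrite mulfV ?gt_eqF// => h2; lra.
have [x0|x0] := leP 0 x.
  rewrite (ger0_norm x0) ger0_norm ?h//.
  by rewrite subr_ge0 -expR0 ler_expR.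
rewrite (ltr0_norm x0) ler0_norm; last by rewrite subr_le0 -expR0 ler_expR ltW.
have x0' : 0 <= - x by rewrite oppr_ge0 ltW.
have e1 : 1 <= expR (- x) by rewrite -expR0 ler_expR.
have : - x <= - x * expR (- x) by rewrite ler_peMr.
have := expR_ge1Dx x; lra.
Qed.

Lemma abs_expR_sub1_scaled_le b h : 0 < h <= 1 ->
  `|expR (b * h) - 1| <= `|b| * expR `|b| * h.
Proof.
move=> /andP[h0 h1]; apply: le_trans (abs_expR_sub1_le _) _.
rewrite normrM (gtr0_norm h0) mulrAC ler_wpM2r ?(ltW h0)// ler_wpM2l//.
by rewrite ler_expR ler_piMr.
Qed.

End exponential_bounds.

(** * Second moment of the discrete sums as the mesh tends to 0 *)

Section discretized_variance.
Context {R : realType}.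
Variables (alpha : R) (rho : R -> R).
Hypothesis alpha0 : 0 < alpha.
Hypothesis rhoN : forall w, rho (- w) = rho w.
Hypothesis rho_le : forall w, `|rho w| <= rho 0.
Implicit Types (h : R) (L m n : nat).

Let q h := expR (- alpha * h).
Let kap h := expR ((1 - alpha) * h) - 1.
Let S h L := \sum_(j < L) q h ^+ j * rho (j%:R * h).
Let P h L := \sum_(i < L) \sum_(j < L) q h ^+ i * q h ^+ j * rho (i%:R * h - j%:R * h).
Let Q h L := \sum_(j < L) q h ^+ j * rho (j%:R * h - L%:R * h).

(** Expanded second moment of [Y_t - q^L Y_{t-Lh} + kap * sum_{j<L} q^j Y_{t-jh}], viewed as a
    function of the covariance [rho] alone; [discounted_sum_variance] makes the link. *)
Definition discrete_variance h L := rho 0 + (kap h) ^+ 2 * P h L + 2 * kap h * S h L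
  + (q h ^+ L) ^+ 2 * rho 0 - 2 * q h ^+ L * rho (L%:R * h) - 2 * kap h * q h ^+ L * Q h L.

Let rho00 : 0 <= rho 0. Proof. exact: le_trans (rho_le 0). Qed.

(* Peeling the last and the first row and column of [P h L.+1] gives two expressions whose
   comparison determines [(1 - q^2) P h L] up to a multiple of [q^L]. *)
Let P_last h L : P h L.+1 = P h L + 2 * q h ^+ L * Q h L + (q h ^+ L) ^+ 2 * rho 0.
Proof.
rewrite /P big_ord_recr/= [in X in _ + X]big_ord_recr/= subrr.
under eq_bigr do rewrite big_ord_recr/=.
rewrite big_split/= [LHS]addrA; congr (_ + _).
rewrite -addrA; congr (_ + _).
rewrite /Q mulr_sumr -big_split/=; apply: eq_bigr => i _.
by rewrite -[in X in _ + X](rhoN (_ - _)) opprB; ring.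
Qed.

Let P_first h L : P h L.+1 = rho 0 + 2 * (S h L.+1 - rho 0) + q h ^+ 2 * P h L.
Proof.
rewrite /P /S big_ord_recl/= [in X in X + _]big_ord_recl/= [in RHS]big_ord_recl/=.
under [in X in _ + X]eq_bigr do rewrite big_ord_recl/=.
rewrite big_split/= !mul0r !subrr expr0 !mul1r.
under [X in _ + _ + (_ + X) = _]eq_bigr => i _.
  rewrite (eq_bigr (fun j : 'I_L => q h ^+ 2 * (q h ^+ i * q h ^+ j * rho (i%:R * h - j%:R * h)))); last first.
    move=> j _; rewrite /bump !add1n !exprS -!natr1.
    by rewrite (_ : (i%:R + 1) * h - (j%:R + 1) * h = i%:R * h - j%:R * h); ring.
  rewrite -mulr_sumr; over.
rewrite -mulr_sumr addrA; congr (_ + _); rewrite -addrA; congr (_ + _).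
rewrite (addrC (rho 0)) addrK (mulrC 2) mulr_natr mulr2n; congr (_ + _).
  by apply: eq_bigr => i _; rewrite mul1r sub0r rhoN.
by apply: eq_bigr => i _; rewrite mulr1 subr0.
Qed.

Let b := (1 + alpha) / alpha.
Let k1 := `|1 - alpha| * expR `|1 - alpha|.

Let b0 : 0 < b. Proof. by rewrite divr_gt0// addr_gt0. Qed.
Let k10 : 0 <= k1. Proof. by rewrite mulr_ge0// expR_ge0. Qed.
Let q0 h : 0 < q h. Proof. exact: expR_gt0. Qed.
Let q1 h : 0 < h <= 1 -> 0 < 1 - q h /\ (1 - q h)^-1 <= b / h.
Proof. exact: inv_one_sub_expRN_le. Qed.

Let sum_rho_le h L (f : nat -> R) : 0 < h <= 1 ->
  `|\sum_(j < L) q h ^+ j * rho (f j)| <= b / h * rho 0.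
Proof.
move=> hh; have [q10 qb] := q1 hh.
apply: le_trans (ler_norm_sum _ _ _) _.
apply: (@le_trans _ _ (\sum_(j < L) q h ^+ j * rho 0)).
  apply: ler_sum => j _; rewrite normrM ger0_norm ?exprn_ge0 ?(ltW (q0 h))//.
  by rewrite ler_wpM2l// exprn_ge0// ltW.
rewrite -mulr_suml ler_wpM2r//; apply: le_trans qb.
by apply: geometric_sum_le => //; exact: ltW.
Qed.

(** What remains of [discrete_variance] when every term with a factor [q^L] is dropped and [P] is
    replaced by the solution of [(1 - q^2) P = 2 S - rho 0]. *)
Let main h L := rho 0 + (kap h) ^+ 2 * (1 - q h ^+ 2)^-1 * (2 * S h L - rho 0) + 2 * kap h * S h L.

Definition variance_error : R := rho 0 * (k1 ^+ 2 * b * (3 + 2 * b) + 3 + 2 * k1 * b).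

Let q21 h : 0 < h <= 1 -> 0 < 1 - q h ^+ 2 /\ (1 - q h ^+ 2)^-1 <= b / h.
Proof.
move=> hh; have [q10 qb] := q1 hh.
have l : 1 - q h <= 1 - q h ^+ 2.
  rewrite lerD2l lerN2 expr2 ler_piMl ?(ltW (q0 h))//.
  by rewrite -subr_ge0 ltW.
have q20 := lt_le_trans q10 l.
by split=> //; apply: le_trans qb; rewrite lef_pV2 ?posrE.
Qed.

(** The powers of [h] balance: [kap] is O(h), while [Q] and [1 / (1 - q^2)] are O(1/h). So each
    dropped term is a bounded multiple of [q^L], uniformly in the mesh. *)
Lemma discrete_variance_error h L : 0 < h <= 1 ->
  `|discrete_variance h L - main h L| <= variance_error * q h ^+ L.
Proof.
move=> hh; have /andP[h0 h1] := hh.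
have [q10 qb] := q1 hh; have [q20 q2b] := q21 hh.
have kk : `|kap h| <= k1 * h by exact: abs_expR_sub1_scaled_le.
set qL := q h ^+ L.
have qL0 : 0 <= qL by rewrite exprn_ge0// ltW.
have qL1 : qL <= 1 by rewrite exprn_ile1 ?(ltW (q0 h))// -subr_ge0 ltW.
have eQ := sum_rho_le L (fun j => j%:R * h - L%:R * h) hh; rewrite -/(Q h L) in eQ.
have er := rho_le (L%:R * h).
set rL := rho (L%:R * h) in er.
have eP : P h L = ((2 * S h L - rho 0) + 2 * qL * rL - 2 * qL * Q h L - qL ^+ 2 * rho 0) / (1 - q h ^+ 2).
  have := P_last h L; rewrite P_first /S big_ord_recr/= -/(S h L) -/qL -/rL => e.
  apply: (@mulIf _ (1 - q h ^+ 2)); first by rewrite gt_eqF.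
  rewrite divfK ?gt_eqF//.
  apply/eqP; rewrite -subr_eq0; apply/eqP.
  rewrite [LHS](_ : _ = (P h L + 2 * qL * Q h L + qL ^+ 2 * rho 0) - (rho 0 + 2 * (S h L + qL * rL - rho 0) + q h ^+ 2 * P h L)); last by ring.
  by rewrite -e subrr.
set z := (1 - q h ^+ 2)^-1 in eP q2b *.
have z0 : 0 <= z by rewrite invr_ge0 ltW.
rewrite /discrete_variance /main -/qL -/rL eP -/z.
rewrite (_ : _ - _ = qL * (kap h ^+ 2 * z * (2 * rL - 2 * Q h L - qL * rho 0)
   + (qL * rho 0 - 2 * rL) - 2 * kap h * Q h L)); last by ring.
rewrite normrM (ger0_norm qL0) mulrC ler_wpM2r//.
have t1 : `|2 * rL - 2 * Q h L - qL * rho 0| <= (3 + 2 * (b / h)) * rho 0.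
  have a1 : `|qL * rho 0| <= rho 0 by rewrite ger0_norm ?mulr_ge0// ler_piMl.
  apply: le_trans (ler_normB _ _) _; apply: le_trans (lerD (ler_normB _ _) a1) _.
  rewrite !normrM (ger0_norm (_ : 0 <= 2))//.
  move: er eQ; set u := `|rL|; set v := `|Q h L|; set w := b / h => ? ?; lra.
have t2 : `|qL * rho 0 - 2 * rL| <= 3 * rho 0.
  have a1 : `|qL * rho 0| <= rho 0 by rewrite ger0_norm ?mulr_ge0// ler_piMl.
  apply: le_trans (ler_normB _ _) _; rewrite [X in _ + X]normrM (ger0_norm (_ : 0 <= 2))//.
  lra.
have t3 : `|kap h ^+ 2 * z| <= k1 ^+ 2 * h * b.
  rewrite normrM (ger0_norm z0) normrX.
  apply: (@le_trans _ _ ((k1 * h) ^+ 2 * (b / h))).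
    by apply: ler_pM => //; rewrite ler_pXn2r ?nnegrE// mulr_ge0// ltW.
  rewrite le_eqVlt; apply/orP; left; apply/eqP; field; by rewrite gt_eqF.
have t4 : `|2 * kap h * Q h L| <= 2 * k1 * b * rho 0.
  rewrite !normrM (ger0_norm (_ : 0 <= 2))//.
  apply: (@le_trans _ _ (2 * (k1 * h) * (b / h * rho 0))).
    by apply: ler_pM => //; rewrite ler_wpM2l.
  rewrite le_eqVlt; apply/orP; left; apply/eqP; field; by rewrite gt_eqF.
apply: le_trans (ler_normB _ _) _; apply: le_trans (lerD (ler_normD _ _) t4) _.
have t5 : `|kap h ^+ 2 * z * (2 * rL - 2 * Q h L - qL * rho 0)| <= k1 ^+ 2 * b * (3 + 2 * b) * rho 0.
  rewrite normrM; apply: le_trans (ler_pM _ _ t3 t1) _ => //.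
  rewrite [leLHS](_ : _ = k1 ^+ 2 * b * rho 0 * (3 * h + 2 * b)); last first.
    by field; rewrite gt_eqF.
  rewrite [leRHS](_ : _ = k1 ^+ 2 * b * rho 0 * (3 + 2 * b)); last by ring.
  apply: ler_wpM2l; last by rewrite lerD2r; lra.
  by apply: mulr_ge0 => //; apply: mulr_ge0; [exact: exprn_ge0|exact: ltW].
apply: le_trans (lerD (lerD t5 t2) (lexx _)) _.
rewrite /variance_error le_eqVlt; apply/orP; left; apply/eqP; ring.
Qed.

Variable D : R -> R.
Hypothesis rho_cts : continuous rho.
Hypothesis dD : forall w, 0 < w ->
  isd D w ((1 - alpha ^+ 2) * (expR (- (alpha * w)) * rho w)).
Hypothesis D0 : D n.+1%:R^-1 @[n --> \oo] --> (0 : R).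

Let hn n : R := n.+1%:R^-1.
Let hn01 n : 0 < hn n <= 1.
Proof. by rewrite invr_gt0 ltr0n/= invf_le1 ?ltr0n// ler1n. Qed.

Let cvg_kap : kap (hn n) / hn n @[n --> \oo] --> 1 - alpha.
Proof.
have hd : isd (fun h => expR ((1 - alpha) * h)) 0 (1 - alpha).
  apply: isd_eq (isd_expR (isdZ (1 - alpha) (isd_id 0))) _.
  by rewrite mulr0 expR0; ring.
have := isd_harmonic hd; apply: cvgn_ext => n.
by rewrite /kap mulr0 expR0 invrK.
Qed.

Let cvg_q2 : (1 - q (hn n) ^+ 2) / hn n @[n --> \oo] --> 2 * alpha.
Proof.
have hd : isd (fun h => q h ^+ 2) 0 (- (2 * alpha)).
  apply: isd_eq (isd_sqr (isd_expR (isdZ (- alpha) (isd_id 0)))) _.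
  by rewrite mulr0 expR0; ring.
rewrite -[X in _ --> X]opprK; apply: cvgn_ext (cvgN (isd_harmonic hd)) => n /=.
by rewrite /q mulr0 expR0 /hn invrK; ring.
Qed.

Lemma cvg_discrete_variance_main m :
  main (hn n) (m.+1 * n.+1) @[n --> \oo] --> rho 0 + D m.+1%:R / alpha.
Proof.
set Sn := fun n => S (hn n) (m.+1 * n.+1).
have a1 : 0 < 1 + alpha by rewrite addr_gt0.
have qE n j : q (hn n) ^+ j = expR (- (alpha * (j%:R * hn n))).
  by rewrite /q -expRM_natl; congr expR; ring.
have cS : (1 - alpha ^+ 2) * (hn n * Sn n) @[n --> \oo] --> D m.+1%:R.
  have cphi : continuous (fun w => (1 - alpha ^+ 2) * (expR (- (alpha * w)) * rho w)).
    move=> w; apply: cvgM; first exact: cvg_cst.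
    apply: cvgM; last exact: rho_cts.
    exact: isd_cts (isd_expR (isdN (isdZ alpha (isd_id w)))).
  have := cvg_riemann_sum (m := m) cphi dD D0; apply: cvgn_ext => n.
  rewrite -mulr_sumr mulrCA; congr (_ * (_ * _)).
  by apply: eq_bigr => j _; rewrite qE.
have bS n : `|hn n * Sn n| <= b * rho 0.
  have /andP[h0 _] := hn01 n.
  rewrite normrM gtr0_norm//.
  apply: le_trans (ler_wpM2l (ltW h0) (sum_rho_le _ (fun j => j%:R * hn n) (hn01 n))) _.
  by rewrite le_eqVlt; apply/orP; left; apply/eqP; field; rewrite gt_eqF.
(* Only [(1 - alpha^2) h S] has a known limit, while [h S] is merely bounded. Replacing [kap / h] by
   its limit [1 - alpha] leaves a vanishing multiple of a bounded sequence, and the rest is divided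
   by [1 + alpha], never by [1 - alpha]. *)
have cK : kap (hn n) * Sn n @[n --> \oo] --> D m.+1%:R / (1 + alpha).
  have c1 : (kap (hn n) / hn n - (1 - alpha)) * (hn n * Sn n) @[n --> \oo] --> (0 : R).
    apply: (@cvgn0_squeeze _ _ (fun n => `|kap (hn n) / hn n - (1 - alpha)| * (b * rho 0))).
      by move=> n; rewrite normrM ler_wpM2l.
    rewrite -[X in _ --> X](mul0r (b * rho 0)); apply: cvgM; last exact: cvg_cst.
    rewrite -(@normr0 R R); apply: cvg_norm.
    rewrite -[X in _ --> X](subrr (1 - alpha)); apply: cvgB; [exact: cvg_kap|exact: cvg_cst].
  have c2 : (1 - alpha ^+ 2) * (hn n * Sn n) / (1 + alpha) @[n --> \oo] --> D m.+1%:R / (1 + alpha).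
    by apply: cvgM cS _; exact: cvg_cst.
  rewrite -[X in _ --> X]add0r; apply: cvgn_ext (cvgD c1 c2) => n /=.
  have /andP[h0 _] := hn01 n.
  by field; rewrite !gt_eqF.
have cz : hn n / (1 - q (hn n) ^+ 2) @[n --> \oo] --> (2 * alpha)^-1.
  have a2 : 2 * alpha != 0 by rewrite mulf_neq0// gt_eqF.
  apply: cvgn_ext (cvgV a2 cvg_q2) => n /=.
  have /andP[h0 _] := hn01 n; have [q20 _] := q21 (hn01 n).
  by field; rewrite !gt_eqF.
have ch : hn n @[n --> \oo] --> (0 : R) by exact: (@cvg_harmonic R).
pose v n := rho 0 + (2 * (kap (hn n) / hn n * (hn n / (1 - q (hn n) ^+ 2)) * (kap (hn n) * Sn n))
  - kap (hn n) / hn n * (kap (hn n) / hn n) * hn n * (hn n / (1 - q (hn n) ^+ 2)) * rho 0)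
  + 2 * (kap (hn n) * Sn n).
have hv : v n @[n --> \oo] --> rho 0 + (2 * ((1 - alpha) * (2 * alpha)^-1 * (D m.+1%:R / (1 + alpha)))
  - (1 - alpha) * (1 - alpha) * 0 * (2 * alpha)^-1 * rho 0) + 2 * (D m.+1%:R / (1 + alpha)).
  have c2 : ((2 : R) @[n --> \oo]) --> (2 : R) by exact: cvg_cst.
  have cr : (rho 0 @[n --> \oo]) --> rho 0 by exact: cvg_cst.
  apply: cvgD; last exact: cvgM.
  apply: cvgD => //; apply: cvgB; first by apply: cvgM => //; apply: cvgM => //; exact: cvgM.
  by apply: cvgM => //; apply: cvgM => //; apply: cvgM => //; exact: cvgM.
rewrite (_ : rho 0 + D m.+1%:R / alpha = rho 0 + (2 * ((1 - alpha) * (2 * alpha)^-1 * (D m.+1%:R / (1 + alpha)))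
  - (1 - alpha) * (1 - alpha) * 0 * (2 * alpha)^-1 * rho 0) + 2 * (D m.+1%:R / (1 + alpha))); last first.
  by field; rewrite !gt_eqF.
apply: cvgn_ext hv => n; rewrite /main -/(Sn n) /v.
have /andP[h0 _] := hn01 n; have [q20 _] := q21 (hn01 n).
by field; rewrite !gt_eqF.
Qed.

Lemma discrete_variance_bound m : exists2 u : nat -> R,
  u n @[n --> \oo] --> rho 0 + D m.+1%:R / alpha &
  forall n, `|discrete_variance n.+1%:R^-1 (m.+1 * n.+1) - u n| <=
     variance_error * expR (- (alpha * m.+1%:R)).
Proof.
exists (fun n => main (hn n) (m.+1 * n.+1)); first exact: cvg_discrete_variance_main.
move=> n; apply: le_trans (discrete_variance_error _ (hn01 n)) _.
rewrite /q -expRM_natl le_eqVlt; apply/orP; left; apply/eqP; congr (_ * expR _).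
have : n.+1%:R != 0 :> R by rewrite pnatr_eq0.
by rewrite natrM /hn; move: (n.+1%:R) (m.+1%:R) => x y x0; field.
Qed.

End discretized_variance.

(** * Limits of Gaussian spaces *)

Section centered_normal.
Context {d : measure_display} {T : measurableType d} {R : realType}.
Variable P : probability T R.
Local Notation E := (esp P).

(** The parameters of the law are given without any link to the moments of [X]. The first two
    derivatives of the characteristic function at 0 identify them: [m = E X = 0] and
    [s^2 = E X^2]. *)
Lemma normal_gaussRV (X : T -> R) (m s : R) : L2 P X -> E X = 0 ->
  is_normal P X m s -> gaussRV P X.
Proof.
move=> hX EX nX.
have mX := L2_meas hX; have iX := L2_intg hX.
have i1 : intg P (fun=> 1) := intg_cst P 1.
have mc (c : R) : measurable_fun setT (fun _ : T => c) by exact: measurable_cst.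
have i1X : intg P (fun w => 1 * X w) by apply: eq_intg iX => w; rewrite mul1r.
have iXX : intg P (fun w => X w * X w) by exact: intgM.
pose F th t := E (fun w => cos (th + t * X w)).
have FE th t : F th t = cos (th + t * m) * expR (- (s ^+ 2 * t ^+ 2 / 2)).
  exact: is_normal_charfun.
have dF th t : isd (F th) t (- E (fun w => X w * sin (th + t * X w))).
  have h := isd_esp_cos t i1 mX i1X (mc th).
  apply: eq_isd (isd_eq h _).
    by move=> u; apply: eq_esp => w; rewrite mul1r.
  by congr (- _); apply: eq_esp => w; rewrite mul1r.
have dF' th t : isd (F th) t (- sin (th + t * m) * m * expR (- (s ^+ 2 * t ^+ 2 / 2))
    - cos (th + t * m) * (s ^+ 2 * t * expR (- (s ^+ 2 * t ^+ 2 / 2)))).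
  apply: (@eq_isd _ (fun t => cos (th + t * m) * expR (- (s ^+ 2 * t ^+ 2 / 2)))).
    by move=> u; rewrite FE.
  have i := isd_id t.
  have i2 := isdM (isdM (isd_cst (s ^+ 2) t) (isd_sqr i)) (isd_cst 2^-1 t).
  apply: isd_eq (isdM (isd_cos (isdD (isd_cst th t) (isdM i (isd_cst m t)))) (isd_expR (isdN i2))) _.
  by field.
have eqd th t : - E (fun w => X w * sin (th + t * X w)) =
    - sin (th + t * m) * m * expR (- (s ^+ 2 * t ^+ 2 / 2))
    - cos (th + t * m) * (s ^+ 2 * t * expR (- (s ^+ 2 * t ^+ 2 / 2))).
  by rewrite -(isd_derive1 (dF th t)) (isd_derive1 (dF' th t)).
have m0 : m = 0.
  have := eqd (pi / 2) 0; rewrite expr0n/= !mul0r !mulr0 !mul0r oppr0 expR0 mulr0 subr0 addr0 sin_pihalf.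
  rewrite (eq_esp P (Y := X)); last by move=> w; rewrite mul0r addr0 sin_pihalf mulr1.
  by rewrite EX mulr1 mulN1r => /eqP; rewrite eqr_opp => /eqP.
have vX : E (fun w => X w ^+ 2) = s ^+ 2.
  pose G t := E (fun w => X w * cos (- (pi / 2) + t * X w)).
  have cE (x : R) : cos (- (pi / 2) + x) = sin x.
    by rewrite addrC cosBpihalf.
  have GE t : G t = s ^+ 2 * t * expR (- (s ^+ 2 * t ^+ 2 / 2)).
    have := eqd 0 t; rewrite m0 !mulr0 !mul0r addr0 cos0 sub0r mul1r.
    move=> /eqP; rewrite eqr_opp => /eqP <-; apply: eq_esp => w; by rewrite cE add0r.
  have d1 := isd_esp_cos 0 iX mX iXX (mc (- (pi / 2))).
  have d2 : isd G 0 (s ^+ 2).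
    apply: (@eq_isd _ (fun t => s ^+ 2 * t * expR (- (s ^+ 2 * t ^+ 2 / 2)))).
      by move=> u; rewrite GE.
    have i := isd_id (0 : R).
    have i2 := isdM (isdM (isd_cst (s ^+ 2) 0) (isd_sqr i)) (isd_cst 2^-1 0).
    apply: isd_eq (isdM (isdM (isd_cst (s ^+ 2) 0) i) (isd_expR (isdN i2))) _.
    have -> : - (s ^+ 2 * 0 ^+ 2 / 2) = 0 by ring.
    by rewrite expR0; ring.
  have e := isd_derive1 d1; rewrite (isd_derive1 d2) in e; rewrite e.
  rewrite -espN; last first.
    apply: (intgMb (C := 1)) => //; last by move=> w; exact: norm_sin_le1.
    by apply: measurable_sin_comp; apply: measurable_funD => //; exact: measurable_funM.
  apply: eq_esp => w; rewrite mul0r addr0 sinN sin_pihalf; ring.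
split=> // th t; have := FE th t; rewrite /F m0 mulr0 addr0 => ->.
by rewrite vX.
Qed.

End centered_normal.

(** * L^2 limits of Gaussian spaces *)

Section L2_convergence.
Context {d : measure_display} {T : measurableType d} {R : realType}.
Variable P : probability T R.
Local Notation E := (esp P).
Implicit Types (X Y : T -> R) (Xn Yn : nat -> T -> R).

Definition cvgL2 Xn X := [/\ forall n, L2 P (Xn n), L2 P X &
  E (fun w => (Xn n w - X w) ^+ 2) @[n --> \oo] --> (0 : R)].

Lemma cvgL2_lin (a b : R) Xn Yn X Y : cvgL2 Xn X -> cvgL2 Yn Y ->
  cvgL2 (fun n w => a * Xn n w + b * Yn n w) (fun w => a * X w + b * Y w).
Proof.
move=> [hn h cx] [kn k cy]; split=> [n||].
- by apply: L2D; exact: L2Z.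
- by apply: L2D; exact: L2Z.
have c0 : 2 * a ^+ 2 * E (fun w => (Xn n w - X w) ^+ 2) + 2 * b ^+ 2 * E (fun w => (Yn n w - Y w) ^+ 2)
    @[n --> \oo] --> (0 : R).
  rewrite (_ : 0 = 2 * a ^+ 2 * 0 + 2 * b ^+ 2 * 0); last by ring.
  by apply: cvgD; apply: cvgM => //; exact: cvg_cst.
apply: cvgn0_squeeze c0 => n; rewrite ger0_norm; last by apply: esp_ge0 => w; exact: sqr_ge0.
have ix : intg P (fun w => (Xn n w - X w) ^+ 2) := L2_sq (L2B (hn n) h).
have iy : intg P (fun w => (Yn n w - Y w) ^+ 2) := L2_sq (L2B (kn n) k).
rewrite -!espZ// -espD; [|exact: intgZ|exact: intgZ].
apply: esp_le.
- by apply: L2_sq; apply: L2B; apply: L2D; exact: L2Z.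
- by apply: intgD; exact: intgZ.
move=> w; rewrite -subr_ge0; set x := Xn n w; set y := Yn n w.
rewrite (_ : _ - _ = (a * (x - X w) - b * (y - Y w)) ^+ 2) ?sqr_ge0//; ring.
Qed.

Lemma cvgn_sqrt0 (u : nat -> R) : u n @[n --> \oo] --> (0 : R) ->
  Num.sqrt (u n) @[n --> \oo] --> (0 : R).
Proof.
move=> /cvgn_epsP hu; apply/cvgn_epsP => e e0.
have [N hN] := hu (e ^+ 2) (exprn_gt0 _ e0); exists N => n /hN.
rewrite !subr0 [in X in _ -> X]ger0_norm ?sqrtr_ge0// => h.
rewrite -(ltr_pXn2r (_ : 0 < 2)%N) ?nnegrE ?sqrtr_ge0 ?(ltW e0)//.
have [u0|u0] := leP 0 (u n); first by rewrite sqr_sqrtr//; apply: le_lt_trans h; exact: ler_norm.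
by rewrite ler0_sqrtr ?(ltW u0)// expr0n/= exprn_gt0.
Qed.

Lemma cvgL2_inner Xn Yn X Y : cvgL2 Xn X -> cvgL2 Yn Y ->
  E (fun w => Xn n w * Yn n w) @[n --> \oo] --> E (fun w => X w * Y w).
Proof.
move=> [hn h cx] [kn k cy].
pose a n := Num.sqrt (E (fun w => (Xn n w - X w) ^+ 2)).
pose b n := Num.sqrt (E (fun w => (Yn n w - Y w) ^+ 2)).
have ca : a n @[n --> \oo] --> (0 : R) by exact: cvgn_sqrt0.
have cb : b n @[n --> \oo] --> (0 : R) by exact: cvgn_sqrt0.
pose x := Num.sqrt (E (fun w => X w ^+ 2)); pose y := Num.sqrt (E (fun w => Y w ^+ 2)).
have c0 : a n * b n + a n * y + x * b n @[n --> \oo] --> (0 : R).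
  rewrite (_ : 0 = 0 * 0 + 0 * y + x * 0); last by ring.
  have cc (z : R) : (z @[n --> \oo]) --> z by exact: cvg_cst.
  by apply: cvgD; [apply: cvgD; exact: cvgM|exact: cvgM].
have hd n : `|E (fun w => Xn n w * Yn n w) - E (fun w => X w * Y w)| <= a n * b n + a n * y + x * b n.
  have lx := L2B (hn n) h; have ly := L2B (kn n) k.
  have i1 := intgM lx ly; have i2 := intgM lx k; have i3 := intgM h ly.
  rewrite -espB; [|exact: intgM|exact: intgM].
  rewrite (eq_esp P (Y := fun w => (Xn n w - X w) * (Yn n w - Y w) + (Xn n w - X w) * Y w
     + X w * (Yn n w - Y w))); last by move=> w; ring.
  rewrite espD//; last exact: intgD.
  rewrite espD//.
  have hh u v : L2 P u -> L2 P v -> `|E (fun w => u w * v w)| <=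
      Num.sqrt (E (fun w => u w ^+ 2)) * Num.sqrt (E (fun w => v w ^+ 2)).
    by move=> hu hv; apply: le_trans (abs_esp (intgM hu hv)) (esp_normM_le hu hv).
  apply: le_trans (ler_normD _ _) _; apply: lerD; last exact: hh h ly.
  by apply: le_trans (ler_normD _ _) _; apply: lerD; [exact: hh lx ly|exact: hh lx k].
have /cvgn_epsP hc := cvgn0_squeeze hd c0.
by apply/cvgn_epsP => e /hc[N hN]; exists N => n /hN; rewrite subr0.
Qed.

Lemma abs_cosB_le (x y : R) : `|cos x - cos y| <= `|x - y|.
Proof.
rewrite -[leRHS]mul1r; apply: (@isd_lip _ cos (fun x => - sin x)).
  by move=> z; apply: isd_eq (isd_cos (isd_id z)) _; rewrite mulr1.
by move=> z; rewrite normrN norm_sin_le1.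
Qed.

Lemma cvgL2_cos Xn X (th t : R) : cvgL2 Xn X ->
  E (fun w => cos (th + t * Xn n w)) @[n --> \oo] --> E (fun w => cos (th + t * X w)).
Proof.
move=> [hn h cx].
have c0 : `|t| * Num.sqrt (E (fun w => (Xn n w - X w) ^+ 2)) @[n --> \oo] --> (0 : R).
  by rewrite -[X in _ --> X](mulr0 `|t|); apply: cvgM; [exact: cvg_cst|exact: cvgn_sqrt0].
have ic Y : L2 P Y -> intg P (fun w => cos (th + t * Y w)).
  move=> hY; apply: (@intg_bdd _ _ _ P _ 1); last by move=> w; exact: norm_cos_le1.
  apply: measurable_cos_comp; apply: measurable_funD => //; apply: measurable_funM => //.
  exact: L2_meas hY.
have hd n : `|E (fun w => cos (th + t * Xn n w)) - E (fun w => cos (th + t * X w))| <=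
    `|t| * Num.sqrt (E (fun w => (Xn n w - X w) ^+ 2)).
  have lx := L2B (hn n) h.
  rewrite -espB; [|exact: ic|exact: ic].
  apply: (@le_trans _ _ (E (fun w => `|t| * `|Xn n w - X w|))).
    have i1 := intgB (ic _ (hn n)) (ic _ h).
    apply: abs_esp_le; [exact: intg_meas i1|apply: intgZ; apply: intg_abs; exact: L2_intg|].
    move=> w; apply: le_trans (abs_cosB_le _ _) _.
    by rewrite -normrM (_ : _ - _ = t * (Xn n w - X w))//; ring.
  rewrite espZ; last by apply: intg_abs; exact: L2_intg.
  by rewrite ler_wpM2l//; exact: esp_norm_le.
have /cvgn_epsP hc := cvgn0_squeeze hd c0.
by apply/cvgn_epsP => e /hc[N hN]; exists N => n /hN; rewrite subr0.
Qed.

Definition L2_closure (G : set (T -> R)) : set (T -> R) :=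
  [set X | exists2 Xn, forall n, G (Xn n) & cvgL2 Xn X].

Lemma cvgL2_cst X : L2 P X -> cvgL2 (fun=> X) X.
Proof.
move=> h; split=> //.
rewrite (_ : (fun n => _) = fun=> 0); first exact: cvg_cst.
apply/funext => n; rewrite (eq_esp P (Y := fun=> 0)) ?esp_cst// => w.
by rewrite subrr expr0n.
Qed.

(** Cosines are Lipschitz and second moments are inner products, so both sides of the characteristic
    function identity pass to the limit. *)
Lemma L2_closure_gaussian (G : set (T -> R)) : gaussian_space P G ->
  gaussian_space P (L2_closure G).
Proof.
move=> hG; split=> [a b X Y [Xn gX cX] [Yn gY cY]|X [Xn gX cX]].
  exists (fun n w => a * Xn n w + b * Yn n w); last exact: cvgL2_lin.
  by move=> n; exact: (gs_lin hG).
have [_ lX _] := cX; split=> // th t.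
have c1 := cvgL2_cos (th := th) (t := t) cX.
have c2 := cvgL2_inner cX cX.
apply: (cvgn_unique c1).
apply: (@cvgn_ext _ _ (fun n => cos th * expR (- (E (fun w => Xn n w * Xn n w) * t ^+ 2 / 2)))).
  move=> n; have [_ /(_ (Xn n) (gX n))[_ ->]] := hG.
  by congr (_ * expR (- (_ * _ / _))); apply: eq_esp => w; rewrite expr2.
rewrite (eq_esp P (Y := fun w => X w * X w)); last by move=> w; rewrite expr2.
apply: cvgM; first exact: cvg_cst.
apply: (@cvg_comp _ _ _ (fun n => - (E (fun w => Xn n w * Xn n w) * t ^+ 2 / 2)) expR
  _ (nbhs (- (E (fun w => X w * X w) * t ^+ 2 / 2)))); last exact: continuous_expR.
have cc (z : R) : (z @[n --> \oo]) --> z by exact: cvg_cst.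
by apply: cvgN; apply: cvgM => //; apply: cvgM.
Qed.

End L2_convergence.

(** * The Gaussian space of the fractional Brownian motion *)

Section fbm_span.
Context {d : measure_display} {T : measurableType d} {R : realType}.
Variable P : probability T R.
Local Notation E := (esp P).
Variables (H : R) (B : R -> {RV P >-> R}).
Hypothesis hB : fractional_brownian_motion H B.

Lemma expectationE (X : T -> R) : ('E_P[X])%E = (\int[P]_w (X w)%:E)%E.
Proof. by rewrite unlock. Qed.

Lemma L2_of_expectation_fin (X : T -> R) (x : R) : measurable_fun setT X ->
  ('E_P[fun w => (X w ^+ 2)%R])%E = x%:E -> L2 P X.
Proof.
move=> mX; rewrite expectationE => e; split=> //.
have mX2 : measurable_fun setT (fun w => X w ^+ 2) by exact: measurable_funX.
apply/integrableP; split; first exact/measurable_EFinP.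
under eq_integral => w _ do rewrite /= ger0_norm ?sqr_ge0//.
by rewrite e ltry.
Qed.

Lemma fbm_L2 t : 0 <= t -> L2 P (B t).
Proof.
move=> t0; have [_ _ /(_ t t t0 t0) h] := hB.
apply: L2_of_expectation_fin h; exact: measurable_funPT.
Qed.

Lemma fbm_esp t : 0 <= t -> E (B t) = 0.
Proof.
move=> t0; have [_ /(_ t t0) + _] := hB.
by rewrite expectationE (espEE (L2_intg (fbm_L2 t0))) => -[].
Qed.

Lemma fbm_cov s t : 0 <= s -> 0 <= t -> E (fun w => B s w * B t w) =
  (s `^ (2 * H) + t `^ (2 * H) - `|t - s| `^ (2 * H)) / 2.
Proof.
move=> s0 t0; have [_ _ /(_ s t s0 t0)] := hB.
rewrite expectationE.
by rewrite (espEE (intgM (fbm_L2 s0) (fbm_L2 t0))) => -[].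
Qed.

Definition fbm_span : set (T -> R) := [set X | exists n (t c : 'I_n -> R),
  (forall i, 0 <= t i) /\ X = (fun w => \sum_(i < n) c i * B (t i) w)].

Lemma fbm_span_B t : 0 <= t -> fbm_span (B t).
Proof.
move=> t0; exists 1%N, (fun=> t), (fun=> 1); split=> //.
by apply/funext => w; rewrite big_ord_recl big_ord0 addr0 mul1r.
Qed.

Lemma fbm_span_gaussian : gaussian_space P fbm_span.
Proof.
split=> [a b X Y [n [t [c [t0 ->]]]] [m [s [e [s0 ->]]]]|X [n [t [c [t0 ->]]]]].
  exists (n + m)%N, (fun i => match fintype.split i with inl j => t j | inr j => s j end),
    (fun i => match fintype.split i with inl j => a * c j | inr j => b * e j end); split.
    by move=> i; case: fintype.split.
  apply/funext => w; rewrite big_split_ord/= !mulr_sumr; congr (_ + _).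
    by apply: eq_bigr => i _; rewrite (unsplitK (inl i)) mulrA.
  by apply: eq_bigr => i _; rewrite (unsplitK (inr i)) mulrA.
have lt i : L2 P (fun w => c i * B (t i) w) by apply: L2Z; exact: fbm_L2.
have [gB _ _] := hB.
have [|m [s hn]] := gB n t c; first by move=> i; rewrite /= in_itv/= t0.
apply: normal_gaussRV hn; first exact: L2_sum.
rewrite esp_sum; last by move=> i _; exact: L2_intg (lt i).
rewrite big1// => i _; rewrite espZ ?fbm_esp ?mulr0//.
by apply: L2_intg; exact: fbm_L2.
Qed.

End fbm_span.

(** * Riemann sums of the Wiener integral *)

Section discounted_sums.
Context {d : measure_display} {T : measurableType d} {R : realType}.
Variable P : probability T R.
Local Notation E := (esp P).
Variable G : set (T -> R).
Hypothesis hG : gaussian_space P G.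
Variables (Y : R -> T -> R) (rho : R -> R) (alpha : R).
Hypothesis gY : forall t, G (Y t).
Hypothesis covY : forall s t, E (fun w => Y s w * Y t w) = rho (s - t).
Hypothesis alpha0 : 0 < alpha.
Hypothesis rhoN : forall w, rho (- w) = rho w.
Implicit Types (t h : R) (L : nat).

Let q h := expR (- alpha * h).
Let kap h := expR ((1 - alpha) * h) - 1.

(** The left-tagged Riemann-Stieltjes sum times [exp (- alpha t)], with [p] counting cells backwards
    from the right endpoint [t]. The factor [expR ((1 - alpha) * h)] appears because the integrand
    is taken at the left end of a cell and [Y] also at its right end. *)
Definition discounted_sum t h L w := \sum_(p < L) q h ^+ p *
  (expR ((1 - alpha) * h) * Y (t - p%:R * h) w - q h * Y (t - p.+1%:R * h) w).
Local Notation V := discounted_sum.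

Lemma discounted_sumE t h L w : V t h L w = Y t w - q h ^+ L * Y (t - L%:R * h) w
  + kap h * \sum_(j < L) q h ^+ j * Y (t - j%:R * h) w.
Proof.
elim: L => [|L ih]; first by rewrite /V !big_ord0 expr0 mul0r subr0 mulr0 addr0 mul1r subrr.
by rewrite /V big_ord_recr/= -/(V t h L w) ih big_ord_recr/= exprSr /kap; ring.
Qed.

Lemma gs_sum (n : nat) (c : 'I_n -> R) (X : 'I_n -> T -> R) t : (forall i, G (X i)) ->
  G (fun w => \sum_(i < n) c i * X i w).
Proof.
elim: n c X => [|n ih] c X gX.
  by apply: (gs_ext _ (gsZ hG 0 (gY t))) => w; rewrite big_ord0 mul0r.
apply: (gs_ext _ (gs_lin hG 1 (c ord_max) (ih (fun i => c (widen_ord (leqnSn n) i)) _ (fun i => gX _)) (gX ord_max))).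
by move=> w; rewrite big_ord_recr/= mul1r.
Qed.

Lemma gs_discounted_sum t h L : G (V t h L).
Proof.
apply: (gs_sum _ t) => p.
apply: (gs_ext _ (gs_lin hG (expR ((1 - alpha) * h)) (- q h) (gY (t - p%:R * h)) (gY (t - p.+1%:R * h)))).
by move=> w; rewrite mulNr.
Qed.

Lemma esp_sum_mul (n m : nat) (a : 'I_n -> R) (b : 'I_m -> R) (s : 'I_n -> R) (r : 'I_m -> R) :
  E (fun w => (\sum_(i < n) a i * Y (s i) w) * (\sum_(j < m) b j * Y (r j) w)) =
  \sum_(i < n) \sum_(j < m) a i * b j * rho (s i - r j).
Proof.
have lY t := gs_L2 hG (gY t).
have iY x t u : intg P (fun w => x * (Y t w * Y u w)) by apply: intgZ; exact: intgM.
rewrite (eq_esp P (Y := fun w => \sum_(i < n) \sum_(j < m) a i * b j * (Y (s i) w * Y (r j) w))); last first.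
  move=> w; rewrite mulr_suml; apply: eq_bigr => i _; rewrite mulr_sumr; apply: eq_bigr => j _; ring.
rewrite esp_sum; last by move=> i _; apply: intg_sum => j _; exact: iY.
apply: eq_bigr => i _; rewrite esp_sum; last by move=> j _; exact: iY.
by apply: eq_bigr => j _; rewrite espZ ?covY//; exact: intgM.
Qed.

Lemma discounted_sum_variance t h L : E (fun w => V t h L w ^+ 2) = discrete_variance alpha rho h L.
Proof.
have lY u := gs_L2 hG (gY u).
pose Ga w := \sum_(j < L) q h ^+ j * Y (t - j%:R * h) w.
have gGa : G Ga by exact: gs_sum.
have lG := gs_L2 hG gGa.
set Z := Y (t - L%:R * h); set qL := q h ^+ L.
have e1 : E (fun w => Y t w * Ga w) = \sum_(j < L) q h ^+ j * rho (j%:R * h).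
  have := esp_sum_mul (fun _ : 'I_1 => 1) (fun j : 'I_L => q h ^+ j) (fun=> t) (fun j => t - j%:R * h).
  rewrite big_ord_recl big_ord0 addr0.
  rewrite (eq_esp P (Y := fun w => Y t w * Ga w)); last first.
    by move=> w; rewrite big_ord_recl big_ord0 addr0 mul1r.
  move=> ->; apply: eq_bigr => j _; rewrite mul1r; congr (_ * rho _); ring.
have e2 : E (fun w => Z w * Ga w) = \sum_(j < L) q h ^+ j * rho (j%:R * h - L%:R * h).
  have := esp_sum_mul (fun _ : 'I_1 => 1) (fun j : 'I_L => q h ^+ j) (fun=> t - L%:R * h) (fun j => t - j%:R * h).
  rewrite big_ord_recl big_ord0 addr0.
  rewrite (eq_esp P (Y := fun w => Z w * Ga w)); last first.
    by move=> w; rewrite big_ord_recl big_ord0 addr0 mul1r.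
  move=> ->; apply: eq_bigr => j _; rewrite mul1r; congr (_ * rho _); ring.
have e3 : E (fun w => Ga w * Ga w) =
    \sum_(i < L) \sum_(j < L) q h ^+ i * q h ^+ j * rho (i%:R * h - j%:R * h).
  rewrite esp_sum_mul; apply: eq_bigr => i _; apply: eq_bigr => j _; congr (_ * _).
  by rewrite -rhoN; congr rho; ring.
have e4 : E (fun w => Y t w * Y t w) = rho 0 by rewrite covY subrr.
have e5 : E (fun w => Z w * Z w) = rho 0 by rewrite covY subrr.
have e6 : E (fun w => Y t w * Z w) = rho (L%:R * h) by rewrite covY; congr rho; ring.
rewrite (eq_esp P (Y := fun w => (((Y t w * Y t w + kap h ^+ 2 * (Ga w * Ga w)) + 2 * kap h * (Y t w * Ga w)
   + qL ^+ 2 * (Z w * Z w)) - 2 * qL * (Y t w * Z w)) - 2 * kap h * qL * (Z w * Ga w))); last first.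
  by move=> w; rewrite discounted_sumE -/(Ga w) -/qL -/(Z w); ring.
have lZ : L2 P Z by exact: lY.
have i1 := intgM (lY t) (lY t).
have i2 := intgZ (kap h ^+ 2) (intgM lG lG).
have i3 := intgZ (2 * kap h) (intgM (lY t) lG).
have i4 := intgZ (qL ^+ 2) (intgM lZ lZ).
have i5 := intgZ (2 * qL) (intgM (lY t) lZ).
have i6 := intgZ (2 * kap h * qL) (intgM lZ lG).
have j1 := intgD i1 i2; have j2 := intgD j1 i3; have j3 := intgD j2 i4; have j4 := intgB j3 i5.
rewrite (espB j4 i6) (espB j3 i5) (espD j2 i4) (espD j1 i3) (espD i1 i2).
rewrite !espZ ?e1 ?e2 ?e3 ?e4 ?e5 ?e6//; exact: intgM.
Qed.

(** Moving the left endpoint further away adds a sum of the same kind, ending at [t - L h] and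
    damped by [q^L]. A bound on second moments thus becomes a tail bound. *)
Lemma discounted_sum_cat t h L L' w :
  V t h (L + L') w - V t h L w = q h ^+ L * V (t - L%:R * h) h L' w.
Proof.
rewrite /V big_split_ord/= addrAC subrr add0r mulr_sumr; apply: eq_bigr => p _.
rewrite exprD -mulrA; congr (_ * (_ * (_ * Y _ w - _ * Y _ w))).
  by rewrite natrD; ring.
by rewrite -addnS natrD; ring.
Qed.

Variables (K c : R).
Hypothesis K0 : 0 <= K.
Hypothesis c0 : 0 <= c < alpha.
Hypothesis rho_decay : forall w, `|rho w| <= K * expR (- (c * `|w|)).

(** Bounds the sum of [|coef j| exp (c j h)] uniformly in [h] and [L]: the two endpoint terms
    contribute at most 1 each, and the rest is [kap = O(h)] times a geometric series of ratio
    [exp (- (alpha - c) h)]. *)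
Definition discounted_weight : R := 2 + `|1 - alpha| * expR `|1 - alpha| * ((1 + (alpha - c)) / (alpha - c)).
Definition discounted_cov_bound : R := K * discounted_weight ^+ 2.

Let coef h L (j : nat) : R := (j == 0%N)%:R - (j == L)%:R * q h ^+ L + (j < L)%:R * (kap h * q h ^+ j).

Let VE t h L w : V t h L w = \sum_(j < L.+1) coef h L j * Y (t - j%:R * h) w.
Proof.
rewrite /coef; under eq_bigr do rewrite mulrDl mulrBl.
rewrite big_split sumrB discounted_sumE; congr (_ - _ + _).
- rewrite big_ord_recl mul1r mul0r subr0 big1 ?addr0// => j _.
  by rewrite mul0r.
- rewrite big_ord_recr/= eqxx mul1r big1 ?add0r// => j _.
  by rewrite /= ltn_eqF// !mul0r.
rewrite big_ord_recr/= ltnn !mul0r addr0 mulr_sumr; apply: eq_bigr => j _.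
by rewrite /= ltn_ord mul1r mulrA.
Qed.

Let ca : 0 < alpha - c. Proof. by rewrite subr_gt0; case/andP: c0. Qed.

Let weight_le h L : 0 < h <= 1 ->
  \sum_(j < L.+1) `|coef h L j| * expR (c * (j%:R * h)) <= discounted_weight.
Proof.
move=> hh; have /andP[h0 h1] := hh.
have q0 : 0 < q h by exact: expR_gt0.
have qe j : q h ^+ j * expR (c * (j%:R * h)) = expR (- (alpha - c) * h) ^+ j.
  by rewrite /q -!expRM_natl -expRD; congr expR; ring.
apply: (@le_trans _ _ (\sum_(j < L.+1) ((j == 0%N :> nat)%:R * expR (c * (j%:R * h))
   + (j == L :> nat)%:R * q h ^+ L * expR (c * (j%:R * h))
   + (j < L)%:R * (`|kap h| * expR (- (alpha - c) * h) ^+ j)))).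
  apply: ler_sum => j _; rewrite -qe mulrA (mulrA `|kap h|) mulrA -!mulrDl ler_wpM2r ?expR_ge0//.
  rewrite /coef; apply: le_trans (ler_normD _ _) _; apply: lerD.
    apply: le_trans (ler_normB _ _) _; rewrite normrM !normr_nat.
    by rewrite (ger0_norm (exprn_ge0 _ (ltW q0))).
  by rewrite !normrM normr_nat (ger0_norm (exprn_ge0 _ (ltW q0))).
have e0 : 0 < expR (- (alpha - c) * h) by exact: expR_gt0.
have [p1 p2] := inv_one_sub_expRN_le ca hh.
rewrite !big_split/= /discounted_weight (_ : 2 = 1 + 1)//; apply: lerD; first apply: lerD.
- rewrite big_ord_recl/= mul0r mulr0 expR0 mul1r big1 ?addr0// => j _.
  by rewrite mul0r.
- rewrite big_ord_recr/= eqxx mul1r qe big1 ?add0r; last by move=> j _; rewrite ltn_eqF// !mul0r.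
  by rewrite exprn_ile1 ?(ltW e0)// -subr_ge0 ltW.
rewrite big_ord_recr/= ltnn mul0r addr0.
under eq_bigr => j _ do rewrite ltn_ord mul1r.
rewrite -mulr_sumr.
have k1 := abs_expR_sub1_scaled_le (1 - alpha) hh.
apply: (@le_trans _ _ (`|1 - alpha| * expR `|1 - alpha| * h * ((1 + (alpha - c)) / (alpha - c) / h))).
  apply: ler_pM => //; first by apply: sumr_ge0 => j _; rewrite exprn_ge0// ltW.
  by apply: le_trans p2; apply: geometric_sum_le => //; exact: ltW.
rewrite le_eqVlt; apply/orP; left; apply/eqP; field; by rewrite !gt_eqF.
Qed.

(** By the triangle inequality, going back [i] and [j] steps costs at most [exp (c i h) exp (c j h)]
    in the decay of [rho]. The double sum then factors into two weights. *)
Lemma discounted_sum_cov_le t t' h L L' : 0 < h <= 1 ->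
  `|E (fun w => V t h L w * V t' h L' w)| <= discounted_cov_bound * expR (- (c * `|t - t'|)).
Proof.
move=> hh; have /andP[h0 h1] := hh; have /andP[c00 _] := c0.
rewrite (eq_esp P (Y := fun w => (\sum_(j < L.+1) coef h L j * Y (t - j%:R * h) w) *
   (\sum_(j < L'.+1) coef h L' j * Y (t' - j%:R * h) w))); last by move=> w; rewrite !VE.
rewrite (esp_sum_mul (fun j : 'I_L.+1 => coef h L j) (fun j : 'I_L'.+1 => coef h L' j)
  (fun j => t - j%:R * h) (fun j => t' - j%:R * h)).
apply: le_trans (ler_norm_sum _ _ _) _.
apply: (@le_trans _ _ (\sum_(i < L.+1) \sum_(j < L'.+1) K * expR (- (c * `|t - t'|)) *
   ((`|coef h L i| * expR (c * (i%:R * h))) * (`|coef h L' j| * expR (c * (j%:R * h)))))).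
  apply: ler_sum => i _; apply: le_trans (ler_norm_sum _ _ _) _; apply: ler_sum => j _.
  rewrite !normrM.
  rewrite [leRHS](_ : _ = `|coef h L i| * `|coef h L' j| *
    (K * (expR (- (c * `|t - t'|)) * expR (c * (i%:R * h)) * expR (c * (j%:R * h))))); last by ring.
  rewrite ler_wpM2l ?mulr_ge0//; apply: le_trans (rho_decay _) _; rewrite ler_wpM2l//.
  rewrite -!expRD ler_expR [leRHS](_ : _ = - (c * (`|t - t'| - i%:R * h - j%:R * h))); last by ring.
  rewrite lerN2 ler_wpM2l//.
  have a1 : 0 <= i%:R * h by rewrite mulr_ge0// ltW.
  have a2 : 0 <= j%:R * h by rewrite mulr_ge0// ltW.
  rewrite -addrA -opprD lerBlDr [X in `|X| <= _](_ : t - t' = t - i%:R * h - (t' - j%:R * h) + (i%:R * h - j%:R * h)); last by ring.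
  apply: le_trans (ler_normD _ _) _; rewrite lerD2l.
  by apply: le_trans (ler_normB _ _) _; rewrite !ger0_norm.
under eq_bigr => i _ do rewrite -mulr_sumr.
rewrite -mulr_sumr; under eq_bigr => i _ do rewrite -mulr_sumr.
rewrite -mulr_suml /discounted_cov_bound [leLHS]mulrAC [leRHS]mulrAC -!mulrA ler_wpM2l//.
rewrite mulrA mulrC ler_wpM2l ?expR_ge0// expr2.
by apply: ler_pM; try exact: weight_le; apply: sumr_ge0 => j _; rewrite mulr_ge0// expR_ge0.
Qed.

Lemma discounted_sum_tail_le t h L L' : 0 < h <= 1 ->
  E (fun w => (V t h (L + L') w - V t h L w) ^+ 2) <= discounted_cov_bound * (q h ^+ L) ^+ 2.
Proof.
move=> hh; set u := t - L%:R * h.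
rewrite (eq_esp P (Y := fun w => (q h ^+ L) ^+ 2 * (V u h L' w * V u h L' w))); last first.
  by move=> w; rewrite discounted_sum_cat -/u; ring.
have lV := gs_L2 hG (gs_discounted_sum u h L').
rewrite espZ; last exact: intgM.
rewrite mulrC ler_wpM2r ?sqr_ge0//.
have := discounted_sum_cov_le u u L' L' hh.
rewrite subrr normr0 mulr0 oppr0 expR0 mulr1; apply: le_trans; exact: ler_norm.
Qed.

End discounted_sums.

(** * Wiener integrals as limits along uniform grids *)

Section integral_as_limit.
Context {d : measure_display} {T : measurableType d} {R : realType}.
Variable P : probability T R.
Local Notation E := (esp P).

Lemma L2_of_expectation_lt (X : T -> R) (e : R) : measurable_fun setT X ->
  ('E_P[fun w => (X w ^+ 2)%R] < e%:E)%E -> L2 P X /\ E (fun w => X w ^+ 2) < e.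
Proof.
move=> mX; rewrite expectationE => h.
have lX : L2 P X.
  split=> //; apply/integrableP; split; first by apply/measurable_EFinP; exact: measurable_funX.
  under eq_integral => w _ do rewrite /= ger0_norm ?sqr_ge0//.
  by apply: lt_trans h _; rewrite ltry.
by split=> //; move: h; rewrite espEE ?lte_fin//; exact: L2_sq.
Qed.

Definition uniform_partition (a h : R) (L : nat) : seq R := mkseq (fun i => a + i.+1%:R * h) L.

Lemma nth_uniform_partition (a b h : R) (L i : nat) : (i < L)%N ->
  nth b (uniform_partition a h L) i = a + i.+1%:R * h.
Proof. by move=> iL; rewrite nth_mkseq. Qed.

Lemma nth_cons_uniform_partition (a b h : R) (L i : nat) : (i <= L)%N ->
  nth b (a :: uniform_partition a h L) i = a + i%:R * h.
Proof.
by case: i => [|i] iL; rewrite /= ?mul0r ?addr0// nth_uniform_partition.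
Qed.

Lemma uniform_itv_partition (a h : R) (L : nat) : 0 < h ->
  itv_partition a (a + L%:R * h) (uniform_partition a h L).
Proof.
move=> h0; split.
  apply/(pathP a) => i; rewrite size_mkseq => iL.
  rewrite nth_cons_uniform_partition ?(ltnW iL)// nth_uniform_partition//.
  by rewrite ltrD2l ltr_pM2r// ltr_nat.
rewrite -[last _ _]/(last a (a :: _)) -nth_last /= size_mkseq.
by rewrite nth_cons_uniform_partition.
Qed.

Lemma is_integral_cvgL2 (X : R -> {RV P >-> R}) (f : R -> R) (a : R) (m : nat) (I : {RV P >-> R}) :
  (forall t, L2 P (X t)) -> is_integral P (fun t => X t) f a (a + m%:R) I ->
  cvgL2 P (fun n => riemann_stieltjes_sum (fun t => X t) f a (a + m%:R)
     (uniform_partition a n.+1%:R^-1 (m * n.+1)) (fun i => a + i%:R * n.+1%:R^-1)) I.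
Proof.
move=> lX hI.
pose S n := riemann_stieltjes_sum (fun t => X t) f a (a + m%:R)
     (uniform_partition a n.+1%:R^-1 (m * n.+1)) (fun i => a + i%:R * n.+1%:R^-1).
have lS n : L2 P (S n).
  apply: L2_sum => i _; apply: L2Z; apply: L2B; exact: lX.
have mI : measurable_fun setT I by exact: measurable_funPT.
have key e : 0 < e -> exists N, forall n, (N <= n)%N ->
    L2 P (fun w => S n w - I w) /\ E (fun w => (S n w - I w) ^+ 2) < e.
  move=> e0; have [dl dl0 hd] := hI e e0.
  have /cvgn_epsP/(_ _ dl0)[N hN] := @cvg_harmonic R; exists N => n /hN.
  rewrite /harmonic /= subr0; set h := n.+1%:R^-1; move=> hdl.
  have h0 : 0 < h by rewrite invr_gt0.
  rewrite ger0_norm ?(ltW h0)// in hdl.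
  apply: L2_of_expectation_lt.
    by apply: measurable_funB => //; exact: L2_meas (lS n).
  (* The integer length of the interval makes both endpoints grid points for every [n]. *)
  have mE : a + m%:R = a + (m * n.+1)%:R * h by rewrite natrM mulfK// pnatr_eq0.
  apply: hd; first by rewrite mE; exact: uniform_itv_partition.
  rewrite size_mkseq => i iL; rewrite nth_cons_uniform_partition ?(ltnW iL)// nth_uniform_partition//.
  rewrite lexx lerD2l ler_wpM2r ?(ltW h0)// ?ler_nat//.
  by rewrite opprD addrACA subrr add0r -mulrBl -natrB// subSnn mul1r.
(* The definition of the integral bounds only the distance to the sums; a single sum at finite
   distance makes [I] square-integrable. *)
have lI : L2 P I.
  have [N hN] := key 1 ltr01; have [l _] := hN N (leqnn _).
  by apply: eq_L2 (L2B (lS N) l) => w; rewrite opprB addrC subrK.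
split=> //; apply/cvgn_epsP => e e0; have [N hN] := key e e0.
exists N => n /hN[_]; rewrite subr0 ger0_norm//; by apply: esp_ge0 => w; exact: sqr_ge0.
Qed.

Lemma is_integral_Ny_cvgL2 (X : R -> {RV P >-> R}) (f : R -> R) (b : R) (I : {RV P >-> R}) :
  (forall t, L2 P (X t)) -> is_integral_Ny P (fun t => X t) f b I ->
  exists2 J : nat -> {RV P >-> R},
    forall m, cvgL2 P (fun n => riemann_stieltjes_sum (fun t => X t) f (b - m%:R) b
      (uniform_partition (b - m%:R) n.+1%:R^-1 (m * n.+1)) (fun i => (b - m%:R) + i%:R * n.+1%:R^-1)) (J m) &
    cvgL2 P (fun m => J m) I.
Proof.
move=> lX [J hJ cJ]; exists (fun m => J (b - m%:R)).
  move=> m; have := @is_integral_cvgL2 X f (b - m%:R) m (J (b - m%:R)) lX; rewrite subrK; apply.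
  by apply: hJ; rewrite gerBl.
have lJ m : L2 P (J (b - m%:R)).
  have := @is_integral_cvgL2 X f (b - m%:R) m (J (b - m%:R)) lX; rewrite subrK.
  by case; first by apply: hJ; rewrite gerBl.
have key e : 0 < e -> exists N, forall m, (N <= m)%N ->
    L2 P (fun w => J (b - m%:R) w - I w) /\ E (fun w => (J (b - m%:R) w - I w) ^+ 2) < e.
  move=> e0; have := cJ [set x | (x < e%:E)%E] _.
  case.
    by apply: open_nbhs_nbhs; split; [exact: open_ereal_lt_ereal|rewrite /= lte_fin].
  move=> M [_ hM]; exists (Num.bound (b - M)) => m Nm.
  apply: L2_of_expectation_lt; first by apply: measurable_funB; exact: measurable_funPT.
  apply: hM; rewrite ltrBlDr -ltrBlDl.
  have [h|h] := leP 0 (b - M); last by apply: lt_le_trans h _.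
  by apply: (lt_le_trans (archi_boundP h)); rewrite ler_nat.
split=> //.
  have [N hN] := key 1 ltr01; have [l _] := hN N (leqnn _).
  by apply: eq_L2 (L2B (lJ N) l) => w; rewrite opprB addrC subrK.
apply/cvgn_epsP => e e0; have [N hN] := key e e0.
exists N => n /hN[_]; rewrite subr0 ger0_norm//; by apply: esp_ge0 => w; exact: sqr_ge0.
Qed.

End integral_as_limit.

(** * The two processes as limits of discounted sums *)

Section stationary_transform.
Context {d : measure_display} {T : measurableType d} {R : realType}.
Variable P : probability T R.
Local Notation E := (esp P).
Variables (H alpha : R) (B : R -> {RV P >-> R}).
Hypothesis hH : 1 / 2 < H < 1.
Hypothesis hB : fractional_brownian_motion H B.

Let H0 : 0 < H. Proof. by case/andP: hH => ? _; lra. Qed.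

Lemma time_change_ge0 s : 0 <= time_change H s.
Proof. by rewrite mulr_ge0 ?expR_ge0// ltW. Qed.

Definition lamperti (s : R) (w : T) : R := expR (- s) * B (time_change H s) w.

Lemma lamperti_span s : fbm_span B (lamperti s).
Proof.
exact: (gsZ (fbm_span_gaussian hB) _ (fbm_span_B B (time_change_ge0 s))).
Qed.

Lemma lamperti_cov s t : E (fun w => lamperti s w * lamperti t w) = fou2_cov H (s - t).
Proof.
rewrite (eq_esp P (Y := fun w => expR (- s) * expR (- t) * (B (time_change H s) w * B (time_change H t) w))); last first.
  by move=> w; rewrite /lamperti; ring.
rewrite espZ; last by apply: intgM; apply: (fbm_L2 hB); exact: time_change_ge0.
rewrite (fbm_cov hB) ?time_change_ge0//.
exact: time_change_cov.
Qed.

Lemma riemann_stieltjes_discounted_sum (a h : R) (L : nat) w :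
  expR (- alpha * (a + L%:R * h)) *
  riemann_stieltjes_sum (fun s => B (time_change H s)) (fun s => expR ((alpha - 1) * s)) a (a + L%:R * h)
    (uniform_partition a h L) (fun i => a + i%:R * h) w = discounted_sum lamperti alpha (a + L%:R * h) h L w.
Proof.
rewrite /riemann_stieltjes_sum size_mkseq big_mkord mulr_sumr /discounted_sum.
rewrite (reindex_inj rev_ord_inj)/=; apply: eq_bigr => p _.
have pL := ltn_ord p.
rewrite nth_cons_uniform_partition ?leq_subr// nth_uniform_partition ?subnSK ?leq_subr//.
have e1 : a + L%:R * h - p%:R * h = a + (L - p)%:R * h.
  by rewrite natrB ?(ltnW pL)//; ring.
have e2 : a + L%:R * h - p.+1%:R * h = a + (L - p.+1)%:R * h by rewrite natrB//; ring.
rewrite e1 e2 /lamperti; set s := a + (L - p.+1)%:R * h.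
have e3 : a + (L - p)%:R * h = s + h by rewrite /s !natrB ?(ltnW pL)// -natr1; ring.
have e4 : a + L%:R * h = s + p%:R * h + h by rewrite /s natrB// -natr1; ring.
rewrite e3 e4 mulrBr mulrA.
rewrite [RHS](_ : _ = expR (- alpha * h) ^+ p * expR ((1 - alpha) * h) * expR (- (s + h)) * B (time_change H (s + h)) w
  - expR (- alpha * h) ^+ p * expR (- alpha * h) * expR (- s) * B (time_change H s) w); last by ring.
rewrite -!expRM_natl -!expRD mulrBr !mulrA -!expRD; congr (expR _ * _ - expR _ * _); ring.
Qed.

Let K := H `^ (2 * H).
Let c1 := (1 - H) / H.
Let hH1 : 0 < 1 - H. Proof. by case/andP: hH => _ ?; rewrite subr_gt0. Qed.
Let c10 : 0 < c1. Proof. by rewrite divr_gt0. Qed.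
Hypothesis alpha0 : 0 < alpha.

(** It has to be strictly below [alpha], for the weights [q^j exp (c j h)] to be summable, and at
    most the decay rate [(1 - H) / H] of the covariance; half of the minimum satisfies both. *)
Definition fou2_rate : R := Num.min alpha ((1 - H) / H) / 2.
Definition fou2_cov_bound : R := discounted_cov_bound alpha (3 / 2 * H `^ (2 * H)) fou2_rate.
Local Notation c := fou2_rate.
Local Notation C := fou2_cov_bound.

Lemma fou2_rate_gt0 : 0 < c.
Proof. by rewrite divr_gt0// lt_min alpha0 c10. Qed.

Let c_bounds : 0 <= c < alpha.
Proof.
rewrite (ltW fou2_rate_gt0)/= /fou2_rate; apply: (@le_lt_trans _ _ (alpha / 2)).
  by rewrite ler_wpM2r// ge_min lexx.
by rewrite ltr_pdivrMr// mulr_natr mulr2n ltrDl.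
Qed.

Let K0 : 0 <= 3 / 2 * K. Proof. by rewrite mulr_ge0// powR_ge0. Qed.

Let decay w : `|fou2_cov H w| <= 3 / 2 * K * expR (- (c * `|w|)).
Proof.
apply: le_trans (fou2_cov_abs_le hH w) _; rewrite ler_wpM2l// ler_expR lerN2 ler_wpM2r//.
rewrite /fou2_rate -/c1; apply: (@le_trans _ _ (c1 / 2)).
  by rewrite ler_wpM2r// ge_min lexx orbT.
by rewrite ler_pdivrMr// mulr_natr mulr2n lerDl ltW.
Qed.

Lemma fou2_cov_bound_ge0 : 0 <= C.
Proof. by rewrite mulr_ge0// sqr_ge0. Qed.

Local Notation G := (fbm_span B).
Let hG : gaussian_space P G := fbm_span_gaussian hB.
Let V (k m n : nat) := discounted_sum lamperti alpha k%:R n.+1%:R^-1 (m * n.+1).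
Let hn (n : nat) : 0 < (n.+1%:R^-1 : R) <= 1.
Proof. by rewrite invr_gt0 ltr0n/= invf_le1 ?ltr0n// ler1n. Qed.
Let gV k m n : G (V k m n).
Proof. by apply: (gs_discounted_sum hG) => t; exact: lamperti_span. Qed.

Lemma discounted_sum_lamperti_cov_le k l m m' n :
  `|E (fun w => V k m n w * V l m' n w)| <= C * expR (- (c * `|k%:R - l%:R|)).
Proof.
by apply: (discounted_sum_cov_le hG lamperti_span lamperti_cov K0 c_bounds decay); exact: hn.
Qed.

Lemma discounted_sum_lamperti_tail_le k m n :
  E (fun w => (V k (k + m) n w - V k k n w) ^+ 2) <= C * expR (- (alpha * k%:R)).
Proof.
rewrite {1}/V mulnDl.
apply: le_trans (discounted_sum_tail_le hG lamperti_span lamperti_cov K0 c_bounds decay _ _ _ (hn n)) _.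
rewrite ler_wpM2l ?fou2_cov_bound_ge0// -!expRM_natl ler_expR.
have n0 : n.+1%:R != 0 :> R by rewrite pnatr_eq0.
rewrite (natrM _ k) mulrCA [X in X <= _](_ : _ = - (alpha * k%:R) - alpha * k%:R); last first.
  by move: (n.+1%:R) n0 => x x0; field.
by rewrite gerDl oppr_le0 mulr_ge0// ltW.
Qed.

Lemma fou2_limit (k m : nat) (a : R) (I : {RV P >-> R}) : a + m%:R = k%:R ->
  cvgL2 P (fun n => riemann_stieltjes_sum (fun s => B (time_change H s))
     (fun s => expR ((alpha - 1) * s)) a k%:R
     (uniform_partition a n.+1%:R^-1 (m * n.+1)) (fun i => a + i%:R * n.+1%:R^-1)) I ->
  cvgL2 P (V k m) (fun w => expR (- alpha * k%:R) * I w).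
Proof.
move=> amk hI.
have [h1 h2 h3] := cvgL2_lin (expR (- alpha * k%:R)) 0 hI hI.
have e1 w : expR (- alpha * k%:R) * I w + 0 * I w = expR (- alpha * k%:R) * I w.
  by rewrite mul0r addr0.
have e2 n : (fun w => expR (- alpha * k%:R) * riemann_stieltjes_sum (fun s => B (time_change H s))
     (fun s => expR ((alpha - 1) * s)) a k%:R
     (uniform_partition a n.+1%:R^-1 (m * n.+1)) (fun i => a + i%:R * n.+1%:R^-1) w
  + 0 * riemann_stieltjes_sum (fun s => B (time_change H s))
     (fun s => expR ((alpha - 1) * s)) a k%:R
     (uniform_partition a n.+1%:R^-1 (m * n.+1)) (fun i => a + i%:R * n.+1%:R^-1) w) =1 V k m n.
  have n0 : n.+1%:R != 0 :> R by rewrite pnatr_eq0.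
  move=> w; rewrite mul0r addr0.
  have := riemann_stieltjes_discounted_sum a n.+1%:R^-1 (m * n.+1) w.
  by rewrite natrM mulfK// amk.
split=> [n||].
- exact: eq_L2 (e2 n) (h1 n).
- exact: eq_L2 e1 h2.
apply: cvgn_ext h3 => n; apply: eq_esp => w.
have e2' := e2 n w; rewrite /= in e2'.
by rewrite e1 e2'.
Qed.

Variables U Ualpha : R -> {RV P >-> R}.
Hypothesis hU : fOU2 H alpha B U.
Hypothesis hUa : stationary_fOU2 H alpha B Ualpha.

Let lB t : L2 P (B (time_change H t)).
Proof. by apply: (fbm_L2 hB); exact: time_change_ge0. Qed.

Lemma fou2_cvgL2 (k : nat) : cvgL2 P (V k k) (U k%:R).
Proof.
have [I hI eU] := hU (ler0n R k).
have e0 : 0 + k%:R = k%:R :> R by rewrite add0r.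
have := @is_integral_cvgL2 _ _ _ P (fun t => B (time_change H t)) (fun s => expR ((alpha - 1) * s)) 0 k I lB.
rewrite e0 => /(_ hI)/(fou2_limit e0)[h1 h2 h3].
split=> //; first by apply: eq_L2 h2 => w; rewrite eU.
by apply: cvgn_ext h3 => n; apply: eq_esp => w; rewrite eU.
Qed.

Lemma stationary_fou2_cvgL2 (k : nat) : exists2 Z : nat -> T -> R,
  forall m, cvgL2 P (V k m) (Z m) & cvgL2 P Z (Ualpha k%:R).
Proof.
have [I hI eU] := hUa (ler0n R k).
have [J hJ cJ] := is_integral_Ny_cvgL2 (X := fun t => B (time_change H t)) lB hI.
exists (fun m w => expR (- alpha * k%:R) * J m w).
  by move=> m; apply: (fou2_limit _ (hJ m)); rewrite subrK.
have [h1 h2 h3] := cvgL2_lin (expR (- alpha * k%:R)) 0 cJ cJ.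
have e1 (x : R) : expR (- alpha * k%:R) * x + 0 * x = expR (- alpha * k%:R) * x.
  by rewrite mul0r addr0.
split=> [n||].
- by apply: eq_L2 (h1 n) => w; rewrite e1.
- by apply: eq_L2 h2 => w; rewrite e1 eU.
by apply: cvgn_ext h3 => n; apply: eq_esp => w; rewrite !e1 eU.
Qed.

(* The closure is taken twice: the left endpoint tends to [-oo] after the mesh tends to 0. *)
Lemma stationary_fou2_gaussian (k : nat) : L2_closure P (L2_closure P G) (Ualpha k%:R).
Proof.
have [Z hZ cZ] := stationary_fou2_cvgL2 k; exists Z => // m; exists (V k m) => //.
Qed.

Lemma cvgn_abs_le (u : nat -> R) (l b : R) : u n @[n --> \oo] --> l ->
  (forall n, `|u n| <= b) -> `|l| <= b.
Proof. by move=> ul ub; apply: (cvgn_le_cst (cvg_norm ul)). Qed.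

Lemma stationary_fou2_cov_le (k l : nat) :
  `|E (fun w => Ualpha k%:R w * Ualpha l%:R w)| <= C * expR (- (c * `|k%:R - l%:R|)).
Proof.
have [Z hZ cZ] := stationary_fou2_cvgL2 k; have [Z' hZ' cZ'] := stationary_fou2_cvgL2 l.
apply: (cvgn_abs_le (cvgL2_inner cZ cZ')) => m.
apply: (cvgn_abs_le (cvgL2_inner (hZ m) (hZ' m))) => n.
exact: discounted_sum_lamperti_cov_le.
Qed.

Lemma stationary_fou2_variance (k : nat) :
  E (fun w => Ualpha k%:R w ^+ 2) = nu2 H alpha + 1.
Proof.
have [Z hZ cZ] := stationary_fou2_cvgL2 k.
have [D [dD D0 Doo]] := fou2_cov_primitive hH alpha0.
(* Cauchy-Schwarz for the stationary process gives the maximum at 0 without analysing the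
   formula. *)
have rho_le w : `|fou2_cov H w| <= fou2_cov H 0.
  have l s := gs_L2 hG (lamperti_span s).
  have := abs_esp (intgM (l w) (l 0)); rewrite lamperti_cov subr0 => /le_trans; apply.
  apply: le_trans (esp_normM_le (l w) (l 0)) _.
  have e2 s : E (fun x => lamperti s x ^+ 2) = fou2_cov H 0.
    by rewrite -(subrr s) -lamperti_cov; apply: eq_esp => x; rewrite expr2.
  by rewrite !e2 -expr2 sqr_sqrtr// fou2_cov_ge0.
pose e := variance_error alpha (fou2_cov H).
have hm m : `|E (fun w => Z m.+1 w ^+ 2) - (fou2_cov H 0 + D m.+1%:R / alpha)| <=
    e * expR (- (alpha * m.+1%:R)).
  have [u cu hu] := discrete_variance_bound alpha0 (fou2_covN H) rho_le (fou2_cov_continuous hH) dD D0 m.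
  have cV := cvgL2_inner (hZ m.+1) (hZ m.+1).
  rewrite (eq_esp P (Y := fun w => Z m.+1 w * Z m.+1 w)); last by move=> w; rewrite expr2.
  apply: (cvgn_abs_le (cvgB cV cu)) => n /=.
  rewrite (eq_esp P (Y := fun w => V k m.+1 n w ^+ 2)); last by move=> w; rewrite expr2.
  rewrite /V (discounted_sum_variance hG alpha lamperti_span lamperti_cov (fou2_covN H)).
  exact: hu.
have cexp : e * expR (- (alpha * m.+1%:R)) @[m --> \oo] --> (0 : R).
  apply: (@cvgn0_squeeze _ _ (fun m => `|e| / alpha * m.+1%:R^-1)); last exact: cvgn_scale_harmonic.
  move=> m; rewrite normrM -mulrA ler_wpM2l// gtr0_norm ?expR_gt0// expRN -invfM lef_pV2 ?posrE ?expR_gt0//.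
    by apply: le_trans (expR_ge1Dx _); rewrite lerDr.
  by rewrite mulr_gt0.
have c1' := cvgn0_squeeze hm cexp.
have c2 : fou2_cov H 0 + D m.+1%:R / alpha @[m --> \oo] --> nu2 H alpha + 1.
  (* The value [K] of the covariance at 0 cancels against the [- alpha K] in the limit of [D],
     leaving the Beta term alone. *)
  rewrite fou2_cov0// (_ : nu2 H alpha + 1 = K + ((2 * H - 1) * K * Beta (1 - H + alpha * H) (2 * H - 1) - alpha * K) / alpha); last first.
    by rewrite /nu2 /K; field; rewrite gt_eqF.
  apply: cvgD; first exact: cvg_cst.
  apply: cvgM; last exact: cvg_cst.
  by have := Doo; rewrite -cvg_shiftS.
have [_ _ _] := cZ.
have c3 := cvgL2_inner cZ cZ.
rewrite (eq_esp P (Y := fun w => Ualpha k%:R w * Ualpha k%:R w)); last by move=> w; rewrite expr2.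
have c4 : E (fun w => Z m.+1 w * Z m.+1 w) @[m --> \oo] --> E (fun w => Ualpha k%:R w * Ualpha k%:R w).
  by have := c3; rewrite -cvg_shiftS.
apply: (cvgn_unique c4).
rewrite -[X in _ --> X]add0r; apply: cvgn_ext (cvgD c1' c2) => m /=.
rewrite subrK; apply: eq_esp => w; by rewrite expr2.
Qed.

(** At time [k] both variables are limits of discounted sums with right endpoint [k]: [k] units of
    length for [U], arbitrarily many for [Ualpha]. Their distance is a limit of tails. *)
Lemma fou2_stationary_dist (k : nat) :
  E (fun w => (U k%:R w - Ualpha k%:R w) ^+ 2) <= C * expR (- (alpha * k%:R)).
Proof.
have [Z hZ cZ] := stationary_fou2_cvgL2 k.
have cU := fou2_cvgL2 k.
have lU : L2 P (U k%:R) by case: cU.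
have sq X Y : E (fun w => (X w - Y w) ^+ 2) =
   E (fun w => (1 * X w + -1 * Y w) * (1 * X w + -1 * Y w)) by apply: eq_esp => w; ring.
have cU' := cvgL2_cst lU.
have sh : cvgL2 P (fun m => Z (k + m)%N) (Ualpha k%:R).
  have [h1 h2 h3] := cZ; split=> //.
  have := h3; rewrite -(cvg_shiftn k); apply: cvg_trans; apply: near_eq_cvg; apply: nearW => m /=.
  by rewrite addnC.
rewrite (eq_esp P (Y := fun w => (Ualpha k%:R w - U k%:R w) ^+ 2)); last by move=> w; ring.
rewrite sq.
have l1 := cvgL2_lin 1 (-1) sh cU'.
apply: (cvgn_le_cst (cvgL2_inner l1 l1)) => m.
have l2 := cvgL2_lin 1 (-1) (hZ (k + m)%N) cU.
apply: (cvgn_le_cst (cvgL2_inner l2 l2)) => n.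
by rewrite -sq; exact: discounted_sum_lamperti_tail_le.
Qed.

End stationary_transform.

(** * The estimator *)

Section two_sided_geometric.
Context {R : realType}.

(** Splitting at [i] leaves two one-sided geometric sums, hence the 2. *)
Lemma sum_exp_dist_le (c : R) (n : nat) (i : 'I_n) : 0 < c ->
  \sum_(j < n) expR (- (c * `|i%:R - j%:R|)) <= 2 / (1 - expR (- c)).
Proof.
move=> c0; set x := expR (- c).
have x0 : 0 < x by exact: expR_gt0.
have x1 : 0 < 1 - x by rewrite subr_gt0 -expR0 ltr_expR oppr_lt0.
have iN := ltn_ord i.
rewrite -(big_mkord predT (fun j => expR (- (c * `|i%:R - j%:R|)))).
rewrite (@big_cat_nat _ _ _ i)//=; last exact: ltnW.
rewrite (_ : 2 / (1 - x) = (1 - x)^-1 + (1 - x)^-1); last by field; rewrite gt_eqF.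
apply: lerD.
  rewrite big_nat_rev/= add0n big_mkord.
  apply: le_trans (geometric_sum_le i (ltW x0) x1); apply: ler_sum => j _.
  have ji := ltn_ord j.
  rewrite /x -expRM_natl ler_expR mulrN lerN2 mulrC ler_wpM2l ?(ltW c0)//.
  rewrite natrB// opprB addrC subrK ger0_norm ?ler0n//.
  by rewrite ler_nat.
rewrite -{1}[nat_of_ord i]add0n big_addn big_mkord.
apply: le_trans (geometric_sum_le (n - i) (ltW x0) x1); apply: ler_sum => j _.
rewrite /x -expRM_natl ler_expR mulrN lerN2 mulrC ler_wpM2l ?(ltW c0)//.
by rewrite natrD opprD addrCA addrN addr0 normrN ger0_norm ?ler0n.
Qed.

End two_sided_geometric.

(** * From the stationary process to the estimator *)

Section assembly.
Context {d : measure_display} {T : measurableType d} {R : realType}.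
Variable P : probability T R.
Local Notation E := (esp P).

(** [X^2 - Y^2] factors as [(X - Y) (X + Y)], and [(X + Y)^2 <= 2 (X - Y)^2 + 8 Y^2], the difference
    being [(X - 3 Y)^2]. The bound thus involves only the distance and the moment of [Y], the two
    quantities known for [U] and [Ualpha]. *)
Lemma esp_abs_sqrB_le (X Y : T -> R) : L2 P X -> L2 P Y ->
  E (fun w => `|X w ^+ 2 - Y w ^+ 2|) <= Num.sqrt (E (fun w => (X w - Y w) ^+ 2)) *
    Num.sqrt (2 * E (fun w => (X w - Y w) ^+ 2) + 8 * E (fun w => Y w ^+ 2)).
Proof.
move=> lX lY; have lB := L2B lX lY; have lD := L2D lX lY.
rewrite (eq_esp P (Y := fun w => `|(X w - Y w) * (X w + Y w)|)); last first.
  by move=> w; congr `|_|; ring.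
apply: le_trans (esp_normM_le lB lD) _; rewrite ler_wpM2l ?sqrtr_ge0//.
apply: ler_wsqrtr; rewrite -!espZ; [|exact: L2_sq|exact: L2_sq].
have i1 := intgZ 2 (L2_sq lB); have i2 := intgZ 8 (L2_sq lY).
rewrite -espD//; apply: esp_le; [exact: L2_sq|exact: intgD|].
move=> w; rewrite -subr_ge0 (_ : _ - _ = (X w - 3 * Y w) ^+ 2) ?sqr_ge0//; ring.
Qed.

Variables (H alpha : R).
Hypothesis hH : 1 / 2 < H < 1.
Hypothesis alpha0 : 0 < alpha.
Local Notation c := (fou2_rate H alpha).
Local Notation C := (fou2_cov_bound H alpha).
Local Notation s2 := (nu2 H alpha + 1).

Let s20 : 0 < s2. Proof. by have := nu2_gtN1 hH alpha0; lra. Qed.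
Let c0 : 0 < c. Proof. exact: fou2_rate_gt0. Qed.
Let C0 : 0 <= C. Proof. exact: fou2_cov_bound_ge0. Qed.

(** The first summand pays for replacing [U] by [Ualpha]: a geometric series in [exp (- alpha / 2)],
    the square root of the decay of the squared distance, over the lower bound [sqrt 2 * s2] of
    [sqrt (v2 / n)]. The second is [quadratic_clt] with row sums bounded by
    [C * 2 / (1 - exp (- c))]. *)
Definition berry_esseen_bound : R :=
  Num.sqrt C * Num.sqrt (2 * C + 8 * s2) / (1 - expR (- (alpha / 2))) / (Num.sqrt 2 * s2)
  + 8 * ((C * (2 / (1 - expR (- c)))) ^+ 2 / s2 ^+ 2).

Variables (B U Ualpha : R -> {RV P >-> R}).
Hypothesis hB : fractional_brownian_motion H B.
Hypothesis hU : fOU2 H alpha B U.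
Hypothesis hUa : stationary_fOU2 H alpha B Ualpha.
Variable n : nat.
Hypothesis n0 : (0 < n)%N.

Let X (i : 'I_n) : T -> R := Ualpha i%:R.
Let G := L2_closure P (L2_closure P (fbm_span B)).
Let hG : gaussian_space P G.
Proof. exact: L2_closure_gaussian (L2_closure_gaussian (fbm_span_gaussian hB)). Qed.
Let gUa k : G (Ualpha k%:R).
Proof. exact: stationary_fou2_gaussian hUa k. Qed.
Let gX i : G (X i). Proof. exact: gUa. Qed.
Local Notation S := (sumsq X).
Let v2 := E (fun w => (S w - E S) ^+ 2).
Let lUa k : L2 P (Ualpha k%:R). Proof. exact: (gs_L2 hG (gUa k)). Qed.
Let lU k : L2 P (U k%:R).
Proof. by have [] := fou2_cvgL2 hH hB hU k. Qed.
Let nR0 : 0 < n%:R :> R. Proof. by rewrite ltr0n. Qed.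

Let ES : E S = n%:R * s2.
Proof.
rewrite /sumsq esp_sum; last by move=> i _; exact: L2_sq (lUa i).
rewrite (eq_bigr (fun=> s2)); last by move=> i _; exact: stationary_fou2_variance hUa i.
by rewrite sumr_const card_ord [RHS]mulr_natl.
Qed.

Let lS : L2 P S. Proof. exact: (sumsq_L2 hG gX). Qed.

Let v2_ge : 2 * (n%:R * s2 ^+ 2) <= v2.
Proof.
apply: (var_sumsq_ge hG gX) => i; rewrite -(stationary_fou2_variance hH hB alpha0 hUa i).
by apply: eq_esp => w; rewrite expr2.
Qed.

Let v20 : 0 < v2.
Proof. by apply: lt_le_trans v2_ge; rewrite !mulr_gt0// exprn_gt0. Qed.

Let V2E : fine ('E_P[fun w' => (V2 P n Ualpha w' ^+ 2)%R])%E = v2 / n%:R.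
Proof.
rewrite expectationE -espE.
rewrite (eq_esp P (Y := fun w => n%:R^-1 * (S w - E S) ^+ 2)).
  have iSS : intg P (fun w => (S w - E S) ^+ 2) by exact: L2_sq (L2B lS (L2_cst P _)).
  by rewrite (espZ _ iSS) mulrC.
move=> w; rewrite /V2 exprMn exprVn sqr_sqrtr ?ler0n//; congr (_ * _ ^+ 2).
rewrite big_mkord sumrB; congr (_ - _).
rewrite ES -[in RHS](card_ord n) -sum1_card natr_sum mulr_suml.
apply: eq_bigr => i _; rewrite mul1r expectationE -espE.
exact: stationary_fou2_variance hUa i.
Qed.

Let FU w := (Num.sqrt v2)^-1 * (\sum_(k < n) U k%:R w ^+ 2 - n%:R * s2).
Let FV w := (Num.sqrt v2)^-1 * (S w - E S).

Let FUE w : Num.sqrt (n%:R / fine ('E_P[fun w' => (V2 P n Ualpha w' ^+ 2)%R])%E)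
   * (nu2 H (alpha_hat H n U w) - nu2 H alpha) = FU w.
Proof.
rewrite V2E /alpha_hat nu2_nu2_inv//; last first.
  rewrite /Q2 ler_pdivlMl// mulrN1 -[leLHS]add0r lerBlDr.
  rewrite big_mkord sumrB sumr_const card_ord subrK.
  by apply: sumr_ge0 => k _; exact: sqr_ge0.
rewrite invf_div mulrA -expr2 sqrtrM ?sqr_ge0// sqrtr_sqr ger0_norm ?ler0n// sqrtrV ?(ltW v20)//.
rewrite /FU /Q2 big_mkord sumrB sumr_const card_ord.
move: (\sum_(k < n) _) => s; have := sqrtr_gt0 v2; rewrite v20 => sv0.
field; by rewrite !gt_eqF.
Qed.

Let iFU : intg P FU.
Proof.
apply: intgZ; apply: intgB; last exact: intg_cst.
by apply: intg_sum => k _; exact: L2_sq (lU k).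
Qed.

Let iFV : intg P FV.
Proof. by apply: intgZ; apply: intgB; [exact: L2_intg|exact: intg_cst]. Qed.

Let dFUV : E (fun w => `|FU w - FV w|) <=
  Num.sqrt C * Num.sqrt (2 * C + 8 * s2) / (1 - expR (- (alpha / 2))) / (Num.sqrt 2 * s2) / Num.sqrt n%:R.
Proof.
set k1 := Num.sqrt C * Num.sqrt (2 * C + 8 * s2).
have ha : 0 < 1 - expR (- (alpha / 2)) by rewrite subr_gt0 -expR0 ltr_expR oppr_lt0 divr_gt0.
have ik (k : 'I_n) : intg P (fun w => `|U k%:R w ^+ 2 - Ualpha k%:R w ^+ 2|).
  by apply: intg_abs; apply: intgB; apply: L2_sq.
have sv0 : 0 < Num.sqrt v2 by rewrite sqrtr_gt0.
apply: (@le_trans _ _ ((Num.sqrt v2)^-1 * \sum_(k < n) E (fun w => `|U k%:R w ^+ 2 - Ualpha k%:R w ^+ 2|))).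
  rewrite -esp_sum// -espZ; last exact: intg_sum.
  apply: esp_le; [apply: intg_abs; exact: intgB|apply: intgZ; exact: intg_sum|].
  move=> w; rewrite /FU /FV ES -mulrBr normrM ger0_norm ?invr_ge0 ?(ltW sv0)//.
  rewrite ler_wpM2l ?invr_ge0 ?(ltW sv0)// opprB addrA subrK /sumsq -sumrB.
  exact: ler_norm_sum.
have h1 (k : 'I_n) : E (fun w => `|U k%:R w ^+ 2 - Ualpha k%:R w ^+ 2|) <= k1 * expR (- (alpha / 2)) ^+ k.
  apply: le_trans (esp_abs_sqrB_le (lU k) (lUa k)) _.
  rewrite (stationary_fou2_variance hH hB alpha0 hUa).
  have := fou2_stationary_dist hH hB alpha0 hU hUa k.
  set dk := E _ => hdk.
  have dk0 : 0 <= dk by apply: esp_ge0 => w; exact: sqr_ge0.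
  rewrite /k1 mulrAC; apply: ler_pM; rewrite ?sqrtr_ge0//.
    apply: le_trans (ler_wsqrtr hdk) _; rewrite sqrtrM// ler_wpM2l ?sqrtr_ge0//.
    have -> : expR (- (alpha * k%:R)) = (expR (- (alpha / 2)) ^+ k) ^+ 2.
      by rewrite -exprM -expRM_natl; congr expR; rewrite natrM; field.
    by rewrite sqrtr_sqr ger0_norm// exprn_ge0// expR_ge0.
  apply: ler_wsqrtr; rewrite lerD2r ler_wpM2l//; apply: le_trans hdk _.
  by rewrite ler_piMr// -expR0 ler_expR oppr_le0 mulr_ge0// ltW.
have h2 : \sum_(k < n) E (fun w => `|U k%:R w ^+ 2 - Ualpha k%:R w ^+ 2|) <= k1 / (1 - expR (- (alpha / 2))).
  apply: le_trans (ler_sum _ (fun k _ => h1 k)) _; rewrite -mulr_sumr ler_wpM2l ?mulr_ge0 ?sqrtr_ge0//.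
  by apply: geometric_sum_le => //; exact: expR_ge0.
have h3 : Num.sqrt 2 * s2 * Num.sqrt n%:R <= Num.sqrt v2.
  apply: le_trans (ler_wsqrtr v2_ge).
  rewrite sqrtrM// sqrtrM ?ler0n// sqrtr_sqr (ger0_norm (ltW s20)).
  by rewrite mulrAC -mulrA.
have p3 : 0 < Num.sqrt 2 * s2 * Num.sqrt n%:R by rewrite !mulr_gt0 ?sqrtr_gt0.
rewrite -[leRHS]mulrA -invfM [leRHS]mulrC; apply: ler_pM => //.
- by apply: sumr_ge0 => k _; apply: esp_ge0.
by rewrite lef_pV2 ?posrE.
Qed.

(** The stationary statistic [FV] is interposed between [FU] and the normal law. Integrability is
    returned as well, because the Wasserstein distance is built on extended expectations. *)
Lemma esp_lip_estimator_le (f : R -> R) : (forall x y, `|f x - f y| <= `|x - y|) ->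
  intg P (fun w => f (FU w)) /\
  `|E (fun w => f (FU w)) - esp (normal_prob (0 : R) 1) f| <= berry_esseen_bound / Num.sqrt n%:R.
Proof.
move=> lipf; have cf := lip_continuous lipf.
have mf Z : measurable_fun setT Z -> measurable_fun setT (fun w : T => f (Z w)).
  by move=> mZ; apply: measurableT_comp mZ; exact: cts_meas.
have if_ Z : intg P Z -> intg P (fun w => f (Z w)).
  move=> iZ; apply: (@intg_dom _ _ _ P _ (fun w => `|f 0| + `|Z w|)).
  - exact: mf (intg_meas iZ).
  - move=> w; have := lipf (Z w) 0; rewrite subr0 => h.
    by rewrite -(subrK (f 0) (f (Z w))) addrC (le_trans (ler_normD _ _))// lerD2l.
  by apply: intgD; [exact: intg_cst|exact: intg_abs].
split; first exact: if_.
rewrite -(subrK (E (fun w => f (FV w))) (E (fun w => f (FU w)))) -addrA.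
apply: le_trans (ler_normD _ _) _; rewrite /berry_esseen_bound mulrDl; apply: lerD.
  apply: le_trans dFUV; rewrite -espB; [|exact: if_|exact: if_].
  have iB := intgB (if_ _ iFU) (if_ _ iFV).
  apply: abs_esp_le; [exact: intg_meas iB|apply: intg_abs; exact: intgB|by move=> w; exact: lipf].
apply: (quadratic_clt hG gX n0 s20 lipf) => i.
  rewrite -(stationary_fou2_variance hH hB alpha0 hUa i).
  by apply: eq_esp => w; rewrite expr2.
apply: (@le_trans _ _ (\sum_(j < n) C * expR (- (c * `|i%:R - j%:R|)))).
  by apply: ler_sum => j _; exact: stationary_fou2_cov_le hUa i j.
by rewrite -mulr_sumr ler_wpM2l//; exact: sum_exp_dist_le.
Qed.

Lemma wasserstein_estimator_le (d' : measure_display) (T' : measurableType d')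
    (P' : probability T' R) (N : {RV P' >-> R}) : is_normal P' N 0 1 ->
  (wasserstein P P'
     (fun w => Num.sqrt (n%:R / fine ('E_P[fun w' => (V2 P n Ualpha w' ^+ 2)%R]))
               * (nu2 H (alpha_hat H n U w) - nu2 H alpha))%R N
   <= (berry_esseen_bound / Num.sqrt n%:R)%:E)%E.
Proof.
move=> hN; rewrite (funext FUE); apply: ge_ereal_sup => _ [f lipf <-].
have lip x y : `|f x - f y| <= `|x - y|.
  by have := lipf (x, y); rewrite /= mul1r; apply.
have [iF hF] := esp_lip_estimator_le lip.
have mN : measurable_fun setT (N : T' -> R) by exact: measurable_funPT.
have lawN (A : set R) : measurable A -> P' (N @^-1` A) = normal_prob 0 1 A.
  by move=> mA; rewrite (hN A mA) oner_eq0.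
have mf : measurable_fun setT f by apply: cts_meas; exact: lip_continuous.
have iN : intg P' (fun w => f (N w)).
  by apply/(@intg_law _ _ _ _ _ P' (normal_prob (0 : R) 1) N mN lawN f mf); exact: lip_intg_normal.
have eN := @esp_law _ _ _ _ _ P' (normal_prob (0 : R) 1) N mN lawN f mf iN.
rewrite !expectationE (espEE iF) (espEE iN) eN -EFinB abse_EFin lee_fin.
exact: hF.
Qed.

End assembly.

Theorem theorem25 (R : realType) (H alpha : R)
    (hH : 1 / 2 < H < 1) (halpha : 0 < alpha) :
  exists C : R,
    forall (d : measure_display) (T : measurableType d) (P : probability T R)
      (B U Ualpha : R -> {RV P >-> R})
      (d' : measure_display) (T' : measurableType d') (P' : probability T' R)
      (N : {RV P' >-> R}),
    fractional_brownian_motion H B ->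
    fOU2 H alpha B U ->
    stationary_fOU2 H alpha B Ualpha ->
    is_normal P' N 0 1 ->
    forall n : nat, (0 < n)%N ->
      (wasserstein P P'
         (fun w => Num.sqrt (n%:R / fine ('E_P[fun w' => (V2 P n Ualpha w' ^+ 2)%R]))
                   * (nu2 H (alpha_hat H n U w) - nu2 H alpha))%R
         N
       <= (C / Num.sqrt n%:R)%:E)%E.
Proof.
exists (berry_esseen_bound H alpha) => d T P B U Ualpha d' T' P' N hB hU hUa hN n n0.
exact: (wasserstein_estimator_le hH halpha hB hU hUa n0).
Qed.
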